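(* Let $\mathcal G$ be a metric graph with $\#\mathfrak C_0(\mathcal G)<\infty$. Then the Neumann extension $\mathbf H_N$ is given as the restriction $\mathbf H_N=\mathbf H|_{\mathrm{dom}(\mathbf H_N)}$ of the maximal Kirchhoff Laplacian $\mathbf H$ to the domain $$\mathrm{dom}(\mathbf H_N)=\{f\in\mathrm{dom}(\mathbf H)\cap H^1(\mathcal G)\,:\,\Gamma_1f=0\},$$ where $\Gamma_1f=(\partial_nf(\gamma))_{\gamma\in\mathfrak C_0(\mathcal G)}$ is the vector of normal derivatives of $f$ at the finite volume ends.
   Context: Metric graphs. Let $\mathcal G_d=(\mathcal V,\mathcal E)$ be an unoriented graph with countably infinite vertex and edge sets which is locally finite (each vertex $v$ has finite degree $\deg(v)$), connected and simple (no loops or multiple edges). Given edge lengths $|e|\in(0,\infty)$, $e\in\mathcal E$, the metric graph $\mathcal G=(\mathcal G_d,|\cdot|)$ is the topological space obtained by identifying each edge $e$ with the interval $[0,|e|]$ and gluing together endpoints corresponding to the same vertex. It carries the natural path metric and the Lebesgue measure on its edges, denoted $\mathrm{vol}$. $\mathcal E_v$ is the set of edges incident to $v$; a function $f$ on $\mathcal G$ has edge components $f_e=f|_e$; $f_e'(v)$ denotes the derivative of $f_e$ at the vertex $v$ of $e$ taken in the direction pointing from $v$ into $e$. $L^2(\mathcal G)=\bigoplus_{e}L^2(e)$. Ends. Consider sequences $(U_n)_{n\ge0}$ of non-empty open connected subsets of $\mathcal G$ with compact boundaries, $U_{n+1}\subseteq U_n$ and $\bigcap_n\overline{U_n}=\emptyset$.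 Two such sequences $(U_n),(U_n')$ are equivalent if for every $n$ there are $j,k$ with $U_n\supseteq U_j'$ and $U_n'\supseteq U_k$. Equivalence classes are called topological ends of $\mathcal G$. A topological end $\gamma$ has finite volume if there is a sequence $(U_n)$ representing $\gamma$ with $\mathrm{vol}(U_n)<\infty$ for some $n$; $\mathfrak C_0(\mathcal G)$ is the set of finite volume ends. Operators and spaces. The maximal Kirchhoff Laplacian $\mathbf H$ in $L^2(\mathcal G)$ acts by $f\mapsto -f''$ edgewise on the domain of all $f\in L^2(\mathcal G)$ with $f_e\in H^2(e)$ for all $e$, $f''\in L^2(\mathcal G)$, and satisfying at every vertex $v$ the Kirchhoff conditions: $f$ is continuous at $v$ and $\sum_{e\in\mathcal E_v}f_e'(v)=0$. $H^1(\mathcal G)$ is the space of continuous $f\in L^2(\mathcal G)$ with $f_e\in H^1(e)$ for all $e$ and $\|f'\|_{L^2(\mathcal G)}^2=\sum_e\|f_e'\|^2_{L^2(e)}<\infty$. The Neumann extension $\mathbf H_N$ is the self-adjoint operator in $L^2(\mathcal G)$ associated with the closed non-negative form $\mathfrak t_N[f]=\int_{\mathcal G}|f'(x)|^2dx$, $\mathrm{dom}(\mathfrak t_N)=H^1(\mathcal G)$. Normal derivatives. For a connected subgraph $\widetilde{\mathcal G}=(\widetilde{\mathcal V},\widetilde{\mathcal E})$ (viewed as a closed subset of $\mathcal G$) put $\partial\widetilde{\mathcal G}=\{v\in\widetilde{\mathcal V}:\deg_{\widetilde{\mathcal G}}(v)<\deg_{\mathcal G}(v)\}$ and, for $v\in\partial\widetilde{\mathcal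 G}$, $\frac{\partial f}{\partial n_{\widetilde{\mathcal G}}}(v)=\sum_{e\in\mathcal E_v\cap\widetilde{\mathcal E}}f_e'(v)$. A graph representation of an end $\gamma$ is a sequence $(\mathcal G_k)$ of connected subgraphs with $\mathcal G_k\supseteq\mathcal G_{k+1}$, $\#\partial\mathcal G_k<\infty$, such that for some $(U_n)$ representing $\gamma$, for each $n$ there are $j,k$ with $\mathcal G_n\supseteq U_j$ and $U_n\supseteq\mathcal G_k$. If $\#\mathfrak C_0(\mathcal G)<\infty$, then for $\gamma\in\mathfrak C_0(\mathcal G)$ and $f\in\mathrm{dom}(\mathbf H)$ the normal derivative is $\partial_nf(\gamma):=\lim_{k\to\infty}\sum_{v\in\partial\mathcal G_k}\frac{\partial f}{\partial n_{\mathcal G_k}}(v)$ for any graph representation $(\mathcal G_k)$ of $\gamma$ (the limit exists and is independent of the representation). *)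

(* Defs.v *)
From HB Require Import structures.
From mathcomp Require Import all_boot all_order all_algebra finmap.
From mathcomp Require Import generic_quotient.
From mathcomp Require Import complex.
From mathcomp Require Import all_classical all_reals all_analysis.

Set Implicit Arguments.
Unset Strict Implicit.
Unset Printing Implicit Defensive.

Import Order.TTheory GRing.Theory Num.Theory.
Import numFieldTopology.Exports numFieldNormedType.Exports.

Local Open Scope classical_set_scope.
Local Open Scope ring_scope.
Local Open Scope quotient_scope.

(** The graph is unoriented: [src] and [tgt] only fix the identification of
    each edge [e] with the interval from 0 to [len e], the endpoint 0 being
    [src e] and the endpoint [len e] being [tgt e]. *)

Definition joins (V E : Type) (src tgt : E -> V) (e : E) (v w : V) : Prop :=
  (src e = v /\ tgt e = w) \/ (src e = w /\ tgt e = v).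

Definition path_connected (V E : eqType) (src tgt : E -> V)
    (VS : set V) (ES : set E) : Prop :=
  forall v w, VS v -> VS w ->
    exists p : seq V,
      path (fun a b => `[< exists2 e, ES e & joins src tgt e a b >]) v p
      /\ last v p = w.

Record metricGraph (R : realType) := MetricGraph {
  vertex : countType ;
  edge : countType ;
  src : edge -> vertex ;
  tgt : edge -> vertex ;
  len : edge -> R ;
  infinite_vertices : infinite_set [set: vertex] ;
  infinite_edges : infinite_set [set: edge] ;
  loopless : forall e, src e != tgt e ;
  no_multiple_edges : forall e e' v w,
    joins src tgt e v w -> joins src tgt e' v w -> e = e' ;
  locally_finite : forall v, finite_set [set e | src e = v \/ tgt e = v] ;
  graph_connected : path_connected src tgt [set: vertex] [set: edge] ;
  len_gt0 : forall e, 0 < len e }.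

Section MetricGraphTopology.
Context {R : realType} (G : metricGraph R).

Definition edge_union : Type := {e : edge G & set_type `[0, len e]}.
HB.instance Definition _ := Topological.on edge_union.

Definition end_vertex (p : edge_union) : option (vertex G) :=
  let: existT e x := p in
  if set_val x == 0 then Some (src e)
  else if set_val x == len e then Some (tgt e) else None.

Definition glue (p q : edge_union) : bool :=
  (p == q) || ((end_vertex p != None) && (end_vertex p == end_vertex q)).

Lemma glue_refl : reflexive glue.
Proof. by move=> p; rewrite /glue eqxx. Qed.

Lemma glue_sym : symmetric glue.
Proof.
move=> p q; rewrite /glue (eq_sym p) (eq_sym (end_vertex p) (end_vertex q)).
by case: (end_vertex q =P end_vertex p) => [->|_] //; rewrite !andbF.
Qed.

Lemma glue_trans : transitive glue.
Proof.
move=> q p r /orP[/eqP->//|/andP[p0 /eqP pq]] /orP[/eqP<-|/andP[_ /eqP qr]].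
  by rewrite /glue p0 pq eqxx orbT.
by rewrite /glue p0 pq qr eqxx orbT.
Qed.

Canonical glue_equiv := EquivRel glue glue_refl glue_sym glue_trans.

Definition mgraph : Type := quotient_topology {eq_quot glue}.
HB.instance Definition _ := Topological.on mgraph.
HB.instance Definition _ := Quotient.on mgraph.

Lemma left_endpoint_subproof (e : edge G) : (0 : R) \in `[0, len e]%classic.
Proof. by rewrite inE /= in_itv /= lexx ltW ?len_gt0. Qed.

(** The point of [G] at coordinate [x] of [e], for [0 <= x <= len e]; outside
    this range the value is irrelevant. *)
Definition edge_pt (e : edge G) (x : R) : mgraph :=
  \pi_mgraph (existT _ e
    (insubd (exist _ 0 (left_endpoint_subproof e) : set_type `[0, len e]) x)
    : edge_union).

(** [vol] is only applied to open sets. *)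
Definition vol (A : set mgraph) : \bar R :=
  \esum_(e in [set: edge G])
    lebesgue_measure ([set x : R | `[0, len e]%classic x /\ A (edge_pt e x)]).

End MetricGraphTopology.

Section Ends.
Context {R : realType} (G : metricGraph R).
Implicit Types U : nat -> set (mgraph G).

Definition boundary (T : topologicalType) (A : set T) : set T :=
  closure A `\` interior A.

Definition end_sequence U : Prop :=
  [/\ forall n, [/\ U n !=set0, open (U n), connected (U n)
                  & compact (boundary (U n))],
      forall n, U n.+1 `<=` U n
    & \bigcap_n closure (U n) = set0].

Definition end_equiv U U' : Prop :=
  forall n, exists j k, U' j `<=` U n /\ U k `<=` U' n.

(** An end is the equivalence class itself, as a set of sequences. *)
Definition topological_end : set (set (nat -> set (mgraph G))) :=
  [set gamma | exists2 U, end_sequence U &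
     gamma = [set U' | end_sequence U' /\ end_equiv U U']].

Definition finite_volume_end : set (set (nat -> set (mgraph G))) :=
  [set gamma | topological_end gamma /\
     exists2 U, gamma U & exists n, (vol (U n) < +oo)%E].

End Ends.

Section Subgraphs.
Context {R : realType} (G : metricGraph R).

Definition incident (v : vertex G) : set (edge G) :=
  [set e | src e = v \/ tgt e = v].

Record subgraph := Subgraph {
  sub_vertex : set (vertex G) ;
  sub_edge : set (edge G) ;
  sub_endpoints : forall e, sub_edge e ->
    sub_vertex (src e) /\ sub_vertex (tgt e) }.

Definition connected_subgraph (S : subgraph) : Prop :=
  path_connected (@src R G) (@tgt R G) (sub_vertex S) (sub_edge S).

Definition sub_points (S : subgraph) : set (mgraph G) :=
  [set p | exists e x, [/\ `[0, len e]%classic x, p = edge_pt e x &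
     [\/ sub_edge S e, x = 0 /\ sub_vertex S (src e)
       | x = len e /\ sub_vertex S (tgt e)]]].

Definition degree (v : vertex G) : nat := #|` fset_set (incident v)|.

Definition sub_degree (S : subgraph) (v : vertex G) : nat :=
  #|` fset_set (incident v `&` sub_edge S)|.

Definition sub_boundary (S : subgraph) : set (vertex G) :=
  [set v | sub_vertex S v /\ (sub_degree S v < degree v)%N].

Definition graph_representation (gamma : set (nat -> set (mgraph G)))
    (S : nat -> subgraph) : Prop :=
  [/\ forall k, connected_subgraph (S k),
      forall k, sub_points (S k.+1) `<=` sub_points (S k),
      forall k, finite_set (sub_boundary (S k))
    & exists2 U, gamma U & forall n, exists j k,
        U j `<=` sub_points (S n) /\ sub_points (S k) `<=` U n].

End Subgraphs.

Section L2.
Context {R : realType} (G : metricGraph R).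
Local Notation C := (R[i]).
Local Notation mu := (@lebesgue_measure R).

Definition normsq (z : C) : R := complex.Re z ^+ 2 + complex.Im z ^+ 2.

Definition cintegral (a b : R) (f : R -> C) : C :=
  Complex (\int[mu]_(x in `[a, b]) complex.Re (f x))
          (\int[mu]_(x in `[a, b]) complex.Im (f x)).

Definition cmeasurable (l : R) (f : R -> C) : Prop :=
  measurable_fun `[0, l] (fun x => complex.Re (f x)) /\
  measurable_fun `[0, l] (fun x => complex.Im (f x)).

Definition sqint (l : R) (f : R -> C) : Prop :=
  cmeasurable l f /\ (\int[mu]_(x in `[0%R, l]) (normsq (f x))%:E < +oo)%E.

(** Families [f] of functions on the edges, [f e x] being the value at
    coordinate [x] of [e]. *)
Record l2fun := L2Fun {
  l2val :> edge G -> R -> C ;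
  l2_measurable : forall e, cmeasurable (len e) (l2val e) ;
  l2_finite : (\esum_(e in [set: edge G])
    \int[mu]_(x in `[0%R, len e]) (normsq (l2val e x))%:E < +oo)%E }.

HB.instance Definition _ := gen_eqMixin l2fun.
HB.instance Definition _ := gen_choiceMixin l2fun.

Definition l2_ae_eq (f g : l2fun) : bool :=
  `[< forall e, f e = g e %[ae mu in `[0, len e]%classic] >].

Lemma l2_ae_eq_refl : reflexive l2_ae_eq.
Proof. by move=> f; apply/asboolP => e; exact: ae_eq_refl. Qed.

Lemma l2_ae_eq_sym : symmetric l2_ae_eq.
Proof.
by move=> f g; apply/idP/idP => /asboolP fg; apply/asboolP => e;
  exact: (ae_eq_sym (fg e)).
Qed.

Lemma l2_ae_eq_trans : transitive l2_ae_eq.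
Proof.
move=> g f h /asboolP fg /asboolP gh; apply/asboolP => e.
exact: (ae_eq_trans (fg e) (gh e)).
Qed.

Canonical l2_ae_eq_equiv :=
  EquivRel l2_ae_eq l2_ae_eq_refl l2_ae_eq_sym l2_ae_eq_trans.

Definition L2 : Type := {eq_quot l2_ae_eq}.
HB.instance Definition _ := Choice.on L2.
HB.instance Definition _ := EqQuotient.on L2.

Definition L2_to_fun (f : L2) : edge G -> R -> C := l2val (repr f).
Coercion L2_to_fun : L2 >-> Funclass.

Definition l2_zero : l2fun.
Proof.
refine (@L2Fun (fun _ _ => 0) _ _).
- by move=> e; split; exact: measurable_cst.
- abstract (rewrite esum1 ?ltry// => e _; rewrite (eq_integral (cst 0%E));
    [exact: integral0|by move=> x _; rewrite /normsq /= expr0n /= addr0]).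
Defined.

Definition L2_zero : L2 := \pi_L2 l2_zero.

(** Sum of an absolutely summable family. *)
Definition edge_sum (a : edge G -> R) : R :=
  fine (\esum_(e in [set: edge G]) (Num.max (a e) 0)%:E)
  - fine (\esum_(e in [set: edge G]) (Num.max (- a e) 0)%:E).

(** The inner product of L2, linear in the first argument. *)
Definition dotp (f g : L2) : C :=
  let a e := cintegral 0 (len e) (fun x => f e x * (g e x)^*%C) in
  Complex (edge_sum (fun e => complex.Re (a e)))
          (edge_sum (fun e => complex.Im (a e))).

Definition continuous_rep (f : L2) (F : mgraph G -> C) : Prop :=
  continuous (F : mgraph G -> C^o) /\
  forall e, f e = F \o edge_pt e %[ae mu in `[0, len e]%classic].

(** [F] is in the Sobolev space H^1(0, l), with derivative [g]: the elements of
    H^1(0, l) are the absolutely continuous functions with square integrable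
    derivative, i.e. the primitives of square integrable functions. *)
Definition sobolev_deriv (l : R) (F g : R -> C) : Prop :=
  sqint l g /\ forall x, 0 <= x <= l -> F x = F 0 + cintegral 0 x g.

End L2.

(** Unbounded operators in [L2 G] are identified with their graphs. *)
Section Operators.
Context {R : realType} (G : metricGraph R).
Local Notation C := (R[i]).
Local Notation H := (L2 G).
Implicit Types (f g h : H) (F : mgraph G -> C).

Definition dom (T : set (H * H)) : set H := [set f | exists h, T (f, h)].

Definition restriction (T : set (H * H)) (D : set H) : set (H * H) :=
  T `&` [set p | D p.1].

(** The operator associated with a closed non-negative form [t] of domain
    [D], by the first representation theorem. *)
Definition form_operator (D : set H) (t : H -> H -> C) : set (H * H) :=
  [set p | D p.1 /\ forall g, D g -> t p.1 g = dotp p.2 g].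

(** [f] is in H^1 of the metric graph, with edgewise derivative [f1]; such an
    [f1] is unique as an element of [L2 G]. *)
Definition H1_deriv f f1 : Prop :=
  exists2 F, continuous_rep f F &
    forall e, sobolev_deriv (len e) (F \o edge_pt e) (f1 e).

Definition H1 : set H := [set f | exists f1, H1_deriv f f1].

Definition deriv f : H := xget (L2_zero G) (H1_deriv f).

Definition neumann_form f g : C := dotp (deriv f) (deriv g).

Definition neumann_extension : set (H * H) := form_operator H1 neumann_form.

(** [f_e'(v)], for an endpoint [v] of [e]: the one-sided derivative of [F] along
    [e], in the direction pointing from [v] into [e]. *)
Definition deriv_into F (e : edge G) (v : vertex G) : C :=
  let p t := edge_pt e (if v == src e then t else len e - t) in
  lim (((F (p t) - F (p 0)) / (t%:C)%C : C^o) @[t --> (0 : R)^'+]).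

Definition kirchhoff F (v : vertex G) : Prop :=
  \sum_(e \in incident v) deriv_into F e v = 0.

(** Continuity at the vertices is the continuity of [F] on [mgraph G];
    [F1] is the edgewise first derivative, and [- p.2] the second one. *)
Definition kirchhoff_laplacian : set (H * H) :=
  [set p : H * H | exists F, [/\ continuous_rep p.1 F,
     forall e, exists2 F1 : R -> C,
       sobolev_deriv (len e) (F \o edge_pt e) F1 &
       sobolev_deriv (len e) F1 (fun x => - p.2 e x)
   & forall v, kirchhoff F v]].

Definition subgraph_normal_deriv F (S : subgraph G) (v : vertex G) : C :=
  \sum_(e \in incident v `&` sub_edge S) deriv_into F e v.

(** The limit is a relation rather than the value of [lim], so that
    [is_normal_deriv f gamma 0] includes the convergence of the sums. *)
Definition is_normal_deriv f (gamma : set (nat -> set (mgraph G))) (c : C) :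
    Prop :=
  exists2 F, continuous_rep f F &
    forall S, graph_representation gamma S ->
      (\sum_(v \in sub_boundary (S k)) subgraph_normal_deriv F (S k) v : C^o)
        @[k --> \oo] --> (c : C^o).

End Operators.

Arguments finite_volume_end {R} G.
Arguments topological_end {R} G.
Arguments H1 {R} G.
Arguments neumann_extension {R} G.
Arguments kirchhoff_laplacian {R} G.

(* Main.v *)
Require Import Defs.
From mathcomp Require Import all_boot all_order all_algebra finmap.
From mathcomp Require Import generic_quotient complex.
From mathcomp Require Import all_classical all_reals all_analysis.
From mathcomp Require Import measurable_realfun ring lra.

(* Let p e and q e be the values of f' at the target and the source of e, for the
   orientation of e, and h = - f''. Integration by parts gives
     <f', g'> - <h, g> = sum over e of (p e * g (tgt e) - q e * g (src e)),
   the flux of f against the restriction of g to the vertices. Against the indicator of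
   one vertex the flux vanishes iff the Kirchhoff condition holds there. Against the
   indicator of the vertices of a subgraph S of finite volume and finite boundary it
   is the sum of the normal derivatives of f on the boundary of S plus the sum of
   p e - q e over the edges of S, which tends to 0 along a graph representation.
   If (f, h) is in the Neumann extension, test functions supported on one edge show
   that f is in H^2 there, and piecewise linear interpolations of indicators show that
   the flux vanishes against all of these indicators; hence f is Kirchhoff with zero
   normal derivatives. Conversely, if f is Kirchhoff with zero normal derivatives, the
   flux vanishes against the indicator of every vertex set W with finite edge boundary
   and finite volume, by induction on the number of ends inside W: either W splits into
   two infinite such sets, or W differs from each member of a graph representation of
   one end by a finite set. For g in H^1, almost every superlevel set of the positive
   part of g on the vertices is such a W, by trace estimates and Borel-Cantelli, and
   the layer cake formula gives zero flux against g. *)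

Set Implicit Arguments.
Unset Strict Implicit.
Unset Printing Implicit Defensive.

Import Order.TTheory GRing.Theory Num.Theory.
Import numFieldTopology.Exports numFieldNormedType.Exports.

Local Open Scope classical_set_scope.
Local Open Scope ring_scope.

(** * Real functions on an interval *)

(** Edge lengths have no positive lower bound, so the values of [f'] and [g] at the vertices are
    controlled only with the weight [Num.min (len e) 1], and the two terms of the flux on an edge
    need not be summable separately. Their combination is: in [(p e - q e) * g (tgt e) + q e * (g
    (tgt e) - g (src e))] each difference gains the weight that the other factor loses, and each
    product is bounded by a summable [M e + N e]. For this reason the flux is not rearranged into a
    sum over vertices for general [g]; the argument passes to indicators, where only finitely many
    edges have to be rearranged. Superlevel sets at levels [t > 0] have finite volume by a Chebyshev
    estimate, so ends of infinite volume, of which there may be infinitely many, are never met.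
    Finiteness of the set of finite volume ends makes the induction possible. *)

Section SquareIntegrable.
Context {R : realType}.
Local Notation mu := (@lebesgue_measure R).
Implicit Types (l x : R) (f g : R -> R).

Definition rsqint l f : Prop :=
  measurable_fun `[0, l] f /\
  (\int[mu]_(x in `[0%R, l]) ((f x) ^+ 2)%:E < +oo)%E.

(* The real counterpart of [sobolev_deriv]. *)
Definition prim l f g : Prop :=
  rsqint l g /\ forall x, 0 <= x <= l -> f x = f 0 + \int[mu]_(t in `[0, x]) g t.

Definition norm2 l f : R := \int[mu]_(x in `[0, l]) (f x) ^+ 2.

Lemma rsqint_integrable_sq l f : rsqint l f ->
  mu.-integrable `[0, l] (EFin \o (fun x => f x ^+ 2)).
Proof.
move=> [mf fy]; apply/integrableP; split.
  by apply/measurable_EFinP; exact: measurable_funX.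
apply: le_lt_trans fy; rewrite le_eqVlt; apply/orP; left; apply/eqP.
by apply: eq_integral => x _ /=; rewrite ger0_norm ?sqr_ge0.
Qed.

Lemma rsqint_integrableM l f g : rsqint l f -> rsqint l g ->
  mu.-integrable `[0, l] (EFin \o (fun x => f x * g x)).
Proof.
move=> fi gi.
have i2 : mu.-integrable `[0, l] (EFin \o (fun x => f x ^+ 2 + g x ^+ 2)).
  have := integrableD _ (rsqint_integrable_sq fi) (rsqint_integrable_sq gi).
  by apply.
apply: le_integrable i2 => //.
  by apply/measurable_EFinP; apply: measurable_funM; [exact: fi.1|exact: gi.1].
move=> x _ /=; rewrite lee_fin normrM [leRHS]ger0_norm ?addr_ge0 ?sqr_ge0//.
rewrite -(real_normK (num_real (f x))) -(real_normK (num_real (g x))).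
by have := normr_ge0 (f x); have := normr_ge0 (g x);
  have := sqr_ge0 (`|f x| - `|g x|); nra.
Qed.

Lemma mu_itv0_lty l : (mu `[0%R, l] < +oo)%E.
Proof. by rewrite lebesgue_measure_itv/=; case: ifP => _; rewrite -?EFinB ltry. Qed.

Lemma bounded_rsqint l f M : measurable_fun `[0, l] f ->
  (forall x, 0 <= x <= l -> `|f x| <= M) -> rsqint l f.
Proof.
move=> mf fM; split => //; apply: (@le_lt_trans _ _ (\int[mu]_(x in `[0%R, l]) (M ^+ 2)%:E)%E).
  apply: ge0_le_integral => //.
  - by move=> x _; rewrite lee_fin sqr_ge0.
  - by apply/measurable_EFinP; exact: measurable_funX.
  - by move=> x; rewrite /= in_itv/= => /fM fxM; rewrite lee_fin -real_normK ?num_real// ler_sqr ?nnegrE// (le_trans _ fxM).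
rewrite integral_cst//; apply: lte_mul_pinfty => //.
- by rewrite lee_fin sqr_ge0.
- exact: mu_itv0_lty.
Qed.

Lemma rsqint_cst l c : rsqint l (cst c).
Proof. by apply: (@bounded_rsqint _ _ `|c|). Qed.

Lemma rsqintD l f g : rsqint l f -> rsqint l g -> rsqint l (fun x => f x + g x).
Proof.
move=> fi gi; split; first by apply: measurable_funD; [exact: fi.1|exact: gi.1].
have : mu.-integrable `[0, l] (EFin \o (fun x => f x * f x + g x * g x + (f x * g x + f x * g x))).
  have [a b c] := And3 (rsqint_integrableM fi fi) (rsqint_integrableM gi gi) (rsqint_integrableM fi gi).
  have := integrableD _ (integrableD _ a b) (integrableD _ c c).
  by apply.
move/integrableP => [_]; apply: le_lt_trans; rewrite le_eqVlt; apply/orP; left; apply/eqP.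
apply: eq_integral => x _ /=; rewrite ger0_norm; first by congr EFin; ring.
by have := sqr_ge0 (f x + g x); congr (_ <= _); ring.
Qed.

Lemma rsqintZ l f c : rsqint l f -> rsqint l (fun x => c * f x).
Proof.
move=> fi; split; first by apply: measurable_funM; [exact: measurable_cst|exact: fi.1].
have : mu.-integrable `[0, l] (fun x => (c ^+ 2)%:E * (f x ^+ 2)%:E)%E.
  by apply: integrableZl => //; exact: rsqint_integrable_sq.
move=> /integrableP[_]; apply: le_lt_trans; rewrite le_eqVlt; apply/orP; left; apply/eqP.
apply: eq_integral => x _ /=; rewrite ger0_norm; last exact: mulr_ge0 (sqr_ge0 _) (sqr_ge0 _).
by congr EFin; ring.
Qed.

Lemma rsqintN l f : rsqint l f -> rsqint l (fun x => - f x).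
Proof.
move=> /(@rsqintZ _ _ (-1)); congr (rsqint l).
by apply/funext => x; rewrite mulN1r.
Qed.

Lemma rsqint_integrable l f : rsqint l f -> mu.-integrable `[0, l] (EFin \o f).
Proof.
move=> /rsqint_integrableM /(_ (rsqint_cst l 1)); apply: eq_integrable => //.
by move=> x _ /=; rewrite mulr1.
Qed.

Lemma rsqint_sub l l' f : l' <= l -> rsqint l f -> rsqint l' f.
Proof.
move=> ll fi.
have sub : `[0, l'] `<=` `[0, l].
  by apply: subset_itvl; rewrite bnd_simp.
split; first exact: measurable_funS fi.1.
apply: le_lt_trans fi.2; apply: ge0_subset_integral => //.
- by apply/measurable_EFinP; apply: measurable_funX; exact: fi.1.
- by move=> x _; rewrite lee_fin sqr_ge0.
Qed.

Lemma norm2_ge0 l f : 0 <= norm2 l f.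
Proof. by apply: Rintegral_ge0 => x _; exact: sqr_ge0. Qed.

Lemma prim_continuous l f g : 0 <= l -> prim l f g ->
  {within `[0, l], continuous f}.
Proof.
move=> l0 [gi fE].
have := parameterized_integral_continuous l0 (rsqint_integrable gi).
move=> H; apply: (@subspace_eq_continuous _ _ _ (fun x => f 0 + parameterized_integral mu 0 x g)).
  by move=> x; rewrite inE/= in_itv/= => xl; symmetry; exact: fE xl.
move=> x; apply: (@cvgD _ R^o); [exact: cvg_cst|exact: H].
Qed.

Lemma within_continuous_rsqint l f :
  {within `[0, l], continuous f} -> rsqint l f.
Proof.
move=> cf; have mf : measurable_fun `[0, l] f.
  by apply: subspace_continuous_measurable_fun.
have [M [_ fM]] := compact_bounded (continuous_compact cf (@segment_compact _ 0 l)).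
apply: (@bounded_rsqint _ _ (M + 1)) => // x xl; apply: fM; first by rewrite ltrDl.
by exists x => //=; rewrite in_itv.
Qed.

Lemma prim_rsqint l f g : 0 <= l -> prim l f g -> rsqint l f.
Proof. by move=> l0 /(prim_continuous l0)/within_continuous_rsqint. Qed.

End SquareIntegrable.

(** * Integration by parts, trace estimates and one-sided derivatives *)

Section IBP.
Context {R : realType}.
Local Notation mu := (@lebesgue_measure R).
Implicit Types (l x : R) (f g : R -> R).

(** Both sides integrate [f x * g y] over the triangle [y <= x] of the square. This replaces the
    product rule in integration by parts, since primitives of integrable functions need not be
    differentiable everywhere. *)
Lemma Rintegral_fubini_triangle l f g :
  mu.-integrable `[0, l] (EFin \o f) -> mu.-integrable `[0, l] (EFin \o g) ->
  (\int[mu]_(x in `[0%R, l]) (f x * (\int[mu]_(t in `[0, x]) g t))%:E =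
   \int[mu]_(y in `[0%R, l]) (g y * (\int[mu]_(t in `[y, l]) f t))%:E)%E.
Proof.
move=> fi gi.
pose f1 := f \_ `[0, l]; pose g1 := g \_ `[0, l].
have f1i : mu.-integrable setT (EFin \o f1).
  by rewrite -restrict_EFin; apply/(@integrable_mkcond _ _ _ mu `[0, l]).
have g1i : mu.-integrable setT (EFin \o g1).
  by rewrite -restrict_EFin; apply/(@integrable_mkcond _ _ _ mu `[0, l]).
have mf1 : measurable_fun setT f1 by apply/measurable_EFinP; exact: measurable_int f1i.
have mg1 : measurable_fun setT g1 by apply/measurable_EFinP; exact: measurable_int g1i.
pose k (z : R * R) := (f1 z.1 * (g1 z.2 * (z.2 <= z.1)%R%:R))%:E.
have mk : measurable_fun setT k.
  apply/measurable_EFinP; apply: measurable_funM.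
    by apply: (measurableT_comp mf1); exact: measurable_fst.
  apply: measurable_funM.
    by apply: (measurableT_comp mg1); exact: measurable_snd.
  have mb : measurable_fun setT (fun z : R * R => z.2 <= z.1).
    by apply: measurable_fun_ler; [exact: measurable_snd|exact: measurable_fst].
  by apply: (measurableT_comp (f := fun b : bool => b%:R : R)) => //.
(* The kernel is dominated by the product of [|f1 x|] and [|g1 y|], whose iterated integral is a
   product of two finite integrals. *)
have ki : (mu \x mu)%E.-integrable setT k.
  apply/integrable12ltyP => //.
  set Ig := (\int[mu]_y `|(g1 y)%:E|)%E.
  have Igy : (Ig < +oo)%E by case/integrableP : g1i.
  have Ig0 : (0 <= Ig)%E by exact: integral_ge0.
  apply: (@le_lt_trans _ _ (\int[mu]_x (`|(f1 x)%:E| * Ig))%E).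
    apply: ge0_le_integral => //.
    - by move=> x _; exact: integral_ge0.
    - by apply: (@measurable_fun_fubini_tonelli_F _ _ _ _ _ mu (fun z => `|k z|)%E) => //; exact: measurableT_comp.
    - by apply: emeasurable_funM => //; apply: measurableT_comp => //; exact/measurable_EFinP.
    move=> x _; rewrite -ge0_integralZl//.
      apply: ge0_le_integral => //.
      - by apply: measurableT_comp => //; exact: (measurableT_comp mk (pair1_measurable x)).
      - by apply: emeasurable_funM => //; apply: measurableT_comp => //; exact/measurable_EFinP.
      move=> y _; rewrite /k/= -EFinM lee_fin !normrM ler_wpM2l//.
      by case: (y <= x); rewrite ?normr1 ?normr0 ?mulr1 ?mulr0.
    by apply: measurableT_comp => //; exact/measurable_EFinP.
  rewrite ge0_integralZr//.
    apply: lte_mul_pinfty => //.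
    - exact: integral_ge0.
    - rewrite ge0_fin_numE; last exact: integral_ge0.
      by case/integrableP : f1i.
  by apply: measurableT_comp => //; exact/measurable_EFinP.
transitivity (\int[mu]_x \int[mu]_y k (x, y))%E.
  rewrite [LHS]integral_mkcond; apply: eq_integral => x _.
  rewrite patchE; case: ifPn => xl; last first.
    rewrite integral0_eq// => y _; rewrite /k/= /f1 patchE (negPf xl).
    by rewrite mul0r.
  move: (xl); rewrite inE/= in_itv/= => /andP[x0 xl'].
  have sub : `[0, x] `<=` `[0, l] by apply: subset_itvl; rewrite bnd_simp.
  have gx : mu.-integrable `[0, x] (EFin \o g) by exact: integrableS gi.
  transitivity (\int[mu]_y ((f x)%:E * ((EFin \o g) \_ `[0%R, x]) y))%E.
    rewrite integralZl//; last by apply/(@integrable_mkcond _ _ _ mu `[0, x]).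
    by rewrite -integral_mkcond EFinM /Rintegral fineK//; exact: integrable_fin_num.
  apply: eq_integral => y _; rewrite /k/= /f1 /g1 patchE xl !patchE EFinM.
  have -> : (y \in `[0, x]%classic) = (y \in `[0, l]%classic) && (y <= x).
    rewrite !mem_setE !in_itv/=; case: (leP 0 y) => //= y0.
    by case: (leP y x) => yx; rewrite ?andbF// (le_trans yx xl').
  (* A restriction takes the value [point] off its domain, and [point] is convertible to 0 here. *)
  rewrite -![point]/0; case: (y \in _) => /=; last by rewrite mul0r.
  by case: (y <= x); rewrite ?mulr1 ?mulr0 ?mule0// EFinM.
rewrite Fubini//; apply/esym.
rewrite [LHS]integral_mkcond; apply: eq_integral => y _.
rewrite patchE; case: ifPn => yl; last first.
  rewrite integral0_eq// => x _; rewrite /k/= /g1 patchE (negPf yl).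
  by rewrite mul0r mulr0.
move: (yl); rewrite inE/= in_itv/= => /andP[y0 yl'].
have sub : `[y, l] `<=` `[0, l] by apply: subset_itvr; rewrite bnd_simp.
have fx : mu.-integrable `[y, l] (EFin \o f) by exact: integrableS fi.
transitivity (\int[mu]_x ((g y)%:E * ((EFin \o f) \_ `[y, l]) x))%E.
  rewrite integralZl//; last by apply/(@integrable_mkcond _ _ _ mu `[y, l]).
  by rewrite -integral_mkcond EFinM /Rintegral fineK//; exact: integrable_fin_num.
apply: eq_integral => x _; rewrite /k/= /f1 /g1 [in RHS]patchE [in RHS]patchE yl patchE.
have -> : (x \in `[y, l]%classic) = (x \in `[0, l]%classic) && (y <= x).
  rewrite !mem_setE !in_itv/=; case: (leP y x) => yx; rewrite ?andbF//=.
  by rewrite (le_trans y0 yx) andbT.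
rewrite -![point]/0; case: (x \in _) => /=; last by rewrite mul0r mule0.
by case: (y <= x); rewrite ?mulr1 ?mulr0 ?mule0// EFinM muleC.
Qed.


Lemma rsqint_integrable_itv l x y f : 0 <= x -> y <= l -> rsqint l f ->
  mu.-integrable `[x, y] (EFin \o f).
Proof.
move=> x0 yl fi; apply: integrableS (rsqint_integrable fi) => //.
by apply: subset_itv; rewrite bnd_simp.
Qed.

Lemma rsqint_integrable_sq_itv l x y f : 0 <= x -> y <= l -> rsqint l f ->
  mu.-integrable `[x, y] (EFin \o (fun x => f x ^+ 2)).
Proof.
move=> x0 yl fi; apply: integrableS (rsqint_integrable_sq fi) => //.
by apply: subset_itv; rewrite bnd_simp.
Qed.

Lemma mu_itv_lty x y : (mu `[x, y] < +oo)%E.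
Proof. by rewrite lebesgue_measure_itv/=; case: ifP => _; rewrite -?EFinB ltry. Qed.

Lemma fine_mu_itv x y (b c : bool) : x <= y ->
  fine (mu [set` Interval (BSide b x) (BSide c y)]) = y - x.
Proof.
rewrite lebesgue_measure_itv/= lte_fin le_eqVlt => /predU1P[<-|->]//.
by rewrite ltxx subrr.
Qed.

Lemma integrable_cst_itv x y c : mu.-integrable `[x, y] (EFin \o cst c).
Proof.
apply: measurable_bounded_integrable => //.
  exact: mu_itv_lty.
by exists `|c|; split => // z zc t _ /=; exact: ltW.
Qed.

Lemma Rintegral_cst_itv x y c : x <= y -> \int[mu]_(t in `[x, y]) c = c * (y - x).
Proof.
by move=> xy; rewrite Rintegral_cst//; congr (_ * _); exact: fine_mu_itv.
Qed.

Lemma prim_diff l f g x y : 0 <= x -> x <= y -> y <= l -> prim l f g ->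
  f y - f x = \int[mu]_(t in `[x, y]) g t.
Proof.
move=> x0 xy yl [gi fE].
have gy : mu.-integrable `[0, y] (EFin \o g) by exact: rsqint_integrable_itv gi.
rewrite (fE y) ?yl ?(le_trans x0)// (fE x) ?x0 ?(le_trans xy)//.
rewrite opprD addrACA subrr add0r Rintegral_itvB ?bnd_simp//.
by rewrite Rintegral_itv_obnd_cbnd//; apply: integrableS gy => //;
   apply: subset_itv; rewrite bnd_simp.
Qed.

(** The triangle identity for [g'] and [f'], where the inner integrals are the increments
    [f x - f 0] and [g l - g x]. *)
Lemma prim_ibp l f f' g g' : 0 <= l -> prim l f f' -> prim l g g' ->
  \int[mu]_(x in `[0, l]) (f x * g' x) + \int[mu]_(x in `[0, l]) (f' x * g x) =
  f l * g l - f 0 * g 0.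
Proof.
move=> l0 pf pg; have [fi fE] := pf; have [gi gE] := pg.
have f'i := rsqint_integrable fi; have g'i := rsqint_integrable gi.
have fgi := rsqint_integrableM (prim_rsqint l0 pf) gi.
have gfi := rsqint_integrableM fi (prim_rsqint l0 pg).
have E : \int[mu]_(x in `[0, l]) (g' x * (\int[mu]_(t in `[0, x]) f' t)) =
    \int[mu]_(x in `[0, l]) (f' x * (\int[mu]_(t in `[x, l]) g' t)).
  by congr fine; exact: Rintegral_fubini_triangle.
move: E.
have -> : \int[mu]_(x in `[0, l]) (g' x * (\int[mu]_(t in `[0, x]) f' t)) =
    \int[mu]_(x in `[0, l]) (f x * g' x - f 0 * g' x).
  by apply: eq_Rintegral; move=> x; rewrite inE/= in_itv/= => xl; rewrite (fE x)//; ring.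
have -> : \int[mu]_(x in `[0, l]) (f' x * (\int[mu]_(t in `[x, l]) g' t)) =
    \int[mu]_(x in `[0, l]) (g l * f' x - f' x * g x).
  apply: eq_Rintegral; move=> x; rewrite inE/= in_itv/= => /andP[x0 xl].
  by rewrite -(prim_diff x0 xl (lexx l) pg); ring.
have fg0 : mu.-integrable `[0, l] (EFin \o (fun x => f 0 * g' x)).
  by apply: rsqint_integrable; exact: rsqintZ.
have fgl : mu.-integrable `[0, l] (EFin \o (fun x => g l * f' x)).
  by apply: rsqint_integrable; exact: rsqintZ.
rewrite RintegralB// RintegralB// RintegralZl// RintegralZl//.
rewrite -(prim_diff (lexx 0) l0 (lexx l) pg) -(prim_diff (lexx 0) l0 (lexx l) pf).
by move=> /eqP; rewrite subr_eq => /eqP ->; ring.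
Qed.

(** Cauchy-Schwarz in discriminant form. For [r > 0] the minimiser [m = I / r] gives the claim. *)
Lemma sqr_le_discriminant (S I r : R) : 0 <= r ->
  (forall m, 0 <= S - 2 * m * I + m ^+ 2 * r) -> I ^+ 2 <= r * S.
Proof.
rewrite le_eqVlt => /predU1P[<-|r0] H.
  have [->|I0] := eqVneq I 0; first by rewrite expr0n mul0r.
  (* For [r = 0] the expression is affine in [m], and this [m] makes it equal to -1. *)
  have := H ((S + 1) / (2 * I)); rewrite mulr0 addr0.
  have -> : S - 2 * ((S + 1) / (2 * I)) * I = - 1 by field.
  by rewrite lerNr oppr0 ler10.
have := H (I / r).
have -> : S - 2 * (I / r) * I + (I / r) ^+ 2 * r = (r * S - I ^+ 2) / r.
  by field; rewrite gt_eqF.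
by rewrite pmulr_lge0 ?invr_gt0// subr_ge0.
Qed.

(** Cauchy-Schwarz for [g] against 1: the integral of [(g t - m) ^+ 2] over [[x, y]] is non-negative
    for every [m]. *)
Lemma prim_diff_sqr l f g x y : 0 <= x -> x <= y -> y <= l -> prim l f g ->
  (f y - f x) ^+ 2 <= (y - x) * norm2 l g.
Proof.
move=> x0 xy yl pf; have [gi _] := pf.
rewrite (prim_diff x0 xy yl pf).
have i1 := rsqint_integrable_itv x0 yl gi.
have i2 := rsqint_integrable_sq_itv x0 yl gi.
apply: (@le_trans _ _ ((y - x) * \int[mu]_(t in `[x, y]) (g t ^+ 2))).
  apply: sqr_le_discriminant; first by rewrite subr_ge0.
  move=> m; have : 0 <= \int[mu]_(t in `[x, y]) (g t - m) ^+ 2.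
    by apply: Rintegral_ge0 => t _; exact: sqr_ge0.
  have -> : \int[mu]_(t in `[x, y]) (g t - m) ^+ 2 =
    \int[mu]_(t in `[x, y]) (g t ^+ 2 + (- (2 * m) * g t + m ^+ 2)).
    by apply: eq_Rintegral; move=> t _; ring.
  have i3 : mu.-integrable `[x, y] (EFin \o (fun t => - (2 * m) * g t)).
    by have := rsqint_integrable_itv x0 yl (rsqintZ (- (2 * m)) gi).
  have i4 := integrable_cst_itv x y (m ^+ 2).
  rewrite RintegralD//; last first.
    by have := integrableD _ i3 i4; apply.
  rewrite RintegralD// RintegralZl// Rintegral_cst_itv//.
  by congr (_ <= _); ring.
apply: ler_wpM2l; first by rewrite subr_ge0.
rewrite /norm2 /Rintegral fine_le//.
- exact: (integrable_fin_num _ i2).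
- exact: (integrable_fin_num _ (rsqint_integrable_sq gi)).
- apply: ge0_subset_integral => //.
  + by apply/measurable_EFinP; apply: measurable_funX; exact: gi.1.
  + by move=> t _; rewrite lee_fin sqr_ge0.
  + by apply: subset_itv; rewrite bnd_simp.
Qed.

(** Average over [t] in [[c, d]] the bound of [f y ^+ 2] by [2 * f t ^+ 2] and the squared
    increment. The condition [d - c <= 1] absorbs the factor [(d - c) ^+ 2] in front of the norm of
    [g]. *)
Lemma prim_trace l f g c d y : 0 <= c -> c <= d -> d <= l -> d - c <= 1 ->
  c <= y -> y <= d -> prim l f g ->
  (d - c) * f y ^+ 2 <= 2 * (norm2 l f + norm2 l g).
Proof.
move=> c0 cd dl dc1 cy yd pf.
have l0 : 0 <= l by rewrite (le_trans c0)// (le_trans cd).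
have fi := prim_rsqint l0 pf.
have i2 := rsqint_integrable_sq_itv c0 dl fi.
have i2' : mu.-integrable `[c, d] (EFin \o (fun x => 2 * f x ^+ 2)).
  by have := integrableZl _ 2 i2; apply.
have N0 := norm2_ge0 l g.
have : \int[mu]_(t in `[c, d]) (f y ^+ 2) <=
   \int[mu]_(t in `[c, d]) (2 * f t ^+ 2 + 2 * (d - c) * norm2 l g).
  apply: le_Rintegral => //.
  - exact: integrable_cst_itv.
  - have := integrableD _ i2' (integrable_cst_itv c d (2 * (d - c) * norm2 l g)).
    by apply.
  move=> t /=; rewrite in_itv/= => /andP[ct td].
  have : (f y - f t) ^+ 2 <= (d - c) * norm2 l g.
    have [ty|yt] := leP t y.
      apply: (le_trans (prim_diff_sqr (le_trans c0 ct) ty (le_trans yd dl) pf)).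
      by apply: ler_wpM2r => //; rewrite lerB.
    rewrite -sqrrN opprB.
    apply: (le_trans (prim_diff_sqr (le_trans c0 cy) (ltW yt) (le_trans td dl) pf)).
    by apply: ler_wpM2r => //; rewrite lerB.
  (* This square is [2 * f t ^+ 2 + 2 * (f y - f t) ^+ 2 - f y ^+ 2]. *)
  by have := sqr_ge0 (f y - 2 * f t); nra.
rewrite RintegralD//; last exact: integrable_cst_itv.
rewrite RintegralZl// !Rintegral_cst_itv//.
have : \int[mu]_(t in `[c, d]) (f t ^+ 2) <= norm2 l f.
  rewrite /norm2 /Rintegral fine_le//.
  - exact: (integrable_fin_num _ i2).
  - exact: (integrable_fin_num _ (rsqint_integrable_sq fi)).
  - apply: ge0_subset_integral => //.
    + by apply/measurable_EFinP; apply: measurable_funX; exact: fi.1.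
    + by move=> t _; rewrite lee_fin sqr_ge0.
    + by apply: subset_itv; rewrite bnd_simp.
set J := Rintegral _ _ _ => J1 J2.
have : (d - c) * (d - c) * norm2 l g <= norm2 l g.
  have : (d - c) * (d - c) <= 1 by rewrite -[leRHS]mulr1 ler_pM// subr_ge0.
  by move=> ?; rewrite -[leRHS]mul1r ler_wpM2r.
by lra.
Qed.

Lemma prim_trace0 l f g : 0 < l -> prim l f g ->
  Num.min l 1 * f 0 ^+ 2 <= 2 * (norm2 l f + norm2 l g).
Proof.
move=> l0 pf; have m0 : 0 < Num.min l 1 by rewrite lt_min l0 ltr01.
have := @prim_trace l f g 0 (Num.min l 1) 0; rewrite subr0; apply => //.
- exact: ltW.
- by rewrite ge_min lexx.
- by rewrite ge_min lexx orbT.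
- exact: ltW.
Qed.

Lemma prim_tracel l f g : 0 < l -> prim l f g ->
  Num.min l 1 * f l ^+ 2 <= 2 * (norm2 l f + norm2 l g).
Proof.
move=> l0 pf; have m0 : 0 < Num.min l 1 by rewrite lt_min l0 ltr01.
have := @prim_trace l f g (l - Num.min l 1) l l; rewrite subKr; apply => //.
- by rewrite subr_ge0 ge_min lexx.
- by rewrite gerBl ltW.
- by rewrite ge_min lexx orbT.
- by rewrite gerBl ltW.
Qed.

(** Unlike in the trace bounds, the weight is on the right. Short edges use Cauchy-Schwarz; on long
    edges the square of the difference is at most twice the sum of the squares, and each square is
    bounded by the trace estimate with constant 2, whence the 8. *)
Lemma prim_trace_diff l f g : 0 < l -> prim l f g ->
  (f l - f 0) ^+ 2 <= 8 * Num.min l 1 * (norm2 l f + norm2 l g).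
Proof.
move=> l0 pf; have Nf := norm2_ge0 l f; have Ng := norm2_ge0 l g.
have := prim_trace0 l0 pf; have := prim_tracel l0 pf.
have := prim_diff_sqr (lexx 0) (ltW l0) (lexx l) pf; rewrite subr0.
have [l1 H _ _|l1 _] := leP l 1.
  apply: (le_trans H); have : 0 <= l * norm2 l f by rewrite mulr_ge0// ltW.
  have : 0 <= l * norm2 l g by rewrite mulr_ge0// ltW.
  by lra.
by have := sqr_ge0 (f l + f 0); rewrite !mul1r; lra.
Qed.

Lemma norm2_eq0_ae l f : rsqint l f -> norm2 l f = 0 ->
  f = cst 0 %[ae mu in `[0, l]%classic].
Proof.
move=> fi f0.
have : (\int[mu]_(x in `[0%R, l]) `|(f x ^+ 2)%:E| = 0)%E.
  transitivity (norm2 l f)%:E; last by rewrite f0.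
  rewrite /norm2 /Rintegral fineK.
    by apply: eq_integral => x _; rewrite gee0_abs// lee_fin sqr_ge0.
  exact: (integrable_fin_num _ (rsqint_integrable_sq fi)).
move=> /ae_eq_integral_abs; move=> /(_ (measurable_itv _)).
have mf : measurable_fun `[0, l] (fun x => (f x ^+ 2)%:E).
  by apply/measurable_EFinP; apply: measurable_funX; exact: fi.1.
move=> /(_ mf); apply: filterS => x H /H /eqP.
by rewrite /= eqe sqrf_eq0 => /eqP.
Qed.

(** Lebesgue differentiation of the integral of the zero extension of [g], which vanishes near every
    interior point. *)
Lemma prim0_ae l f g : 0 < l -> prim l f g -> (forall x, 0 <= x <= l -> f x = f 0) ->
  g = cst 0 %[ae mu in `[0, l]%classic].
Proof.
move=> l0 pf f0; have [gi fE] := pf.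
pose g1 := g \_ `[0, l].
have g1i : mu.-integrable setT (EFin \o g1).
  by rewrite -restrict_EFin; apply/(@integrable_mkcond _ _ _ mu `[0, l]) => //; exact: rsqint_integrable.
have g1x y : mu.-integrable `]-oo, y] (EFin \o g1).
  by apply: integrableS g1i.
have lg1 : locally_integrable [set: R] g1.
  split => //.
  - by apply/measurable_EFinP; exact: measurable_int g1i.
  - exact: openT.
  - move=> K _ cK; have : mu.-integrable K (EFin \o g1).
      by apply: integrableS g1i => //; exact: compact_measurable.
    by move=> /integrableP[_].
have := FTC1Ny g1x lg1.
(* The endpoints are discarded: they have no neighbourhood inside [[0, l]], where the integral is
   known to vanish. *)
have ae0 : {ae mu, forall x : R, x != 0 /\ x != l}.
  exists [set 0; l]; split => //.
  - exact: measurableU.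
  - apply/eqP; rewrite eq_le measure_ge0 andbT.
    have m1 (a : R) : mu [set a] = 0%E by exact: lebesgue_measure_set1.
    apply: (@le_trans _ _ (mu [set 0%R] + mu [set l])%E); first exact: measureU2.
    by rewrite !m1 adde0.
  - move=> x /= /not_andP[|] /negP; rewrite negbK => /eqP ->; [by left|by right].
move: ae0; apply: filterS2; first exact: (ae_filter_ringOfSetsType mu).
move=> x [xn0 xnl] H /=; rewrite in_itv/= => /andP[x0 xl].
have {}x0 : 0 < x by rewrite lt_neqAle eq_sym xn0.
have {}xl : x < l by rewrite lt_neqAle xnl.
have [_ E] := H.
have <- : g1 x = g x.
  by rewrite /g1 patchE mem_set//= in_itv/= !ltW.
rewrite -E derive1E.
rewrite (@near_eq_derive _ _ _ _ (cst 0)).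
  by rewrite derive_cst.
near=> y.
have yl : 0 <= y <= l.
  by apply/andP; split; near: y; [exact: lt_le_nbhsr|exact: lt_le_nbhsl].
transitivity (\int[mu]_(t in `[0, y]) g t).
  rewrite Rintegral_mkcond [RHS]Rintegral_mkcond; apply: eq_Rintegral => t _.
  rewrite /g1 !patchE !mem_setE !in_itv/=; case: (leP t y) => ty; rewrite ?andbF//.
  by rewrite (le_trans ty) ?andbT//; case/andP: yl.
by have := f0 y yl; rewrite fE// => /eqP; rewrite -subr_eq0 addrAC subrr add0r => /eqP.
Unshelve. all: by end_near. Qed.

(** The bound is asked on the open interval, which is what a one-sided limit of [g] at an endpoint
    provides. *)
Lemma prim_diff_lin l f g c e x y : 0 <= x -> x <= y -> y <= l -> prim l f g ->
  (forall t, x < t < y -> `|g t - c| <= e) ->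
  `|f y - f x - c * (y - x)| <= e * (y - x).
Proof.
move=> x0 xy yl pf ge; have [gi _] := pf.
rewrite (prim_diff x0 xy yl pf) -Rintegral_cst_itv//.
have i1 := rsqint_integrable_itv x0 yl gi.
have i2 := integrable_cst_itv x y c.
have i3 : mu.-integrable `[x, y] (EFin \o (fun t => g t - c)).
  by have := integrableB _ i1 i2; apply.
rewrite -RintegralB//.
rewrite -Rintegral_itv_obnd_cbnd; last first.
  by apply: integrableS i3 => //; apply: subset_itv; rewrite bnd_simp.
rewrite -Rintegral_itv_bndo_bndc; last first.
  by apply: integrableS i3 => //; apply: subset_itv; rewrite bnd_simp.
have i4 : mu.-integrable `]x, y[ (EFin \o (fun t => g t - c)).
  by apply: integrableS i3 => //; apply: subset_itv; rewrite bnd_simp.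
apply: le_trans (le_normr_Rintegral _ i4) _ => //.
apply: (@le_trans _ _ (\int[mu]_(t in `]x, y[) e)).
  apply: le_Rintegral => //.
  - exact: integrable_norm.
  - by apply: integrableS (integrable_cst_itv x y e) => //; apply: subset_itv; rewrite bnd_simp.
by rewrite Rintegral_cst// le_eqVlt; apply/orP; left; apply/eqP; congr (_ * _); exact: fine_mu_itv.
Qed.

(** A continuous weak derivative is a classical one-sided derivative at the endpoints. Together with
    [prim_derivl], whose sign reflects the direction into the edge, this computes the limits in
    [deriv_into]. *)
Lemma prim_deriv0 l f g : 0 < l -> prim l f g -> {within `[0, l], continuous g} ->
  (f t - f 0) / t @[t --> (0 : R)^'+] --> g 0.
Proof.
move=> l0 pf /(continuous_within_itvP _ l0)[_ g0 _].
apply/cvgrPdist_le => e e0.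
have /cvgrPdist_le /(_ _ e0) := g0.
move=> [d /= d0 H]; near=> t.
have t0 : 0 < t by near: t; exact: nbhs_right_gt.
have tl : t <= l by near: t; exact: nbhs_right_le.
have td : t < d by near: t; exact: nbhs_right_lt.
have := @prim_diff_lin l f g (g 0) e 0 t (lexx 0) (ltW t0) tl pf.
rewrite subr0 => /(_ _)/wrap[].
  move=> s /andP[s0 st]; rewrite distrC; apply: H => //=.
  by rewrite sub0r normrN gtr0_norm// (lt_trans st).
have -> : g 0 - (f t - f 0) / t = - ((f t - f 0 - g 0 * t) / t).
  by field; rewrite gt_eqF.
by rewrite normrN normrM normfV (gtr0_norm t0) ler_pdivrMr.
Unshelve. all: by end_near. Qed.

Lemma prim_derivl l f g : 0 < l -> prim l f g -> {within `[0, l], continuous g} ->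
  (f (l - t) - f l) / t @[t --> (0 : R)^'+] --> - g l.
Proof.
move=> l0 pf /(continuous_within_itvP _ l0)[_ _ gl].
apply/cvgrPdist_le => e e0.
have /cvgrPdist_le /(_ _ e0) := gl.
move=> [d /= d0 H]; near=> t.
have t0 : 0 < t by near: t; exact: nbhs_right_gt.
have tl : t <= l by near: t; exact: nbhs_right_le.
have td : t < d by near: t; exact: nbhs_right_lt.
have := @prim_diff_lin l f g (g l) e (l - t) l _ _ (lexx l) pf.
rewrite subr_ge0 gerBl subKr => /(_ tl (ltW t0) _)/wrap[].
  move=> s /andP[s0 st]; rewrite distrC; apply: H => //=.
  by rewrite gtr0_norm ?subr_gt0// ltrBlDl -ltrBlDr (le_lt_trans _ s0)// lerB// ltW.
have -> : - g l - (f (l - t) - f l) / t = (f l - f (l - t) - g l * t) / t.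
  by field; rewrite gt_eqF.
by rewrite normrM normfV (gtr0_norm t0) ler_pdivrMr.
Unshelve. all: by end_near. Qed.

End IBP.

(** * Absolutely summable families *)

Section AbsoluteSums.
Context {R : realType} {T : countType}.
Implicit Types (a b c : T -> R) (D : set T).
Local Notation mu := (@lebesgue_measure R).

Definition asum a : Prop := (\esum_(e in [set: T]) `|a e|%:E < +oo)%E.

(* Convertible to [edge_sum] when [T] is the type of edges. *)
Definition rsum a : R :=
  fine (\esum_(e in [set: T]) (Num.max (a e) 0)%:E)
  - fine (\esum_(e in [set: T]) (Num.max (- a e) 0)%:E).

Lemma asum_le a b : (forall e, `|a e| <= `|b e|) -> asum b -> asum a.
Proof. by move=> ab; apply: le_lt_trans; apply: le_esum => e _; rewrite lee_fin. Qed.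

Lemma asum_norm a : asum (fun e => `|a e|) <-> asum a.
Proof. by split; apply: asum_le => e; rewrite normr_id. Qed.

Lemma asumD a b : asum a -> asum b -> asum (fun e => a e + b e).
Proof.
move=> sa sb; apply: (@le_lt_trans _ _ (\esum_(e in [set: T]) (`|a e|%:E + `|b e|%:E))%E).
  by apply: le_esum => e _; rewrite -EFinD lee_fin ler_normD.
by rewrite esumD// ?lte_add_pinfty// => e _; rewrite lee_fin.
Qed.

Lemma asumN a : asum a -> asum (fun e => - a e).
Proof. by apply: asum_le => e; rewrite normrN. Qed.

Lemma asumB a b : asum a -> asum b -> asum (fun e => a e - b e).
Proof. by move=> sa sb; apply: asumD => //; exact: asumN. Qed.

Lemma asum_fset D a : finite_set D -> (forall e, ~ D e -> a e = 0) -> asum a.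
Proof.
move=> fD a0; rewrite /asum (esumID D)// !setTI [X in (_ + X)%E]esum1; last first.
  by move=> e /a0 ->; rewrite normr0.
rewrite adde0 esum_fset// fsbig_finite//=.
by rewrite sumEFin ltry.
Qed.

Lemma asumZ k a : asum a -> asum (fun e => k * a e).
Proof.
move=> sa; have [n kn] : exists n : nat, `|k| <= n%:R.
  by exists (Num.truncn `|k|).+1; rewrite ltW// truncnS_gt.
apply: (@asum_le _ (fun e => n%:R * a e)).
  by move=> e; rewrite !normrM ler_wpM2r// normr_nat.
elim: n {kn} => [|n IH].
  by apply: (@asum_fset set0) => // e _; rewrite mul0r.
rewrite (_ : (fun e => _) = (fun e => n%:R * a e + a e)); first exact: asumD.
by apply/funext => e; rewrite -natr1 mulrDl mul1r.
Qed.

Lemma esum_finK a : (forall e, 0 <= a e) -> asum a ->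
  (fine (\esum_(e in [set: T]) (a e)%:E))%:E = (\esum_(e in [set: T]) (a e)%:E)%E.
Proof.
move=> a0 sa; rewrite fineK// ge0_fin_numE ?esum_ge0//.
  apply: le_lt_trans sa; apply: le_esum => e _; rewrite lee_fin; exact: ler_norm.
by move=> e _; rewrite lee_fin.
Qed.

Lemma asum_pos a : asum a -> asum (fun e => Num.max (a e) 0).
Proof.
apply: asum_le => e; case: (leP (a e) 0) => a0; first by rewrite normr0.
by rewrite gtr0_norm// ler_norm.
Qed.

Lemma asum_neg a : asum a -> asum (fun e => Num.max (- a e) 0).
Proof. by move=> /asumN/asum_pos. Qed.

Lemma fine_esumD a b : (forall e, 0 <= a e) -> (forall e, 0 <= b e) ->
  asum a -> asum b ->
  fine (\esum_(e in [set: T]) (a e + b e)%:E) =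
  fine (\esum_(e in [set: T]) (a e)%:E) + fine (\esum_(e in [set: T]) (b e)%:E).
Proof.
move=> a0 b0 sa sb; apply: EFin_inj.
rewrite EFinD !esum_finK//; last 2 first.
- by move=> e; rewrite addr_ge0.
- exact: asumD.
by rewrite -esumD// => e _; rewrite lee_fin.
Qed.

(** The value does not depend on the decomposition: with [c = a - b], the positive part of [c] plus
    [b] equals the negative part of [c] plus [a], and these non-negative families can be summed.
    Additivity of [rsum] rests on this. *)
Lemma rsumB_ge0 a b : (forall e, 0 <= a e) -> (forall e, 0 <= b e) ->
  asum a -> asum b ->
  rsum (fun e => a e - b e) = fine (\esum_(e in [set: T]) (a e)%:E)
    - fine (\esum_(e in [set: T]) (b e)%:E).
Proof.
move=> a0 b0 sa sb; have sab := asumB sa sb.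
have sp := asum_pos sab; have sn := asum_neg sab.
have ge0max (r : R) : 0 <= Num.max r 0 by rewrite le_max lexx orbT.
apply/eqP; rewrite /rsum subr_eq addrAC eq_sym subr_eq; apply/eqP.
apply: EFin_inj; rewrite !EFinD !esum_finK//.
rewrite -!esumD//; try by move=> e _; rewrite lee_fin.
apply: eq_esum => e _; rewrite -!EFinD; congr EFin.
rewrite opprB.
by case: (leP (a e - b e) 0) => h; case: (leP (b e - a e) 0) => h'; lra.
Qed.

Lemma rsumE a : rsum a = rsum (fun e => Num.max (a e) 0 - Num.max (- a e) 0).
Proof.
congr rsum; apply/funext => e.
by case: (leP (a e) 0) => h; case: (leP (- a e) 0) => h'; lra.
Qed.

Lemma rsumD a b : asum a -> asum b -> rsum (fun e => a e + b e) = rsum a + rsum b.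
Proof.
move=> sa sb.
have ge0max (r : R) : 0 <= Num.max r 0 by rewrite le_max lexx orbT.
rewrite (rsumE a) (rsumE b).
rewrite (rsumB_ge0 _ _ (asum_pos sa) (asum_neg sa))//.
rewrite (rsumB_ge0 _ _ (asum_pos sb) (asum_neg sb))//.
transitivity (rsum (fun e => (Num.max (a e) 0 + Num.max (b e) 0) -
                          (Num.max (- a e) 0 + Num.max (- b e) 0))).
  congr rsum; apply/funext => e; rewrite opprD addrACA.
  by congr +%R; [case: (leP (a e) 0) => h; case: (leP (- a e) 0) => h'
               |case: (leP (b e) 0) => h; case: (leP (- b e) 0) => h']; lra.
have pa := asum_pos sa; have pb := asum_pos sb.
have na := asum_neg sa; have nb := asum_neg sb.
rewrite rsumB_ge0; last 4 first.
- by move=> e; rewrite addr_ge0.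
- by move=> e; rewrite addr_ge0.
- exact: asumD.
- exact: asumD.
rewrite (fine_esumD (fun e => ge0max (a e)) (fun e => ge0max (b e)) pa pb).
rewrite (fine_esumD (fun e => ge0max (- a e)) (fun e => ge0max (- b e)) na nb).
by rewrite opprD addrACA.
Qed.

Lemma rsumN a : rsum (fun e => - a e) = - rsum a.
Proof.
rewrite /rsum opprB; congr (_ - _); congr fine.
by apply: eq_esum => e _; rewrite opprK.
Qed.

Lemma rsumB a b : asum a -> asum b -> rsum (fun e => a e - b e) = rsum a - rsum b.
Proof. by move=> sa sb; rewrite rsumD ?rsumN//; exact: asumN. Qed.

Lemma rsum_fset D a : finite_set D -> (forall e, ~ D e -> a e = 0) ->
  rsum a = \sum_(e \in D) a e.
Proof.
move=> fD a0.
have H (b : T -> R) : (forall e, 0 <= b e) -> (forall e, ~ D e -> b e = 0) ->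
    fine (\esum_(e in [set: T]) (b e)%:E) = \sum_(e \in D) b e.
  move=> b0 bD; rewrite (esumID D) ?setTI; last by move=> e _; rewrite lee_fin.
  rewrite [X in (_ + X)%E]esum1; last by move=> e /bD ->.
  rewrite adde0 esum_fset; [|exact: fD|by move=> e _; rewrite lee_fin].
  by rewrite !fsbig_finite//= sumEFin.
have ge0max (r : R) : 0 <= Num.max r 0 by rewrite le_max lexx orbT.
rewrite /rsum !H//; last 2 first.
- by move=> e /a0 ->; rewrite oppr0 maxxx.
- by move=> e /a0 ->; rewrite maxxx.
rewrite !fsbig_finite//= -sumrB; apply: eq_bigr => e _.
by case: (leP (a e) 0) => h; case: (leP (- a e) 0) => h'; lra.
Qed.

Lemma rsum0 : rsum (fun=> 0) = 0.
Proof. by rewrite (@rsum_fset set0)// fsbig_set0. Qed.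

Lemma normr_rsum_le a : asum a ->
  (`|rsum a|%:E <= \esum_(e in [set: T]) `|a e|%:E)%E.
Proof.
move=> sa.
have ge0max (r : R) : 0 <= Num.max r 0 by rewrite le_max lexx orbT.
rewrite -esum_finK//; last exact/asum_norm.
rewrite lee_fin.
have le1 : fine (\esum_(e in [set: T]) (Num.max (a e) 0)%:E) <= fine (\esum_(e in [set: T]) `|a e|%:E).
  rewrite -lee_fin !esum_finK//; [|exact/asum_norm|exact: asum_pos].
  by apply: le_esum => e _; rewrite lee_fin ge_max ler_norm normr_ge0.
have le2 : fine (\esum_(e in [set: T]) (Num.max (- a e) 0)%:E) <= fine (\esum_(e in [set: T]) `|a e|%:E).
  rewrite -lee_fin !esum_finK//; [|exact/asum_norm|exact: asum_neg].
  by apply: le_esum => e _; rewrite lee_fin ge_max normr_ge0 -normrN ler_norm.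
have ge1 : 0 <= fine (\esum_(e in [set: T]) (Num.max (a e) 0)%:E).
  by apply/fine_ge0/esum_ge0 => e _; rewrite lee_fin.
have ge2 : 0 <= fine (\esum_(e in [set: T]) (Num.max (- a e) 0)%:E).
  by apply/fine_ge0/esum_ge0 => e _; rewrite lee_fin.
by rewrite /rsum ler_norml; apply/andP; split; lra.
Qed.

(** Dominated convergence: a finite set [F] carries all but [eps] of the sum of the [|c e|], and
    [S k] eventually misses [F]. *)
Lemma rsum_restr_cvg0 (S : nat -> set T) c : asum c ->
  (forall e, exists N, forall k, (N <= k)%N -> ~ S k e) ->
  rsum (fun e => if e \in S k then c e else 0) @[k --> \oo] --> 0.
Proof.
move=> sc Se; apply/cvgrPdist_lt => eps eps0.
have fs : (\esum_(e in [set: T]) `|c e|%:E)%E \is a fin_num.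
  by rewrite ge0_fin_numE// esum_ge0.
have [_ [F [fF _] <-] HF] := ub_ereal_sup_adherent eps0 fs.
have [N HN] : exists N, forall k, (N <= k)%N -> S k `&` F = set0.
  have /finite_seqP[s Fs] := fF.
  have [N HN] : exists N, forall e, e \in s -> forall k, (N <= k)%N -> ~ S k e.
    elim: s {F fF HF Fs} => [|e s [N IH]]; first by exists 0%N.
    have [M HM] := Se e; exists (maxn N M) => e'; rewrite inE => /predU1P[->|es] k.
      by rewrite geq_max => /andP[_]; exact: HM.
    by rewrite geq_max => /andP[kN _]; exact: (IH e').
  exists N => k Nk; apply/seteqP; split => // e [Ske]; rewrite Fs => es.
  exact: (HN e es k Nk).
near=> k.
have SF : S k `&` F = set0 by apply: HN; near: k; exact: nbhs_infty_ge.
set ck := fun e => _.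
have sck : asum ck.
  by apply: asum_le sc => e; rewrite /ck; case: ifP => // _; rewrite normr0.
rewrite sub0r normrN -lte_fin; apply: le_lt_trans (normr_rsum_le sck) _.
have : (\esum_(e in [set: T]) `|ck e|%:E + \sum_(e \in F) `|c e|%:E <=
        \esum_(e in [set: T]) `|c e|%:E)%E.
  rewrite (esumID (S k) _ (fun e => `|c e|%:E)) ?setTI; last by move=> e _; rewrite lee_fin.
  apply: leeD.
    rewrite [leRHS]esum_mkcond; apply: le_esum => e _.
    by rewrite /ck; case: ifP => // _; rewrite normr0.
  apply: esum_ge; exists F => //; split => // e Fe Ske.
  by have : (S k `&` F) e by []; rewrite SF.
move: HF; rewrite -/(esum _ _); move: fs.
have : (\esum_(e in [set: T]) `|ck e|%:E)%E \is a fin_num.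
  by rewrite ge0_fin_numE// esum_ge0.
rewrite fsbig_finite//= sumEFin.
case: (\esum_(e in [set: T]) `|ck e|%:E)%E => // x _.
case: (\esum_(e in [set: T]) `|c e|%:E)%E => // y _.
by rewrite -EFinB -EFinD !lte_fin lee_fin; lra.
Unshelve. all: by end_near. Qed.

(** Turns a sum over a countable type into a series, so that monotone convergence and Borel-Cantelli
    for sequences apply. Integers that encode no element contribute 0. *)
Lemma esum_pickle (a : T -> \bar R) : (forall e, 0 <= a e)%E ->
  (\esum_(e in [set: T]) a e = \sum_(n <oo) oapp a 0 (pickle_inv n))%E.
Proof.
move=> a0; rewrite nneseries_esumT; last by move=> n; case: pickle_inv.
transitivity (\esum_(n in [set n | pickle_inv n != None :> option T]) oapp a 0%E (pickle_inv n)).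
  transitivity (\esum_(n in choice.pickle @` [set: T]) oapp a 0%E (pickle_inv n)).
    rewrite esum_image; last by move=> x y _ _; exact: (pcan_inj choice.pickleK).
    by apply: eq_esum => e _; rewrite pickleK_inv.
  congr esum; apply/seteqP; split => [_ [e _ <-]|n /=]; first by rewrite /= pickleK_inv.
  case E : (pickle_inv n) => [e|]// _; exists e => //.
  by have := pickle_invK (T := T) n; rewrite /ocancel/= E.
rewrite esum_mkcond; apply: eq_esum => n _.
case E : (pickle_inv n) => [e|]; case: ifPn => //.
by rewrite notin_setE/= E.
Qed.

Lemma integral_esum (D : set R) (f : T -> R -> \bar R) : measurable D ->
  (forall e, measurable_fun D (f e)) -> (forall e x, 0 <= f e x)%E ->
  (\int[mu]_(x in D) (\esum_(e in [set: T]) f e x) =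
   \esum_(e in [set: T]) \int[mu]_(x in D) f e x)%E.
Proof.
move=> mD mf f0; rewrite esum_pickle; last by move=> e; exact: integral_ge0.
transitivity (\int[mu]_(x in D) \sum_(n <oo) oapp (f^~ x) 0 (pickle_inv n))%E.
  by apply: eq_integral => x _; rewrite esum_pickle.
rewrite integral_nneseries//.
- apply: eq_eseriesr => n _; case: pickle_inv => [e|]//=.
  by rewrite integral0.
- by move=> n; case: pickle_inv => [e|]; [exact: mf|exact: measurable_cst].
- by move=> n x _; case: pickle_inv => [e|]; [exact: f0|].
Qed.

Lemma borel_cantelli_count (A : T -> set R) : (forall e, measurable (A e)) ->
  (\esum_(e in [set: T]) mu (A e) < +oo)%E ->
  {ae mu, forall t, finite_set [set e | A e t]}.
Proof.
move=> mA; rewrite esum_pickle => // sA.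
pose F n := oapp A set0 (pickle_inv n).
have mF n : measurable (F n) by rewrite /F; case: pickle_inv => [e|]; [exact: mA|exact: measurable0].
have FA n : oapp (fun e => mu (A e)) 0%E (pickle_inv n) = mu (F n).
  by rewrite /F; case: pickle_inv => //=; rewrite measure0.
have {}sA : (\sum_(n <oo) mu (F n) < +oo)%E.
  by under eq_eseriesr do rewrite -FA.
exists (lim_sup_set F); split.
- apply: bigcap_measurable => // k _; apply: bigcup_measurable => j _; exact: mF.
- exact: lim_sup_set_cvg0.
move=> t /= nf n _.
apply: contrapT => H; apply: nf.
apply: (@sub_finite_set _ _ (choice.pickle @^-1` `I_n)).
  move=> e /= Ae; rewrite ltnNge; apply/negP => ne; apply: H; exists (choice.pickle e) => //.
  by rewrite /F pickleK_inv.
apply: finite_preimage; last exact: finite_II.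
by move=> x y _ _; exact: (pcan_inj choice.pickleK).
Qed.

(** Sum and integral are exchanged for the positive parts [p] and the negative parts [q] separately;
    the two sums then agree for almost every [t]. *)
Lemma rsum_Rintegral_eq0 (D : set R) (f : T -> R -> R) : measurable D ->
  (forall e, measurable_fun D (f e)) ->
  (\esum_(e in [set: T]) \int[mu]_(x in D) `|f e x|%:E < +oo)%E ->
  {ae mu, forall t, D t -> rsum (f^~ t) = 0} ->
  rsum (fun e => \int[mu]_(x in D) f e x) = 0.
Proof.
move=> mD mf sf f0.
have ge0max (r : R) : 0 <= Num.max r 0 by rewrite le_max lexx orbT.
pose p e t := Num.max (f e t) 0; pose q e t := Num.max (- f e t) 0.
have mp e : measurable_fun D (p e) by apply: measurable_maxr.
have mq e : measurable_fun D (q e).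
  by apply: measurable_maxr => //; exact: measurable_funN.
have p0 e t : 0 <= p e t by exact: ge0max.
have q0 e t : 0 <= q e t by exact: ge0max.
have pq e t : f e t = p e t - q e t.
  by rewrite /p /q; case: (leP (f e t) 0) => h; case: (leP (- f e t) 0) => h'; lra.
have intfe e : mu.-integrable D (EFin \o f e).
  apply/integrableP; split.
    by apply/measurable_EFinP; exact: mf.
  apply: le_lt_trans sf; rewrite (esumID [set e]) ?setTI; last by move=> *; exact: integral_ge0.
  by rewrite esum_set1 ?leeDl ?esum_ge0//; do ?[move=> *; exact: integral_ge0|exact: integral_ge0].
have intpe e : mu.-integrable D (EFin \o p e).
  apply: le_integrable (intfe e) => //; first by apply/measurable_EFinP; exact: mp.
  by move=> t _ /=; rewrite lee_fin /p; case: (leP (f e t) 0) => h; rewrite ?normr0.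
have intqe e : mu.-integrable D (EFin \o q e).
  apply: le_integrable (intfe e) => //; first by apply/measurable_EFinP; exact: mq.
  by move=> t _ /=; rewrite lee_fin /q; case: (leP (- f e t) 0) => h; rewrite ?normr0 ?normrN.
have fK (g : T -> R -> R) : (forall e, mu.-integrable D (EFin \o g e)) ->
    forall e, ((\int[mu]_(x in D) g e x)%:E = \int[mu]_(x in D) (g e x)%:E)%E.
  by move=> ig e; rewrite /Rintegral fineK//; exact: (integrable_fin_num _ (ig e)).
have domp : (\esum_(e in [set: T]) \int[mu]_(x in D) (p e x)%:E < +oo)%E.
  apply: le_lt_trans sf; apply: le_esum => e _; apply: ge0_le_integral => //.
  - by move=> t _; rewrite lee_fin; exact: p0.
  - by apply/measurable_EFinP; exact: mp.
  - by apply/measurable_EFinP; apply: measurableT_comp => //; exact: mf.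
  - by move=> t _; rewrite lee_fin /p ge_max ler_norm normr_ge0.
have domq : (\esum_(e in [set: T]) \int[mu]_(x in D) (q e x)%:E < +oo)%E.
  apply: le_lt_trans sf; apply: le_esum => e _; apply: ge0_le_integral => //.
  - by move=> t _; rewrite lee_fin; exact: q0.
  - by apply/measurable_EFinP; exact: mq.
  - by apply/measurable_EFinP; apply: measurableT_comp => //; exact: mf.
  - by move=> t _; rewrite lee_fin /q ge_max normr_ge0 -normrN ler_norm.
have as_ (g : T -> R -> R) : (forall e, mu.-integrable D (EFin \o g e)) ->
   (forall e t, 0 <= g e t) ->
   (\esum_(e in [set: T]) \int[mu]_(x in D) (g e x)%:E < +oo)%E ->
   asum (fun e => \int[mu]_(x in D) g e x).
  move=> ig g0; apply: le_lt_trans; apply: le_esum => e _.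
  by rewrite ger0_norm ?fK//; apply: Rintegral_ge0.
transitivity (rsum (fun e => \int[mu]_(x in D) p e x - \int[mu]_(x in D) q e x)).
  congr rsum; apply/funext => e; rewrite -RintegralB//.
  by apply: eq_Rintegral => t _; rewrite pq.
rewrite rsumB_ge0; last 4 first.
- by move=> e; apply: Rintegral_ge0 => t _; exact: p0.
- by move=> e; apply: Rintegral_ge0 => t _; exact: q0.
- exact: as_ intpe p0 domp.
- exact: as_ intqe q0 domq.
apply/eqP; rewrite subr_eq0; apply/eqP; congr fine.
under eq_esum do rewrite fK//.
under [RHS]eq_esum do rewrite fK//.
have IE (g : T -> R -> R) : (forall e, measurable_fun D (g e)) -> (forall e t, 0 <= g e t) ->
   (\esum_(e in [set: T]) \int[mu]_(x in D) (g e x)%:E =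
    \int[mu]_(x in D) \esum_(e in [set: T]) (g e x)%:E)%E.
  move=> mg g0; rewrite integral_esum//.
  by move=> e; apply/measurable_EFinP; exact: mg.
rewrite (IE p mp p0) (IE q mq q0).
(* As [fine] sends [+oo] to 0, a vanishing [rsum] identifies the two sums only where they are
   finite, which integrability ensures almost everywhere. *)
have sfae : {ae mu, forall t, D t -> (\esum_(e in [set: T]) `|f e t|%:E < +oo)%E}.
  have : mu.-integrable D (fun t => \esum_(e in [set: T]) `|f e t|%:E)%E.
    apply/integrableP; split.
      under eq_fun do rewrite esum_pickle//.
      apply: ge0_emeasurable_sum => n; last first.
        move=> _; case: pickle_inv => //= e; apply/measurable_EFinP; apply: measurableT_comp => //; exact: mf.
      by move=> x _ _; case: pickle_inv => /=.
    under eq_integral do rewrite gee0_abs ?esum_ge0//.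
    rewrite integral_esum//.
    by move=> e; apply/measurable_EFinP; apply: measurableT_comp => //; exact: mf.
  move/integrable_ae => /(_ mD); apply: filterS.
  by move=> t H /H; rewrite ge0_fin_numE// esum_ge0.
have mes (g : T -> R -> R) : (forall e, measurable_fun D (g e)) -> (forall e t, 0 <= g e t) ->
   measurable_fun D (fun t => \esum_(e in [set: T]) (g e t)%:E)%E.
  move=> mg g0.
  rewrite (_ : (fun t => _) =
      fun t => (\sum_(n <oo) oapp (fun e => (g e t)%:E) 0 (pickle_inv n))%E); last first.
    by apply/funext => t; rewrite esum_pickle// => e; rewrite lee_fin; exact: g0.
  apply: ge0_emeasurable_sum => n.
    by move=> x _ _; case: pickle_inv => //= e; rewrite lee_fin; exact: g0.
  move=> _; case: pickle_inv => //= e; apply/measurable_EFinP; exact: mg.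
apply: ge0_ae_eq_integral => //.
- exact: mes mp p0.
- exact: mes mq q0.
- by move=> t _; apply: esum_ge0 => e _; rewrite lee_fin; exact: p0.
- by move=> t _; apply: esum_ge0 => e _; rewrite lee_fin; exact: q0.
move: f0 sfae; apply: filterS2; first exact: (ae_filter_ringOfSetsType mu).
move=> t H1 H2 Dt; have := H1 Dt; have {}H2 : asum (f^~ t) := H2 Dt.
rewrite /rsum => /eqP; rewrite subr_eq0 => /eqP h; have := congr1 EFin h.
by rewrite !esum_finK//; [exact: asum_neg|exact: asum_pos].
Qed.

End AbsoluteSums.

(** * Edge cuts and fluxes *)

Section Cuts.
Context {R : realType} (G : metricGraph R).
Local Notation V := (vertex G).
Local Notation E := (edge G).
Implicit Types (W B A : set V) (e : E) (v w : V).

Definition cut W : set E := [set e | ~ (W (src e) <-> W (tgt e))].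
Definition touch W : set E := [set e | W (src e) \/ W (tgt e)].
Definition inside W : set E := [set e | W (src e) /\ W (tgt e)].

(** An inductive form of the walks in [path_connected], extended at the far end; [reach_path] and
    [path_reach] translate between the two. *)
Inductive reach (ES : set E) v : V -> Prop :=
| reach_refl : reach ES v v
| reach_step w w' e : reach ES v w -> ES e -> joins (@src R G) (@tgt R G) e w w' ->
    reach ES v w'.

Lemma joinsC e v w : joins (@src R G) (@tgt R G) e v w -> joins (@src R G) (@tgt R G) e w v.
Proof. by case; [right|left]. Qed.

Lemma reach_trans (ES : set E) u v w : reach ES u v -> reach ES v w -> reach ES u w.
Proof. by move=> uv; elim=> // a b e _ IH ESe j; exact: reach_step IH ESe j. Qed.

Lemma reach1 (ES : set E) e v w : ES e -> joins (@src R G) (@tgt R G) e v w -> reach ES v w.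
Proof. by move=> ESe; apply: reach_step ESe; exact: reach_refl. Qed.

Lemma reach_sym (ES : set E) v w : reach ES v w -> reach ES w v.
Proof.
elim=> [|a b e _ IH ESe j]; first exact: reach_refl.
by apply: reach_trans IH; exact: reach1 ESe (joinsC j).
Qed.

Lemma reach_path (ES : set E) v w : reach ES v w -> exists p : seq V,
  path (fun a b => `[< exists2 e, ES e & joins (@src R G) (@tgt R G) e a b >]) v p
  /\ last v p = w.
Proof.
elim=> [|a b e _ [p [pp pl]] ESe j]; first by exists [::].
exists (rcons p b); rewrite rcons_path last_rcons pp pl/=; split => //.
by apply/asboolP; exists e.
Qed.

Lemma path_reach (ES : set E) v p :
  path (fun a b => `[< exists2 e, ES e & joins (@src R G) (@tgt R G) e a b >]) v p ->
  reach ES v (last v p).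
Proof.
elim/last_ind: p => [|p x IH]; first by move=> _; exact: reach_refl.
rewrite rcons_path last_rcons => /andP[/IH H /asboolP[e ESe j]].
exact: reach_step H ESe j.
Qed.

Lemma reachT v w : reach setT v w.
Proof.
by have [p [pp <-]] := graph_connected (v := v) (w := w) I I; exact: path_reach.
Qed.

Definition vconnected W := forall v w, W v -> W w -> reach (inside W) v w.

(** The component of [v] in the subgraph induced by [B]. For [v] outside [B] it is the singleton of
    [v]. *)
Definition comp B v : set V := reach (inside B) v.

Lemma comp_sub B v : B v -> comp B v `<=` B.
Proof.
by move=> Bv w; case=> // a b e _ [Bs Bt] [[_ <-]|[<- _]].
Qed.

Lemma comp_inside B v w : comp B v w -> reach (inside (comp B v)) v w.
Proof.
elim=> [|a b e va IH iBe j]; first exact: reach_refl.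
have vb : comp B v b by exact: reach_step va iBe j.
apply: (reach_step IH _ j).
by move: va vb; case: j => -[<- <-] va vb; split.
Qed.

Lemma comp_connected B v : vconnected (comp B v).
Proof.
move=> w w' vw vw'; apply: reach_trans (comp_inside vw').
by apply: reach_sym; exact: comp_inside.
Qed.

(** An edge with both ends in [B] cannot leave a component of [B]. *)
Lemma cut_comp B v : B v -> cut (comp B v) `<=` cut B.
Proof.
move=> Bv e ce Be; apply: ce.
have st : joins (@src R G) (@tgt R G) e (src e) (tgt e) by left.
split => H.
  have Bs := comp_sub Bv H.
  by apply: (reach_step H _ st); split => //; exact/Be.
have Bt := comp_sub Bv H.
by apply: (reach_step H _ (joinsC st)); split => //; exact/Be.
Qed.

Lemma touch_finite W : finite_set W -> finite_set (touch W).
Proof.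
move=> fW; apply: (@sub_finite_set _ _ (\bigcup_(v in W) [set e | src e = v \/ tgt e = v])).
  by move=> e [Ws|Wt]; [exists (src e) => //; left|exists (tgt e) => //; right].
by apply: bigcup_finite => // v _; exact: locally_finite.
Qed.

Lemma cut_touch W : cut W `<=` touch W.
Proof.
move=> e ce; apply: contrapT => H; apply: ce.
by split => ?; exfalso; apply: H; [left|right].
Qed.

Lemma cut_setI A B : cut (A `&` B) `<=` cut A `|` cut B.
Proof.
move=> e ce; apply: contrapT => H; apply: ce.
have Ae : A (src e) <-> A (tgt e) by apply: contrapT => ?; apply: H; left.
have Be : B (src e) <-> B (tgt e) by apply: contrapT => ?; apply: H; right.
by split => -[/Ae ? /Be ?].
Qed.

Lemma cut_setC A : cut (~` A) = cut A.
Proof.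
apply/seteqP; split => e ce Ae; apply: ce; first by split => ? /Ae.
by split => H; apply: contrapT => nH; have := nH; rewrite -[~ _]/((~` A) _) => /Ae.
Qed.

Lemma cut_setD A B : cut (A `\` B) `<=` cut A `|` cut B.
Proof. by rewrite setDE -(cut_setC B); exact: cut_setI. Qed.

(** Follow a walk in the whole graph from [v0] to [w]: after its last entry into [B], which is
    through a cut edge, it stays in one component. A set with finite cut thus has finitely many
    components. *)
Lemma comp_cover B v0 w : B v0 -> B w -> comp B v0 w \/
  exists2 u, (exists2 e, cut B e & src e = u \/ tgt e = u) /\ B u & comp B u w.
Proof.
move=> Bv0; elim: (reachT v0 w) => [_|a b e _ IH _ j Bb]; first by left; exact: reach_refl.
have [Ba|nBa] := pselect (B a).
  have st u : comp B u a -> comp B u b.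
    move=> ua; apply: (reach_step ua _ j).
    by move: Ba Bb; case: j => -[<- <-] Ba Bb; split.
  by have [va|[u ? ua]] := IH Ba; [left; exact: st|right; exists u => //; exact: st].
right; exists b; last exact: reach_refl.
split => //; exists e.
  by move=> ceB; apply: nBa; case: j => -[? ?]; subst; exact/ceB.
by case: j => -[]; [right|left].
Qed.

Lemma infinite_comp B : infinite_set B -> finite_set (cut B) ->
  exists2 v, B v & infinite_set (comp B v).
Proof.
move=> iB fB; apply: contrapT => H; apply: iB.
have fc v : B v -> finite_set (comp B v).
  by move=> Bv; apply: contrapT => nf; apply: H; exists v.
have [->|/set0P[v0 Bv0]] := eqVneq B set0; first exact: finite_set0.
pose F := [set u | (exists2 e, cut B e & src e = u \/ tgt e = u) /\ B u].
apply: (@sub_finite_set _ _ (comp B v0 `|` \bigcup_(u in F) comp B u)).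
  by move=> w Bw; have [?|[u Fu uw]] := comp_cover Bv0 Bw; [left|right; exists u].
rewrite finite_setU; split; first exact: fc.
apply: bigcup_finite => [|u [_ /fc]//].
apply: (@sub_finite_set _ _ ((@src R G) @` cut B `|` (@tgt R G) @` cut B)).
  by move=> u [[e ce [<-|<-]] _]; [left|right]; exists e.
by rewrite finite_setU; split; exact: finite_image.
Qed.

(** Not a metric ball: the vertices are exhausted by finite sets according to their codes. *)
Definition vball (n : nat) : set V := [set v | (choice.pickle v < n)%N].

Lemma vball_finite n : finite_set (vball n).
Proof.
apply: (@finite_preimage _ _ `I_n choice.pickle); last exact: finite_II.
by move=> x y _ _; exact: (pcan_inj choice.pickleK).
Qed.

(** The combinatorial counterpart of a sequence representing an end inside [W]. The conditions imply
    that [Ws n] contains no vertex of code below [n]. *)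
Definition chain W (Ws : nat -> set V) := [/\ Ws 0%N `<=` W,
  forall n, Ws n.+1 `<=` Ws n `\` vball n.+1 & forall n, [/\ infinite_set (Ws n),
    finite_set (cut (Ws n)) & vconnected (Ws n)]].

(** An argument in the style of König's lemma: removing a finite set keeps the set infinite and its
    cut finite, so some component is again infinite with finite cut. *)
Lemma infinite_chain W : infinite_set W -> finite_set (cut W) -> exists Ws, chain W Ws.
Proof.
move=> iW fW.
pose good B B' := [/\ B' `<=` B, infinite_set B', finite_set (cut B') & vconnected B'].
have goodP B : infinite_set B -> finite_set (cut B) -> exists B', good B B'.
  move=> iB fB; have [v Bv iv] := infinite_comp iB fB.
  exists (comp B v); split => //.
  - exact: comp_sub.
  - exact: sub_finite_set (cut_comp Bv) fB.
  - exact: comp_connected.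
(* The default [set0] is never taken, since [step] is only applied to infinite sets with finite
   cut. *)
pose step B := xget set0 (good B).
have stepP B : infinite_set B -> finite_set (cut B) -> good B (step B).
  by move=> iB fB; apply: xgetPex; exact: goodP.
pose Ws := fix Ws n := if n is m.+1 then step (Ws m `\` vball m.+1) else step W.
have WsP n : infinite_set (Ws n) /\ finite_set (cut (Ws n)) ->
    good (Ws n `\` vball n.+1) (Ws n.+1).
  move=> [iWn fWn]; apply: stepP.
    by apply: infinite_setD => //; exact: vball_finite.
  apply: sub_finite_set (@cut_setD _ _) _; rewrite finite_setU; split => //.
  by apply: sub_finite_set (@cut_touch _) _; apply: touch_finite; exact: vball_finite.
have inv n : [/\ infinite_set (Ws n), finite_set (cut (Ws n)) & vconnected (Ws n)].
  elim: n => [|n [i f _]]; first by have [] := stepP W iW fW.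
  by have [] := WsP n (conj i f).
exists Ws; split => //; first by have [] := stepP W iW fW.
by move=> n; have [i f _] := inv n; have [] := WsP n (conj i f).
Qed.

Lemma chain_le W Ws m n : chain W Ws -> (m <= n)%N -> Ws n `<=` Ws m.
Proof.
move=> [_ Wn _]; elim: n => [|n IH]; first by rewrite leqn0 => /eqP ->.
rewrite leq_eqVlt => /predU1P[->//|]; rewrite ltnS => /IH.
by apply: subset_trans => v /Wn [].
Qed.

Lemma chain_sub W Ws n : chain W Ws -> Ws n `<=` W.
Proof. by move=> c; apply: subset_trans (chain_le c (leq0n n)) _; case: c. Qed.

Lemma chain_notin W Ws v n : chain W Ws -> (choice.pickle v < n)%N -> ~ Ws n v.
Proof.
move=> c vn Wv; have [_ Wn _] := c.
have := chain_le c vn Wv => /Wn[_]; apply; exact: ltnSn.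
Qed.

Lemma finite_chain_notin W Ws (F : set V) : chain W Ws -> finite_set F ->
  exists N, forall n, (N <= n)%N -> Ws n `&` F = set0.
Proof.
move=> c /finite_seqP[s ->].
have [N HN] : exists N, forall v, v \in s -> (choice.pickle v < N)%N.
  elim: s => [|v s [N IH]]; first by exists 0%N.
  exists (maxn (choice.pickle v).+1 N) => w; rewrite inE => /predU1P[->|/IH].
    by rewrite leq_max leqnn.
  by rewrite leq_max => ->; rewrite orbT.
exists N => n Nn; apply/seteqP; split => // v [Wv /= vs].
exact: (chain_notin c (leq_trans (HN v vs) Nn)).
Qed.

End Cuts.

(** * Fluxes against indicators of tame vertex sets *)

Section Flux.
Context {R : realType} (G : metricGraph R).
Local Notation V := (vertex G).
Local Notation E := (edge G).
Implicit Types (W B A : set V) (e : E) (v w : V) (p q : E -> R) (a : V -> R).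

Definition flux p q a e : R := p e * a (tgt e) - q e * a (src e).

(** The edges touching [W] carry both the open set [star W] and the piecewise linear interpolation
    of the indicator of [W], hence [touch] and not [inside]. *)
Definition tame W := finite_set (cut W) /\
  asum (fun e => if e \in touch W then len e else 0).

Lemma tame_sub W B : tame W -> B `<=` W -> finite_set (cut B) -> tame B.
Proof.
move=> [_ tW] BW fB; split => //; apply: asum_le tW => e.
case: ifPn => [|_]; last by rewrite normr0.
by rewrite inE => -[] /BW ?; rewrite ifT// inE; [left|right].
Qed.

Lemma tame_finite W : finite_set W -> tame W.
Proof.
move=> fW; have ft := touch_finite fW; split; first exact: sub_finite_set (@cut_touch _ _ _) ft.
by apply: asum_fset ft _ => e; rewrite -notin_setE => /negPf ->.
Qed.

Lemma tame_setD W B : tame W -> finite_set (cut B) -> tame (W `\` B).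
Proof.
move=> tW fB; apply: (tame_sub tW); first exact: subDsetl.
by apply: sub_finite_set (@cut_setD _ _ _ _) _; rewrite finite_setU; case: tW.
Qed.

(** For tame [W] the first term is non-zero on finitely many edges only, and the second is dominated
    by a summable family; this makes the flux summable. *)
Lemma flux_indic p q W e : flux p q \1_W e =
  (if e \in cut W then flux p q \1_W e else 0) + (if e \in inside W then p e - q e else 0).
Proof.
rewrite /flux !indicE.
have [Ws|Ws] := boolP (src e \in W); have [Wt|Wt] := boolP (tgt e \in W); rewrite /= ?mulr1 ?mulr0.
- rewrite memNset; last first.
    by apply; split => _; apply/set_mem.
  by rewrite add0r mem_set//; split; apply/set_mem.
- rewrite mem_set; last by move=> [/(_ (set_mem Ws)) /mem_set]; rewrite (negPf Wt).
  by rewrite memNset ?addr0// => -[_ /mem_set]; rewrite (negPf Wt).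
- rewrite mem_set; last by move=> [_ /(_ (set_mem Wt)) /mem_set]; rewrite (negPf Ws).
  by rewrite memNset ?addr0// => -[/mem_set]; rewrite (negPf Ws).
- rewrite subrr if_same add0r memNset// => -[/mem_set]; by rewrite (negPf Ws).
Qed.

Section FluxSum.
(** In the application [p e - q e] is the integral of [- h] over [e], and [m] is built from the
    squared norms of [f'] and [h] on the edges. *)
Variables (p q m : E -> R).
Hypotheses (pqm : forall e, `|p e - q e| <= m e + len e) (sm : asum m)
  (kir : forall v, rsum (flux p q \1_[set v]) = 0).

Lemma asum_inside W : tame W -> asum (fun e => if e \in inside W then p e - q e else 0).
Proof.
move=> [_ tW]; apply: asum_le (asumD sm tW) => e.
have l0 := len_gt0 e.
case: ifPn => [|_]; last by rewrite normr0.
rewrite inE => -[Ws Wt]; rewrite ifT; last by rewrite inE; left.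
by apply: le_trans (ler_norm _); exact: pqm.
Qed.

Lemma asum_flux W : tame W -> asum (flux p q \1_W).
Proof.
move=> tW; have := asum_inside tW.
have fc : asum (fun e => if e \in cut W then flux p q \1_W e else 0).
  by apply: asum_fset tW.1 _ => e; rewrite -notin_setE => /negPf ->.
move=> /(asumD fc); congr asum; apply/funext => e.
by rewrite -flux_indic.
Qed.

Lemma rsum_fluxU W B : tame W -> tame B -> W `&` B = set0 ->
  rsum (flux p q \1_(W `|` B)) = rsum (flux p q \1_W) + rsum (flux p q \1_B).
Proof.
move=> tW tB WB; rewrite -rsumD; [|exact: asum_flux|exact: asum_flux].
congr rsum; apply/funext => e; rewrite /flux.
have H v : \1_(W `|` B) v = \1_W v + \1_B v :> R.
  rewrite !indicE in_setU.
  case: (boolP (v \in W)) => Wv; case: (boolP (v \in B)) => Bv /=;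
    rewrite ?addr0 ?add0r//.
  by have : (set0 : set V) v by rewrite -WB; split; exact: set_mem.
by rewrite !H; ring.
Qed.

Lemma rsum_flux_finite W : finite_set W -> rsum (flux p q \1_W) = 0.
Proof.
move=> /finite_seqP[s ->]; elim: s => [|v s IH].
  rewrite (_ : flux _ _ _ = fun=> 0) ?rsum0//; apply/funext => e.
  by rewrite /flux !indicE !memNset//=; ring.
have [vs|vs] := boolP (v \in s).
  rewrite -[RHS]IH; congr rsum; congr flux; congr indic.
  apply/seteqP; split => w /=; rewrite inE; last by move=> ->; rewrite orbT.
  by case/predU1P => [->|].
rewrite (_ : [set` v :: s] = [set v] `|` [set` s]); last first.
  apply/seteqP; split => w /=; rewrite inE; first by case/predU1P; [left|right].
  by case=> [->|->]; rewrite ?eqxx ?orbT.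
rewrite rsum_fluxU ?kir ?IH ?addr0//.
- exact: tame_finite.
- exact: tame_finite.
- by apply/seteqP; split => // w [/= -> ws]; rewrite ws in vs.
Qed.

(* A counterexample with the fewest ends inside it cannot be split into two
   infinite tame sets, so every chain inside it is cofinite in it. *)
Lemma rsum_flux_tame (Y : choiceType) (C0 : set Y) (EN : set V -> set Y) :
  finite_set C0 ->
  (forall W, EN W `<=` C0) ->
  (forall W, tame W -> infinite_set W -> EN W !=set0) ->
  (forall W B, B `<=` W -> EN B `<=` EN W) ->
  (forall W B, W `&` B = set0 -> EN W `&` EN B = set0) ->
  (forall W Ws, tame W -> chain W Ws ->
    rsum (flux p q \1_(Ws n)) @[n --> \oo] --> 0) ->
  forall W, tame W -> rsum (flux p q \1_W) = 0.
Proof.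
move=> fC0 ENC0 ENne ENsub ENdisj lim0 W.
have fEN A : finite_set (EN A) by exact: sub_finite_set (ENC0 A) fC0.
have [n] := ubnP (#|` fset_set (EN W)|)%fset.
elim: n W => // n IH W nW tW.
have [fW|iW] := pselect (finite_set W); first exact: rsum_flux_finite.
have [[B [BW fB iB iWB]]|H] := pselect (exists B, [/\ B `<=` W, finite_set (cut B),
    infinite_set B & infinite_set (W `\` B)]).
  have tB := tame_sub tW BW fB; have tWB := tame_setD tW fB.
  have disj : B `&` (W `\` B) = set0 by rewrite setDIK.
  have WE : W = B `|` (W `\` B) by rewrite setDUK.
  (* The infinite piece [A'] contains an end, which is an end inside [W] but not inside [A]; so [A]
     has fewer ends than [W]. *)
  have lt A A' : tame A -> tame A' -> A `<=` W -> A' `<=` W -> infinite_set A' ->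
      A `&` A' = set0 -> (#|` fset_set (EN A)| < n)%N.
    move=> tA tA' AW A'W iA' AA'; rewrite -ltnS; apply: leq_trans nW; rewrite ltnS.
    apply: fproper_ltn_card; rewrite fproperE; apply/andP; split.
      by rewrite -fset_set_sub//; exact: ENsub.
    apply/negP; rewrite -fset_set_sub// => sub.
    have [y yA'] := ENne A' tA' iA'.
    have : (EN A `&` EN A') y by split => //; apply: sub; exact: ENsub yA'.
    by rewrite ENdisj.
  rewrite WE rsum_fluxU//.
  rewrite (IH B) ?(IH (W `\` B)) ?addr0//.
    by apply: (lt _ B) => //; rewrite setIC.
  by apply: (lt _ (W `\` B)) => //; exact: subDsetl.
have [Ws cWs] := infinite_chain iW tW.1.
(* The complement of [Ws n0] in [W] is finite and has zero flux, so the flux is constant along the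
   chain and equals its limit 0. *)
have eqn n0 : rsum (flux p q \1_W) = rsum (flux p q \1_(Ws n0)).
  have [_ _ /(_ n0)[iWn fWn _]] := cWs.
  have WnW := chain_sub (n := n0) cWs.
  have fD : finite_set (W `\` Ws n0).
    by apply: contrapT => iD; apply: H; exists (Ws n0).
  rewrite -[in LHS](setDUK WnW) rsum_fluxU//.
  - by rewrite (rsum_flux_finite fD) addr0.
  - exact: tame_sub tW WnW fWn.
  - exact: tame_finite.
  - by rewrite setDIK.
have := lim0 W Ws tW cWs.
rewrite (_ : (fun n0 => _) = fun=> rsum (flux p q \1_W)); last first.
  by apply/funext => n0; rewrite -eqn.
by move=> /(cvg_lim (@Rhausdorff _)) <-; rewrite lim_cst.
Qed.

End FluxSum.
End Flux.

(** * Superlevel sets and the layer cake formula *)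

Section LayerCake.
Context {R : realType}.
Local Notation mu := (@lebesgue_measure R).

Lemma asum_ge_finite (T : countType) (c : T -> R) d (S : set T) : asum c -> 0 < d ->
  (forall e, S e -> d <= `|c e|) -> finite_set S.
Proof.
move=> sc d0 cS; apply: contrapT => iS.
set s := fine (\esum_(e in [set: T]) `|c e|%:E).
have [n Hn] : exists n : nat, s < n%:R * d.
  exists (Num.truncn (`|s / d|)).+1; rewrite -ltr_pdivrMr//.
  by apply: le_lt_trans (ler_norm _) _; exact: truncnS_gt.
have [B BS nB] := infinite_set_fset n iS.
have : ((n%:R * d)%:E <= \esum_(e in [set: T]) `|c e|%:E)%E.
  apply: esum_ge; exists [set` B]; first by split.
  rewrite fsbig_finite//= set_fsetK sumEFin lee_fin.
  apply: (@le_trans _ _ (\sum_(i <- B) d)).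
    have -> : \sum_(i <- B) d = #|` B|%:R * d.
      by rewrite big_const_seq count_predT iter_addr_0 [RHS]mulr_natl.
    by rewrite ler_wpM2r ?(ltW d0)// ler_nat.
  by rewrite big_seq [leRHS]big_seq; apply: ler_sum => e eB; apply: cS; exact: BS.
rewrite -(esum_finK (a := fun e => `|c e|))//; last exact/asum_norm.
by rewrite lee_fin leNgt -/s Hn.
Qed.

(** A crude arithmetic-geometric mean inequality; it turns products of trace bounds into summable
    ones. *)
Lemma normr_le_of_sqrM (x M N : R) : 0 <= M -> 0 <= N -> x ^+ 2 <= M * N -> `|x| <= M + N.
Proof.
move=> M0 N0 H; rewrite -(@ler_pXn2r _ 2)// ?nnegrE ?addr_ge0// real_normK ?num_real//.
by apply: (le_trans H); have := mulr_ge0 M0 N0; have := sqr_ge0 M; have := sqr_ge0 N; nra.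
Qed.

Lemma itv_posI x : `]0, +oo[ `&` [set t : R | t < x] = `]0, x[%classic.
Proof. by apply/seteqP; split => t /=; rewrite !in_itv/= andbT => /andP. Qed.

Lemma mu_itv_pos x : (mu `]0%R, x[%classic = (Num.max x 0)%:E)%E.
Proof.
rewrite lebesgue_measure_itv/= lte_fin.
by case: ltP => x0; rewrite ?oppr0 ?adde0 //=.
Qed.

Lemma measurable_ltr_fun (D : set R) x : measurable_fun D (fun t : R => (t < x)%R%:R : R).
Proof.
apply: (measurableT_comp (f := fun b : bool => b%:R : R)) => //.
by apply: measurable_fun_ltr.
Qed.

Lemma integrable_lt_pos x : mu.-integrable `]0, +oo[ (EFin \o (fun t => (t < x)%R%:R)).
Proof.
apply/integrableP; split; first by apply/measurable_EFinP; exact: measurable_ltr_fun.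
apply: (@le_lt_trans _ _ (\int[mu]_(t in `]0%R, +oo[) ((cst 1%E : R -> \bar R) \_ [set t : R | (t < x)%R]) t)%E).
  rewrite le_eqVlt; apply/orP; left; apply/eqP.
  apply: eq_integral => t _; rewrite patchE /=; case: (boolP (t < x)) => tx.
    by rewrite mem_set//= normr1.
  by rewrite memNset/= ?normr0//; exact/negP.
rewrite -integral_mkcondr itv_posI integral_cst// mul1e.
by apply: le_lt_trans (ltry (Num.max x 0)); rewrite -mu_itv_pos.
Qed.

Lemma Rintegral_lt_pos x : \int[mu]_(t in `]0, +oo[) ((t < x)%R%:R) = Num.max x 0.
Proof.
transitivity (\int[mu]_(t in `]0, +oo[) ((cst 1 : R -> R) \_ [set t : R | t < x]) t).
  apply: eq_Rintegral => t _; rewrite patchE /=; case: (boolP (t < x)) => tx.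
    by rewrite mem_set.
  by rewrite memNset//; exact/negP.
rewrite -Rintegral_mkcondr itv_posI Rintegral_cst// mul1r.
by have := mu_itv_pos x => /(congr1 fine).
Qed.

Context (G : metricGraph R).
Local Notation V := (vertex G).
Local Notation E := (edge G).
Variables (p q M N : E -> R) (a : V -> R).
Let lam (e : E) := Num.min (len e) 1.
Hypotheses (M0 : forall e, 0 <= M e) (N0 : forall e, 0 <= N e) (sM : asum M) (sN : asum N).
Hypotheses (hq : forall e, lam e * q e ^+ 2 <= M e)
  (hpq : forall e, (p e - q e) ^+ 2 <= lam e * M e).
Hypotheses (has_ : forall e, lam e * a (src e) ^+ 2 <= N e)
  (hat : forall e, lam e * a (tgt e) ^+ 2 <= N e)
  (had : forall e, (a (tgt e) - a (src e)) ^+ 2 <= lam e * N e).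
Hypothesis T0 : forall W, tame W -> rsum (flux p q \1_W) = 0.

Let lam0 e : 0 < lam e. Proof. by rewrite /lam lt_min len_gt0 ltr01. Qed.
Let laml e : lam e <= len e. Proof. by rewrite /lam ge_min lexx. Qed.

Let pqa e : `|(p e - q e) * a (tgt e)| <= M e + N e.
Proof.
apply: normr_le_of_sqrM => //; rewrite exprMn.
apply: (@le_trans _ _ (lam e * M e * a (tgt e) ^+ 2)); first by rewrite ler_wpM2r ?sqr_ge0.
by rewrite mulrAC mulrC ler_wpM2l.
Qed.

Let qda e : `|q e * (a (tgt e) - a (src e))| <= M e + N e.
Proof.
apply: normr_le_of_sqrM => //; rewrite exprMn.
apply: (@le_trans _ _ (q e ^+ 2 * (lam e * N e))); first by rewrite ler_wpM2l ?sqr_ge0.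
by rewrite mulrA ler_wpM2r// mulrC.
Qed.

Let ada e v : v = src e \/ v = tgt e -> `|a v * (a (tgt e) - a (src e))| <= N e + N e.
Proof.
move=> ve; apply: normr_le_of_sqrM => //; rewrite exprMn.
apply: (@le_trans _ _ (a v ^+ 2 * (lam e * N e))); first by rewrite ler_wpM2l ?sqr_ge0.
by rewrite mulrA ler_wpM2r// mulrC; case: ve => ->.
Qed.

Let superlevel t : set V := [set v | t < a v].

(** An edge is cut at level [t] exactly when [t] lies in [[mn e, mx e[]. The lengths of these
    intervals need not be summable near 0, so they are truncated below at [n.+1%:R^-1] before
    Borel-Cantelli is applied, for each [n]. *)
Let tame_superlevel : {ae mu, forall t, 0 < t -> tame (superlevel t)}.
Proof.
pose mx e := Num.max (a (src e)) (a (tgt e)); pose mn e := Num.min (a (src e)) (a (tgt e)).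
pose A (n : nat) e : set R := `[Num.max (mn e) n.+1%:R^-1, Num.max (mx e) n.+1%:R^-1[%classic.
have mA n e : measurable (A n e) by exact: measurable_itv.
have mnmx e : mn e <= mx e by rewrite /mn /mx; case: (leP (a (src e))) => // /ltW.
have le_max2 (x y z : R) : x <= y -> Num.max x z <= Num.max y z.
  by move=> xy; rewrite ge_max !le_max xy lexx !orbT.
(* If [mx e] exceeds the truncation level, the length is at most [mx e - mn e], which is at most
   [n.+1%:R] times [mx e * (mx e - mn e)], and [ada] bounds this product. Otherwise the interval is
   empty. *)
have muA n e : (mu (A n e) <= (n.+1%:R * (N e + N e))%:E)%E.
  have le1 : Num.max (mn e) n.+1%:R^-1 <= Num.max (mx e) n.+1%:R^-1.
    exact: le_max2.
  have -> : mu (A n e) = (Num.max (mx e) n.+1%:R^-1 - Num.max (mn e) n.+1%:R^-1)%:E.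
    rewrite -(fine_mu_itv true true le1) fineK//.
    rewrite ge0_fin_numE//; apply: le_lt_trans (mu_itv_lty (Num.max (mn e) n.+1%:R^-1) (Num.max (mx e) n.+1%:R^-1)).
    by apply: le_measure; rewrite ?inE//; apply: subset_itvl; rewrite bnd_simp.
  rewrite lee_fin; have n0 : 0 < (n.+1%:R : R) by rewrite ltr0n.
  have ni0 : 0 < (n.+1%:R : R)^-1 by rewrite invr_gt0.
  have [ms|ms] := leP (mx e) n.+1%:R^-1.
    rewrite (max_r (le_trans (mnmx e) ms)) subrr mulr_ge0//.
    by rewrite addr_ge0.
  have : `|mx e * (a (tgt e) - a (src e))| <= N e + N e.
    have [->|->] : mx e = a (src e) \/ mx e = a (tgt e).
    - by rewrite /mx; case: (leP (a (src e))); [right|left].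
    - by apply: ada; left.
    - by apply: ada; right.
  have -> : `|mx e * (a (tgt e) - a (src e))| = mx e * (mx e - mn e).
    rewrite normrM gtr0_norm ?(lt_trans ni0)//; congr (_ * _).
    rewrite /mx /mn; case: (leP (a (src e)) (a (tgt e))) => h.
      by rewrite ger0_norm// subr_ge0.
    by rewrite ltr0_norm ?subr_lt0// opprB.
  move=> H; rewrite -ler_pdivrMl//.
  apply: le_trans H; apply: ler_pM.
  - exact: ltW.
  - by rewrite subr_ge0 ge_max mnmx (ltW ms).
  - exact: ltW.
  - by rewrite lerB// le_max lexx.
have BC n : {ae mu, forall t, finite_set [set e | A n e t]}.
  apply: borel_cantelli_count => //.
  apply: (@le_lt_trans _ _ (\esum_(e in [set: E]) (n.+1%:R * (N e + N e))%:E)%E).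
    exact: le_esum.
  have := asumZ n.+1%:R (asumD sN sN); apply: le_lt_trans; apply: le_esum => e _.
  by rewrite lee_fin ler_norm.
have := ae_foralln BC; apply: filterS => t Ht t0.
have [n nt] : exists n : nat, n.+1%:R^-1 < t.
  exists (Num.truncn t^-1); rewrite invf_plt ?posrE//; exact: truncnS_gt.
have fcut : finite_set (cut (superlevel t)).
  apply: sub_finite_set (Ht n) => e ce; rewrite /A/= in_itv/= ge_max lt_max.
  rewrite (ltW nt) andbT.
  have [ts|ts] := ltP t (a (src e)); have [tt|tt] := ltP t (a (tgt e)).
  - by exfalso; apply: ce; split.
  - by rewrite /mn /mx ge_min tt orbT lt_max ts.
  - by rewrite /mn /mx ge_min ts lt_max tt orbT.
  - by exfalso; apply: ce; rewrite /superlevel /= !ltNge ts tt.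
split => //.
have touchN e : touch (superlevel t) e -> lam e * t ^+ 2 <= N e.
  move=> [h|h]; [apply: le_trans (has_ e)|apply: le_trans (hat e)];
    by rewrite ler_wpM2l ?(ltW (lam0 e))// ler_sqr ?nnegrE ?(ltW t0)// ?(ltW h)// (le_trans (ltW t0))// ltW.
(* Chebyshev: touching edges of length at most 1 satisfy [len e <= N e / t ^+ 2], while longer ones
   satisfy [t ^+ 2 <= N e] and are finite in number. *)
pose S := [set e | touch (superlevel t) e /\ 1 < len e].
have fS : finite_set S.
  apply: (asum_ge_finite sN (exprn_gt0 2 t0)) => e [te l1].
  rewrite ger0_norm//; apply: le_trans (touchN e te).
  by rewrite /lam min_r ?mul1r// ltW.
apply: (@asum_le _ _ _ (fun e => (t ^+ 2)^-1 * N e + (if e \in S then len e else 0))).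
  move=> e; have l0 := len_gt0 e.
  have ge0 : 0 <= (t ^+ 2)^-1 * N e by rewrite mulr_ge0// invr_ge0 sqr_ge0.
  case: ifPn => [|_]; last by rewrite normr0.
  rewrite inE => te; rewrite gtr0_norm//; apply: le_trans (ler_norm _).
  have [l1|l1] := leP (len e) 1.
    rewrite memNset ?addr0; last by move=> [_]; rewrite ltNge l1.
    rewrite mulrC ler_pdivlMr ?exprn_gt0//.
    by have := touchN e te; rewrite /lam min_l.
  by rewrite mem_set// lerDr.
apply: asumD; first exact: asumZ.
by apply: asum_fset fS _ => e; rewrite -notin_setE => /negPf ->.
Qed.

(* Layer cake: [max (a v) 0] is the integral over [t > 0] of the indicator of
   [a v > t], and almost all of these superlevel sets are tame. *)
Lemma rsum_flux_pos : rsum (flux p q (fun v => Num.max (a v) 0)) = 0.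
Proof.
pose f e t := flux p q \1_(superlevel t) e.
have fE e t : f e t = p e * (t < a (tgt e))%R%:R - q e * (t < a (src e))%R%:R.
  by rewrite /f /flux !indicE !mem_setE.
have ip e : mu.-integrable `]0, +oo[ (EFin \o (fun t => p e * (t < a (tgt e))%R%:R)).
  by have := integrableZl _ (p e) (integrable_lt_pos (a (tgt e))); apply.
have iq e : mu.-integrable `]0, +oo[ (EFin \o (fun t => q e * (t < a (src e))%R%:R)).
  by have := integrableZl _ (q e) (integrable_lt_pos (a (src e))); apply.
have -> : flux p q (fun v => Num.max (a v) 0) = fun e => \int[mu]_(t in `]0, +oo[) f e t.
  apply/funext => e; rewrite /flux -!Rintegral_lt_pos.
  rewrite -!RintegralZl//; do ?exact: integrable_lt_pos.
  by rewrite -RintegralB//; apply: eq_Rintegral => t _; rewrite fE.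
apply: rsum_Rintegral_eq0 => //.
- move=> e; rewrite (_ : f e = fun t => p e * (t < a (tgt e))%R%:R - q e * (t < a (src e))%R%:R).
    apply: measurable_funB; apply: measurable_funM => //; exact: measurable_ltr_fun.
  by apply/funext => t; rewrite fE.
- apply: (@le_lt_trans _ _ (\esum_(e in [set: E]) ((M e + N e) + (M e + N e))%:E)%E); last first.
    have := asumD (asumD sM sN) (asumD sM sN); apply: le_lt_trans.
    by apply: le_esum => e _; rewrite lee_fin ler_norm.
  apply: le_esum => e _.
  set mx := Num.max (a (src e)) (a (tgt e)); set mn := Num.min (a (src e)) (a (tgt e)).
  (* Regroup the flux as [p e - q e] times the target indicator plus [q e] times the difference of
     the indicators. That difference is non-zero only for [t] between [mn] and [mx], so the integral
     of [g] is controlled by [pqa] and [qda]. *)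
  pose g t := `|p e - q e| * (t < a (tgt e))%R%:R + `|q e| * ((t < mx)%R%:R - (t < mn)%R%:R).
  have i1 : mu.-integrable `]0, +oo[ (EFin \o (fun t => `|p e - q e| * (t < a (tgt e))%R%:R)).
    by have := integrableZl _ (`|p e - q e|) (integrable_lt_pos (a (tgt e))); apply.
  have i2 : mu.-integrable `]0, +oo[ (EFin \o (fun t => (t < mx)%R%:R - (t < mn)%R%:R)).
    by have := integrableB _ (integrable_lt_pos mx) (integrable_lt_pos mn); apply.
  have i3 : mu.-integrable `]0, +oo[ (EFin \o (fun t => `|q e| * ((t < mx)%R%:R - (t < mn)%R%:R))).
    by have := integrableZl _ (`|q e|) i2; apply.
  have ig : mu.-integrable `]0, +oo[ (EFin \o g).
    by have := integrableD _ i1 i3; apply.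
  have fg t : `|f e t| <= g t.
    rewrite fE /g.
    have -> : p e * (t < a (tgt e))%R%:R - q e * (t < a (src e))%R%:R =
       (p e - q e) * (t < a (tgt e))%R%:R +
       q e * ((t < a (tgt e))%R%:R - (t < a (src e))%R%:R) by ring.
    apply: le_trans (ler_normD _ _) _; apply: lerD.
      by rewrite normrM [X in _ * X]ger0_norm.
    rewrite normrM ler_wpM2l// /mx /mn lt_max lt_min.
    by case: (t < a (tgt e)); case: (t < a (src e)) => /=;
      rewrite ?subrr ?sub0r ?subr0 ?normrN ?normr1 ?normr0.
  apply: (@le_trans _ _ (\int[mu]_(t in `]0%R, +oo[) (g t)%:E)%E).
    apply: ge0_le_integral => //.
    - apply/measurable_EFinP; apply: measurableT_comp => //.
      rewrite (_ : f e = fun t => p e * (t < a (tgt e))%R%:R - q e * (t < a (src e))%R%:R).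
        apply: measurable_funB; apply: measurable_funM => //; exact: measurable_ltr_fun.
      by apply/funext => t; rewrite fE.
    - exact: measurable_int ig.
    - by move=> t _; rewrite lee_fin.
  have -> : (\int[mu]_(t in `]0%R, +oo[) (g t)%:E)%E = (\int[mu]_(t in `]0, +oo[) g t)%:E.
    by rewrite /Rintegral fineK//; exact: (integrable_fin_num _ ig).
  rewrite lee_fin /g RintegralD// RintegralZl//; last exact: integrable_lt_pos.
  rewrite RintegralZl// RintegralB//; do ?exact: integrable_lt_pos.
  rewrite !Rintegral_lt_pos; apply: lerD.
    apply: le_trans (pqa e); rewrite normrM ler_wpM2l//.
    by rewrite ge_max ler_norm normr_ge0.
  apply: le_trans (qda e); rewrite normrM ler_wpM2l//.
  apply: (@le_trans _ _ (mx - mn)).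
    rewrite /mx /mn; case: (leP (a (src e)) (a (tgt e))) => h;
    case: (leP (a (src e)) 0) => h1; case: (leP (a (tgt e)) 0) => h2; lra.
  rewrite /mx /mn; case: (leP (a (src e)) (a (tgt e))) => h; first exact: ler_norm.
  by rewrite -normrN opprB ler_norm.
- have := tame_superlevel; apply: filterS; first exact: (ae_filter_ringOfSetsType mu).
  move=> t Ht /=; rewrite in_itv/= andbT => /Ht; exact: T0.
Qed.

End LayerCake.

(** * Topology and ends of the metric graph *)

Local Open Scope quotient_scope.

Section Topology.
Context {R : realType} (G : metricGraph R).
Local Notation V := (vertex G).
Local Notation E := (edge G).
Local Notation mu := (@lebesgue_measure R).
Implicit Types (W A B : set V) (e : E) (v w : V) (x y : R).

Lemma edge_ptE e (s : set_type `[0, len e]) :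
  \pi_(mgraph G) (existT _ e s : edge_union G) = edge_pt e (set_val s).
Proof. by rewrite /edge_pt valKd. Qed.

Lemma edge_pt_surj (z : mgraph G) : exists e x, 0 <= x <= len e /\ z = edge_pt e x.
Proof.
elim/quotW: z => -[e s]; exists e, (set_val s); split; last by rewrite -edge_ptE.
by have := set_valP s; rewrite /= in_itv.
Qed.

Definition endv e x : option V :=
  if x == 0 then Some (src e) else if x == len e then Some (tgt e) else None.

Lemma edge_pt_glue e x e' x' : 0 <= x <= len e -> 0 <= x' <= len e' ->
  edge_pt e x = edge_pt e' x' <->
  (e = e' /\ x = x') \/ (endv e x <> None /\ endv e x = endv e' x').
Proof.
move=> xl xl'.
have sv e0 y (yl : 0 <= y <= len e0) :
    set_val (insubd (exist _ 0 (left_endpoint_subproof e0) : set_type `[0, len e0]) y) = y.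
  by rewrite set_valE insubdK// inE/= in_itv.
rewrite /edge_pt; split.
  move=> /eqmodP; rewrite /= /glue => /orP[/eqP h|/andP[/eqP h1 /eqP h2]].
    left; have ee' : e = e' by exact: (congr1 (@projT1 _ _) h).
    subst e'; split => //; rewrite -(sv e x xl) -(sv e x' xl').
    exact: (congr1 (fun z : edge_union G => set_val (projT2 z)) h).
  by right; move: h1 h2; rewrite /= !sv// /endv.
case=> [[<- <-]//|[h1 h2]]; apply/eqmodP; rewrite /= /glue; apply/orP; right.
by apply/andP; split; [apply/eqP|apply/eqP]; rewrite /= !sv.
Qed.

(** Only endpoints are glued, so agreement with common vertex values [a] suffices to descend to the
    quotient. *)
Lemma mgraph_lift (T : Type) (f : E -> R -> T) (a : V -> T) :
  (forall e, f e 0 = a (src e)) -> (forall e, f e (len e) = a (tgt e)) ->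
  exists F : mgraph G -> T, forall e x, 0 <= x <= len e -> F (edge_pt e x) = f e x.
Proof.
move=> f0 fl.
have H (z : mgraph G) : exists t, forall e x, 0 <= x <= len e -> z = edge_pt e x -> f e x = t.
  have [e [x [xl ->]]] := edge_pt_surj z; exists (f e x) => e' x' xl' /(edge_pt_glue xl xl').
  have fv e0 x0 v : endv e0 x0 = Some v -> f e0 x0 = a v.
    rewrite /endv; case: eqP => [-> [<-]//|_]; by case: eqP => // -> [<-].
  case=> [[<- <-]//|[]]; case E1 : (endv e x) => [v|]// _ /esym E2.
  by rewrite (fv _ _ _ E1) (fv _ _ _ E2).
have [F HF] := choice H; exists F => e x xl; exact/esym/HF.
Qed.

Lemma open_mgraphP (U : set (mgraph G)) : open U <-> forall e,
  exists2 Q : set R, open Q & forall x, 0 <= x <= len e -> (Q x <-> U (edge_pt e x)).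
Proof.
split.
  move=> oU e; have := oU; rewrite /open/= /quotient_open => /sigT_openP /(_ e).
  move=> [Q oQ QU]; exists Q => // x xl.
  have xl' : x \in `[0, len e]%classic by rewrite inE/= in_itv.
  have := congr1 (fun S => S (exist _ x xl' : set_type `[0, len e])) QU.
  by rewrite /preimage/= edge_ptE set_valE /= => ->.
move=> H; rewrite /open/= /quotient_open; apply/sigT_openP => e.
have [Q oQ QU] := H e; exists Q => //; apply/seteqP; split => s /=.
  by rewrite edge_ptE -QU//; have := set_valP s; rewrite /= in_itv.
by rewrite edge_ptE -QU//; have := set_valP s; rewrite /= in_itv.
Qed.

Lemma edge_pt_continuous e : {within `[0, len e], continuous (@edge_pt R G e)}.
Proof.
apply/continuousP => U /open_mgraphP /(_ e)[Q oQ QU].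
apply/open_subspaceP; exists Q => //.
apply/seteqP; split => x [h xl]; split => //; move: xl; rewrite /= in_itv/= => xl.
  exact/QU.
exact/(QU x xl).
Qed.

Lemma mgraph_continuous (T : topologicalType) (F : mgraph G -> T) :
  (forall e, {within `[0, len e], continuous (F \o edge_pt e)}) -> continuous F.
Proof.
move=> cF; apply/continuousP => U oU; apply/open_mgraphP => e.
have /continuousP /(_ _ oU) := cF e.
move=> /open_subspaceP[Q oQ QU]; exists Q => // x xl.
have xl' : `[0, len e]%classic x by rewrite /= in_itv.
split => h.
  by have : (Q `&` `[0, len e]) x by []; rewrite QU => -[].
by have : ((F \o edge_pt e) @^-1` U `&` `[0, len e]) x by []; rewrite -QU => -[].
Qed.

(** An isolated vertex would be the whole connected graph, which has infinitely many vertices. *)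
Lemma vertex_edge v : exists e : E, src e = v \/ tgt e = v.
Proof.
apply: contrapT => H; apply: (@infinite_vertices R G).
apply: sub_finite_set (finite_set1 v) => w _ /=.
elim: (reachT v w) => // a b e _ -> _ j.
by exfalso; apply: H; exists e; case: j => -[]; [left|right].
Qed.

Lemma vertex_pt_exists : exists vp : V -> mgraph G,
  forall e, edge_pt e 0 = vp (src e) /\ edge_pt e (len e) = vp (tgt e).
Proof.
have H v : exists z : mgraph G, forall e,
    (src e = v -> edge_pt e 0 = z) /\ (tgt e = v -> edge_pt e (len e) = z).
  have [e ev] := vertex_edge v.
  have l0 := len_gt0 e.
  have v0 e' : 0 <= (0 : R) <= len e' by rewrite lexx ltW// len_gt0.
  have vl e' : 0 <= len e' <= len e' by rewrite lexx ltW// len_gt0.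
  have ends e' : endv e' 0 = Some (src e') by rewrite /endv eqxx.
  have endt e' : endv e' (len e') = Some (tgt e') by rewrite /endv gt_eqF ?len_gt0// eqxx.
  have [x [xl ex]] : exists x, 0 <= x <= len e /\ endv e x = Some v.
    by case: ev => <-; [exists 0|exists (len e)].
  exists (edge_pt e x) => e'; split => h; apply/edge_pt_glue => //; right.
    by rewrite ends ex h.
  by rewrite endt ex h.
have [vp Hvp] := choice H; exists vp => e.
by have [h1 _] := Hvp (src e) e; have [_ h2] := Hvp (tgt e) e; rewrite h1// h2.
Qed.

(* The set [star W] is an open neighbourhood of [W]: the edges inside [W] and the half
   edges issuing from [W] along the edges of [cut W]. Its closure is [cstar W]. *)
Definition star_at W e x : Prop :=
  (x <= len e / 2 -> W (src e)) /\ (len e / 2 <= x -> W (tgt e)).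

Definition star W : set (mgraph G) :=
  [set z | exists e x, [/\ 0 <= x <= len e, z = edge_pt e x & star_at W e x]].

Lemma half_len e : 0 < len e / 2 < len e.
Proof. by have := len_gt0 e; lra. Qed.

(** A predicate on coordinates is a function to [Prop], so [mgraph_lift] makes it independent of the
    coordinates chosen for a vertex. *)
Lemma mgraph_predP (P : E -> R -> Prop) (a : V -> Prop) :
  (forall e, P e 0 <-> a (src e)) -> (forall e, P e (len e) <-> a (tgt e)) ->
  forall e x, 0 <= x <= len e ->
  (exists e' x', [/\ 0 <= x' <= len e', edge_pt e x = edge_pt e' x' & P e' x']) <-> P e x.
Proof.
move=> P0 Pl e x xl; split; last by move=> h; exists e, x.
have [F HF] := @mgraph_lift Prop P a (fun e => propext (P0 e)) (fun e => propext (Pl e)).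
by move=> [e' [x' [xl' ee h]]]; rewrite -HF// ee HF.
Qed.

Lemma star_at0 W e : star_at W e 0 <-> W (src e).
Proof.
have := half_len e; rewrite /star_at; split => [[h _]|Ws]; first by apply: h; lra.
by split => // ?; exfalso; lra.
Qed.

Lemma star_atl W e : star_at W e (len e) <-> W (tgt e).
Proof.
have := half_len e; rewrite /star_at; split => [[_ h]|Ws]; first by apply: h; lra.
by split => // ?; exfalso; lra.
Qed.

Lemma starP W e x : 0 <= x <= len e -> (star W (edge_pt e x) <-> star_at W e x).
Proof. exact: (mgraph_predP (star_at0 W) (star_atl W)). Qed.

(** The last condition excludes the midpoints of edges with no end in [W], for which the first two
    hold vacuously. *)
Definition cstar_at W e x : Prop :=
  [/\ x < len e / 2 -> W (src e), len e / 2 < x -> W (tgt e) & W (src e) \/ W (tgt e)].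

Definition cstar W : set (mgraph G) :=
  [set z | exists e x, [/\ 0 <= x <= len e, z = edge_pt e x & cstar_at W e x]].

Lemma cstarP W e x : 0 <= x <= len e -> (cstar W (edge_pt e x) <-> cstar_at W e x).
Proof.
apply: (@mgraph_predP _ W) => e'; have := half_len e'; rewrite /cstar_at.
  split => [[h _ _]|Ws]; first by apply: h; lra.
  by split => //; [move=> ?; exfalso; lra|left].
split => [[_ h _]|Ws]; first by apply: h; lra.
by split => //; [move=> ?; exfalso; lra|right].
Qed.

Lemma open_star_at W e : open [set x | star_at W e x].
Proof.
have [Ws|Ws] := pselect (W (src e)); have [Wt|Wt] := pselect (W (tgt e)).
- rewrite (_ : mkset _ = setT); first exact: openT.
  by apply/seteqP; split.
- rewrite (_ : mkset _ = [set x | x < len e / 2]); first exact: open_lt.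
  apply/seteqP; split => x /=; first by move=> [_ h]; rewrite ltNge; apply/negP => /h.
  by move=> h; split => //; rewrite leNgt h.
- rewrite (_ : mkset _ = [set x | len e / 2 < x]); first exact: open_gt.
  apply/seteqP; split => x /=; first by move=> [h _]; rewrite ltNge; apply/negP => /h.
  by move=> h; split => //; rewrite leNgt h.
- rewrite (_ : mkset _ = set0); first exact: open0.
  apply/seteqP; split => // x /= [h1 h2].
  by have [/ltW/h1//|/h2//] := ltP x (len e / 2).
Qed.

Lemma open_star W : open (star W).
Proof.
apply/open_mgraphP => e; exists [set x | star_at W e x]; first exact: open_star_at.
by move=> x xl; rewrite starP.
Qed.

Lemma closed_cstar W : closed (cstar W).
Proof.
rewrite -openC; apply/open_mgraphP => e; exists [set x | ~ cstar_at W e x]; last first.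
  by move=> x xl /=; rewrite /setC/= cstarP.
have [Ws|Ws] := pselect (W (src e)); have [Wt|Wt] := pselect (W (tgt e)).
- rewrite (_ : mkset _ = set0); first exact: open0.
  by apply/seteqP; split => // x; apply => //; split => //; left.
- rewrite (_ : mkset _ = [set x | len e / 2 < x]); first exact: open_gt.
  apply/seteqP; split => x /=; last by move=> h [_ /(_ h)].
  move=> h; rewrite ltNge; apply/negP => h'; apply: h; split => //; last by left.
  by rewrite ltNge h'.
- rewrite (_ : mkset _ = [set x | x < len e / 2]); first exact: open_lt.
  apply/seteqP; split => x /=; last by move=> h [/(_ h)].
  move=> h; rewrite ltNge; apply/negP => h'; apply: h; split => //; last by right.
  by rewrite ltNge h'.
- rewrite (_ : mkset _ = setT); first exact: openT.
  by apply/seteqP; split => // x _ [_ _ []].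
Qed.

Lemma star_sub_cstar W : star W `<=` cstar W.
Proof.
move=> _ [e [x [xl -> [h1 h2]]]]; apply/cstarP => //; split.
- by move=> /ltW.
- by move=> /ltW.
- by have [/ltW/h1|/h2] := ltP x (len e / 2); [left|right].
Qed.

Lemma closure_star W : closure (star W) `<=` cstar W.
Proof.
rewrite [X in _ `<=` X]((closure_id _).1 (@closed_cstar W)).
exact/closureS/star_sub_cstar.
Qed.

Lemma finite_set_compact (T : topologicalType) (A : set T) : finite_set A -> compact A.
Proof.
move=> /finite_seqP[s ->]; elim: s => [|z s IH].
  rewrite (_ : mkset _ = set0); last by apply/seteqP; split.
  exact: compact0.
rewrite (_ : mkset _ = [set z] `|` [set` s]); first by apply: compactU => //; exact: compact_set1.
apply/seteqP; split => w /=; rewrite inE; first by case/predU1P; [left|right].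
by case=> [->|->]; rewrite ?eqxx ?orbT.
Qed.

(** The boundary consists of midpoints of cut edges, so it is finite. *)
Lemma boundary_star_compact W : finite_set (cut W) -> compact (boundary (star W)).
Proof.
move=> fW; apply: finite_set_compact.
apply: (@sub_finite_set _ _ ((fun e => edge_pt e (len e / 2)) @` cut W)); last exact: finite_image.
move=> z [/closure_star [e [x [xl -> [h1 h2 h3]]]]].
have si : star W `<=` interior (star W) by have : open (star W) := @open_star W; rewrite openE.
move=> ns; have hl := half_len e.
have [xh|xh|xE] := ltgtP x (len e / 2).
- exfalso; apply: ns; apply: si; apply/starP => //; split; first by move=> _; exact: h1.
  by rewrite leNgt xh.
- exfalso; apply: ns; apply: si; apply/starP => //; split; last by move=> _; exact: h2.
  by rewrite leNgt xh.
exists e; last by rewrite xE.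
move=> We; apply: ns; apply: si; apply/starP => //; split => _.
  by case: h3 => // /We.
by case: h3 => // /We.
Qed.

Lemma star_touch W z : star W z -> exists e x, [/\ 0 <= x <= len e, z = edge_pt e x & touch W e].
Proof.
move=> [e [x [xl -> [h1 h2]]]]; exists e, x; split => //.
by have [/ltW/h1|/h2] := ltP x (len e / 2); [left|right].
Qed.

Lemma star_mono A B : A `<=` B -> star A `<=` star B.
Proof.
move=> AB z [e [x [xl -> [h1 h2]]]]; exists e, x; split => //.
by split => [/h1|/h2] /AB.
Qed.

Lemma star_disj A B : A `&` B = set0 -> star A `&` star B = set0.
Proof.
move=> AB; apply/seteqP; split => // z [[e [x [xl -> [h1 h2]]]] /starP -/(_ xl)[h3 h4]].
have [/ltW xh|xh] := ltP x (len e / 2).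
  by have : (set0 : set V) (src e) by rewrite -AB; split; [exact: h1|exact: h3].
by have : (set0 : set V) (tgt e) by rewrite -AB; split; [exact: h2|exact: h4].
Qed.

Lemma star_ne W : W !=set0 -> star W !=set0.
Proof.
move=> [v Wv]; have [e [es|et]] := vertex_edge v.
  exists (edge_pt e 0); apply/starP; first by rewrite lexx ltW// len_gt0.
  by apply/star_at0; rewrite es.
exists (edge_pt e (len e)); apply/starP; first by rewrite lexx ltW// len_gt0.
by apply/star_atl; rewrite et.
Qed.

Lemma edge_arc_connected e x y : 0 <= x -> y <= len e ->
  connected ((@edge_pt R G e) @` `[x, y]).
Proof.
move=> x0 yl; apply: connected_continuous_connected.
  exact/segment_connected.
apply: (@continuous_subspaceW _ _ _ `[0, len e]); last exact: edge_pt_continuous.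
by apply: subset_itv; rewrite bnd_simp.
Qed.

(** Whole edges inside [W] join the vertices of [W], and any other point of the star is joined to
    such a vertex by an arc of its own edge. *)
Lemma connected_star W : W !=set0 -> vconnected W -> connected (star W).
Proof.
move=> [v0 Wv0] cW; have [vp Hvp] := vertex_pt_exists.
have arc e x y z1 z2 : 0 <= x -> y <= len e -> x <= z1 <= y -> x <= z2 <= y ->
    (forall t, x <= t <= y -> star_at W e t) ->
    connected_component (star W) (edge_pt e z1) (edge_pt e z2).
  move=> x0 yl z1xy z2xy H.
  have val t : x <= t <= y -> 0 <= t <= len e.
    by move=> /andP[xt ty]; rewrite (le_trans x0 xt) (le_trans ty yl).
  exists ((@edge_pt R G e) @` `[x, y]).
    split; last exact: edge_arc_connected.
      by exists z1 => //=; rewrite in_itv.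
    move=> z [t tI <-]; move: tI; rewrite /= in_itv/= => txy.
    by apply/starP; [exact: val|exact: H].
  by exists z2 => //=; rewrite in_itv.
have whole e : inside W e -> connected_component (star W) (vp (src e)) (vp (tgt e)).
  move=> [Ws Wt]; have [<- <-] := Hvp e; have l0 := ltW (len_gt0 e).
  by apply: (arc e 0 (len e)); rewrite ?lexx ?l0// => t _; split.
have vv v : W v -> connected_component (star W) (vp v0) (vp v).
  move=> Wv; elim: (cW v0 v Wv0 Wv) => [|a b e _ IH iWe j].
    apply: connected_component_refl.
    have [e [es|et]] := vertex_edge v0.
      rewrite -es -(Hvp e).1; apply/starP; first by rewrite lexx ltW// len_gt0.
      by apply/star_at0; rewrite es.
    rewrite -et -(Hvp e).2; apply/starP; first by rewrite lexx ltW// len_gt0.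
    by apply/star_atl; rewrite et.
  apply: connected_component_trans IH _.
  case: j => -[<- <-]; first exact: whole.
  by apply: connected_component_sym; exact: whole.
rewrite (_ : star W = connected_component (star W) (vp v0)); first exact: component_connected.
apply/seteqP; split => [z|]; last exact: connected_component_sub.
move=> [e [x [/andP[x0 xl] -> [h1 h2]]]].
have [/ltW xh|xh] := ltP x (len e / 2).
  apply: connected_component_trans (vv _ (h1 xh)) _.
  rewrite -(Hvp e).1; apply: (arc e 0 x); rewrite ?lexx ?x0// => t /andP[t0 tx].
  split => [_|ht]; first exact: h1.
  by apply: h2; rewrite (le_trans ht tx).
apply: connected_component_trans (vv _ (h2 xh)) _.
rewrite -(Hvp e).2; apply: (arc e x (len e)); rewrite ?lexx ?xl// => t /andP[t0 tx].
split => [ht|_]; last exact: h2.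
by apply: h1; rewrite (le_trans t0 ht).
Qed.

Lemma vol_star_lty W : tame W -> (vol (star W) < +oo)%E.
Proof.
move=> [_ tW]; apply: le_lt_trans tW; apply: le_esum => e _.
have -> : [set x : R | `[0, len e]%classic x /\ star W (edge_pt e x)] =
    `[0, len e] `&` [set x | star_at W e x].
  apply/seteqP; split => x [xl h]; split => //; have := xl; rewrite /= in_itv/= => xl'.
    exact/(starP W xl').
  exact/(starP W xl').
case: ifPn => [_|]; last first.
  rewrite notin_setE => ntW; rewrite normr0.
  have -> : `[0, len e] `&` [set x | star_at W e x] = set0; last by rewrite measure0.
  apply/seteqP; split => // x [_ [h1 h2]]; apply: ntW.
  by have [/ltW/h1|/h2] := ltP x (len e / 2); [left|right].
rewrite gtr0_norm ?len_gt0//.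
apply: (@le_trans _ _ (mu `[0%R, len e])).
  apply: le_measure; rewrite ?inE//.
  by apply: measurableI; [exact: measurable_itv|apply: open_measurable; exact: open_star_at].
by rewrite lebesgue_measure_itv/= lte_fin len_gt0 oppr0 adde0.
Qed.

(** * Subgraphs, ends and graph representations *)

Lemma induced_subproof W e : inside W e -> W (src e) /\ W (tgt e).
Proof. by []. Qed.

Definition induced W : subgraph G := Subgraph (@induced_subproof W).

Lemma path_connected_induced W : vconnected W -> connected_subgraph (induced W).
Proof. by move=> cW v w Wv Ww; apply: reach_path; exact: cW. Qed.

Lemma sub_boundary_edge (S : subgraph G) v : sub_boundary S v ->
  sub_vertex S v /\ exists2 e, incident v e & ~ sub_edge S e.
Proof.
move=> [Sv lt]; split => //; apply: contrapT => H; move: lt.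
rewrite /sub_degree /degree (_ : _ `&` _ = incident v) ?ltnn//.
apply/seteqP; split => e; first by case.
by move=> ve; split => //; apply: contrapT => nS; apply: H; exists e.
Qed.

Lemma edge_sub_boundary (S : subgraph G) v e : sub_vertex S v -> incident v e ->
  ~ sub_edge S e -> sub_boundary S v.
Proof.
move=> Sv ve nSe; split => //; apply: fproper_ltn_card.
have fi : finite_set (incident v) := @locally_finite R G v.
rewrite fproperE; apply/andP; split.
  by rewrite -fset_set_sub//; exact: finite_setIl.
apply/negP; rewrite -fset_set_sub//; last exact: finite_setIl.
by move=> /(_ _ ve)[].
Qed.

(** A midpoint is glued to no other point, so it detects its edge. Inclusions of point sets thereby
    become inclusions of edge sets. *)
Lemma sub_points_mid (S : subgraph G) e : sub_points S (edge_pt e (len e / 2)) -> sub_edge S e.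
Proof.
have hl := half_len e.
move=> [e' [x [xl ee]]]; have xl' : 0 <= x <= len e' by move: xl; rewrite /= in_itv.
have hl' : 0 <= len e / 2 <= len e by lra.
have [[<- <-]|[]] := (edge_pt_glue hl' xl').1 ee.
  by case=> [//|[x0 _]|[xE _]]; exfalso; lra.
have -> : endv e (len e / 2) = None; last by [].
by rewrite /endv; case: eqP => [h|_]; [exfalso; lra|case: eqP => // h; exfalso; lra].
Qed.

Lemma sub_points_edge (S : subgraph G) e x : sub_edge S e -> 0 <= x <= len e ->
  sub_points S (edge_pt e x).
Proof. by move=> Se xl; exists e, x; split; [rewrite /= in_itv|by []|constructor 1]. Qed.

Lemma sub_edge_mono (S S' : subgraph G) : sub_points S `<=` sub_points S' ->
  sub_edge S `<=` sub_edge S'.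
Proof.
move=> SS e Se; apply: sub_points_mid; apply: SS; apply: sub_points_edge => //.
by have := half_len e; lra.
Qed.

Lemma sub_points_induced W z : sub_points (induced W) z -> star W z.
Proof.
move=> [e [x [xl -> h]]]; have xl' : 0 <= x <= len e by move: xl; rewrite /= in_itv.
apply/starP => //; case: h => [[Ws Wt]|[-> Ws]|[-> Wt]].
- by split.
- exact/star_at0.
- exact/star_atl.
Qed.

Lemma cut_vertices W : finite_set (cut W) ->
  finite_set [set v | exists2 e, cut W e & incident v e].
Proof.
move=> fW; apply: (@sub_finite_set _ _ ((@src R G) @` cut W `|` (@tgt R G) @` cut W)).
  by move=> u [e ce [<-|<-]]; [left|right]; exists e.
by rewrite finite_setU; split; exact: finite_image.
Qed.

(** Links vertex sets to topology: the stars represent an end, and the induced subgraphs are the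
    graph representation along which its normal derivative is tested. *)
Lemma chain_end A Ws : tame A -> chain A Ws ->
  exists gamma, [/\ finite_volume_end G gamma, gamma (star \o Ws) &
    graph_representation gamma (induced \o Ws)].
Proof.
move=> tA cWs; have [_ Wn good] := cWs.
have mono n : Ws n.+1 `<=` Ws n by move=> v /Wn[].
have ne n : Ws n !=set0.
  apply/set0P/negP => /eqP W0; have [iW _ _] := good n; apply: iW; rewrite W0.
  exact: finite_set0.
have es : end_sequence (star \o Ws).
  split => [n|n|].
  - have [iW fW cW] := good n; split; first exact: star_ne.
    + exact: open_star.
    + exact: connected_star.
    + exact: boundary_star_compact.
  - exact: star_mono.
  (* A point in the closure of a star has an endpoint of its edge in the vertex set, but both
     endpoints eventually leave the chain. *)
  - apply/seteqP; split => // z H.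
    have [e [x [xl zE]]] := edge_pt_surj z.
    pose n := (maxn (choice.pickle (src e)) (choice.pickle (tgt e))).+1.
    have : cstar (Ws n) z by apply: closure_star; exact: H.
    rewrite zE cstarP// => -[_ _ []]; apply: (chain_notin cWs); rewrite /n ltnS.
      exact: leq_maxl.
    exact: leq_maxr.
pose gamma := [set U' | end_sequence U' /\ end_equiv (star \o Ws) U'].
have gU : gamma (star \o Ws) by split => // n; exists n, n; split => z.
exists gamma; split => //.
  split; first by exists (star \o Ws).
  exists (star \o Ws) => //; exists 0%N; apply: vol_star_lty.
  by apply: (tame_sub tA); [exact: (chain_sub cWs)|have [] := good 0%N].
split => [k|k|k|].
- by apply: path_connected_induced; have [] := good k.
- move=> z [e [x [xl -> h]]]; exists e, x; split => //.
  case: h => [[/mono ? /mono ?]|[? /mono ?]|[? /mono ?]];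
    [by constructor 1|by constructor 2|by constructor 3].
- have [_ fW _] := good k; apply: sub_finite_set (cut_vertices fW) => v.
  move=> /sub_boundary_edge[Wv [e ve nie]]; exists e => // We; apply: nie.
  by case: ve => vE; rewrite -vE in Wv; split => //; exact/We.
- exists (star \o Ws) => // n.
  have [_ fW _] := good n.
  (* Once a later set of the chain avoids the endpoints of the cut edges of [Ws n], every edge it
     touches lies inside [Ws n], and its star is covered by the induced subgraph. *)
  have [N HN] := finite_chain_notin cWs (cut_vertices fW).
  exists (maxn n N), n; split; last exact: sub_points_induced.
  move=> _ /star_touch[e [x [xl -> te]]]; apply: sub_points_edge => //.
  have [v [Wv ve]] : exists v, Ws (maxn n N) v /\ incident v e.
    by case: te => ?; [exists (src e)|exists (tgt e)]; split => //; [left|right].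
  have Wnv : Ws n v by exact: chain_le cWs (leq_maxl _ _) _ Wv.
  have nce : cut (Ws n) e -> False.
    move=> ce; have : (set0 : set V) v by rewrite -(HN (maxn n N) (leq_maxr _ _)); split => //; exists e.
    by [].
  have We : Ws n (src e) <-> Ws n (tgt e) by apply: contrapT.
  by case: ve => vE; rewrite -vE in Wnv; split => //; exact/We.
Qed.

(** The instance of [EN] for [rsum_flux_tame]; the lemmas below check the conditions imposed
    there. *)
Definition ends_in A : set (set (nat -> set (mgraph G))) :=
  [set gamma | finite_volume_end G gamma /\
    exists2 U, gamma U & exists n, U n `<=` star A].

Lemma ends_in_ne A : tame A -> infinite_set A -> ends_in A !=set0.
Proof.
move=> tA iA; have [Ws cWs] := infinite_chain iA tA.1.
have [gamma [fg gU _]] := chain_end tA cWs; exists gamma; split => //.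
exists (star \o Ws) => //; exists 0%N; apply: star_mono; exact: (chain_sub cWs).
Qed.

Lemma ends_in_mono A B : A `<=` B -> ends_in A `<=` ends_in B.
Proof.
move=> AB gamma [fg [U gU [n UA]]]; split => //; exists U => //; exists n.
exact: subset_trans UA (star_mono AB).
Qed.

Lemma end_sequence_le (U : nat -> set (mgraph G)) m n : end_sequence U -> (m <= n)%N ->
  U n `<=` U m.
Proof.
move=> [_ dU _]; elim: n => [|n IH]; first by rewrite leqn0 => /eqP ->.
by rewrite leq_eqVlt => /predU1P[->//|]; rewrite ltnS => /IH; exact: subset_trans.
Qed.

(** Two sequences of one end both contain a tail of a common sequence, whose members are
    non-empty. *)
Lemma ends_in_disj A B : A `&` B = set0 -> ends_in A `&` ends_in B = set0.
Proof.
move=> AB; apply/seteqP; split => // gamma [[[[U0 es0 ->] _] [U [esU eU] [n UA]]] [_ [U' [_ eU'] [m UB]]]].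
have [_ [k [_ kU]]] := eU n; have [_ [k' [_ kU']]] := eU' m.
have [/(_ (maxn k k'))[[z Uz] _ _ _] _ _] := es0.
have : (star A `&` star B) z.
  split; first by apply: UA; apply: kU; exact: end_sequence_le es0 (leq_maxl _ _) _ Uz.
  by apply: UB; apply: kU'; exact: end_sequence_le es0 (leq_maxr _ _) _ Uz.
by rewrite star_disj.
Qed.

(** The set [U n] of finite volume contains [U0 k], which contains [U' j], which contains the points
    of [S k0]; so edges of later subgraphs lie wholly in [U n]. *)
Lemma graph_representation_vol gamma S : finite_volume_end G gamma ->
  graph_representation gamma S ->
  exists k0, forall k, (k0 <= k)%N -> asum (fun e => if e \in sub_edge (S k) then len e else 0).
Proof.
move=> [[U0 es0 gE] [U gU [n vU]]] [_ dS _ [U' gU' H]].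
move: gU gU'; rewrite gE => -[_ eU] [_ eU'].
have [_ [k [_ kU]]] := eU n.
have [j [_ [jU _]]] := eU' k.
have [_ [k0 [_ k0U]]] := H j.
exists k0 => k1 k01; apply: le_lt_trans vU; apply: le_esum => e _.
case: ifPn => [|_]; last by rewrite normr0 measure_ge0.
rewrite inE gtr0_norm ?len_gt0// => Se.
have -> : [set x : R | `[0, len e]%classic x /\ U n (edge_pt e x)] = `[0, len e]%classic.
  apply/seteqP; split => x; first by case.
  move=> xl; split => //; apply: kU; apply: jU; apply: k0U.
  have dS' : sub_points (S k1) `<=` sub_points (S k0).
    elim: k1 k01 {Se} => [|k1 IH]; first by rewrite leqn0 => /eqP ->.
    rewrite leq_eqVlt => /predU1P[->//|]; rewrite ltnS => /IH.
    exact: subset_trans.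
  apply: dS'; apply: sub_points_edge => //; by move: xl; rewrite /= in_itv.
by rewrite lebesgue_measure_itv/= lte_fin len_gt0 oppr0 adde0.
Qed.

Lemma graph_representation_empty gamma S e : graph_representation gamma S ->
  (exists U, end_sequence U /\ gamma = [set U' | end_sequence U' /\ end_equiv U U']) ->
  exists N, forall k, (N <= k)%N -> ~ sub_edge (S k) e.
Proof.
move=> [_ dS _ [U' gU' H]] [U0 [es0 gE]]; move: gU'; rewrite gE => -[esU' _].
have [n nU] : exists n, ~ U' n (edge_pt e (len e / 2)).
  apply: contrapT => h; have [_ _] := esU'; apply/eqP/set0P.
  exists (edge_pt e (len e / 2)) => n _; apply: subset_closure; apply: contrapT => nU.
  by apply: h; exists n.
have [_ [k [_ kU]]] := H n.
exists k => k1 k01 Se; apply: nU; apply: kU.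
have dS' : sub_points (S k1) `<=` sub_points (S k).
  elim: k1 k01 {Se} => [|k1 IH]; first by rewrite leqn0 => /eqP ->.
  rewrite leq_eqVlt => /predU1P[->//|]; rewrite ltnS => /IH.
  exact: subset_trans.
apply: dS'; apply: sub_points_edge => //.
by have := half_len e; lra.
Qed.

End Topology.

(** * Fluxes and normal derivatives *)

Section Core.
Context {R : realType} (G : metricGraph R).
Local Notation V := (vertex G).
Local Notation E := (edge G).
Implicit Types (W A B : set V) (e : E) (v w : V) (p q m : E -> R) (S : subgraph G).

Lemma rsum_sum (T : countType) (I : Type) (s : seq I) (f : I -> T -> R) :
  (forall i, asum (f i)) ->
  asum (fun t => \sum_(i <- s) f i t) /\
  rsum (fun t => \sum_(i <- s) f i t) = \sum_(i <- s) rsum (f i).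
Proof.
move=> sf; elim: s => [|i s [sIH IH]].
  rewrite big_nil (_ : (fun t => _) = fun=> 0); last by apply/funext => t; rewrite big_nil.
  by split; [apply: (@asum_fset _ _ set0)|exact: rsum0].
rewrite big_cons (_ : (fun t => _) = fun t => f i t + \sum_(i <- s) f i t); last first.
  by apply/funext => t; rewrite big_cons.
by split; [exact: asumD|rewrite rsumD// IH].
Qed.

Lemma indic_fset (F : set V) v : finite_set F ->
  \1_F v = \sum_(i <- fset_set F) \1_[set i] v :> R.
Proof.
move=> fF; rewrite indicE -(in_fset_set fF).
have H (s : seq V) : uniq s -> (v \in s)%:R = \sum_(i <- s) \1_[set i] v :> R.
  elim: s => [|i s IH] /=; first by rewrite big_nil.
  move=> /andP[ins us]; rewrite big_cons inE -(IH us) indicE in_set1.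
  have [->|vi] /= := eqVneq v i; first by rewrite (negPf ins) addr0.
  by rewrite add0r.
by apply: H; exact: fset_uniq.
Qed.

(* When [p e] and [q e] are the derivatives at [tgt e] and [src e] in the direction
   from [src e] to [tgt e], this is the derivative at [v] pointing into [e]. *)
Definition inward_deriv p q e v : R := if v == src e then q e else - p e.

Definition normal_sum p q S : R :=
  \sum_(v \in sub_boundary S) \sum_(e \in incident v `&` sub_edge S) inward_deriv p q e v.

Lemma flux_indic1_incident p q v e : incident v e -> flux p q \1_[set v] e = - inward_deriv p q e v.
Proof.
have h1 := negbTE (loopless e).
have h2 : (tgt e == src e) = false by rewrite eq_sym.
rewrite /flux /inward_deriv !indicE !in_set1 => -[] <-; rewrite ?h1 ?h2 eqxx /= mulr1 mulr0.
  by rewrite sub0r.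
by rewrite subr0 opprK.
Qed.

Lemma flux_indic1_nincident p q v e : ~ incident v e -> flux p q \1_[set v] e = 0.
Proof.
move=> ve; rewrite /flux !indicE !in_set1.
have [sv|_] := eqVneq (src e) v; first by exfalso; apply: ve; left.
have [tv|_] := eqVneq (tgt e) v; first by exfalso; apply: ve; right.
by rewrite !mulr0 subr0.
Qed.

Lemma incident_finite v : finite_set (incident v).
Proof. exact: locally_finite. Qed.

Lemma kirchhoff_flux p q v :
  \sum_(e \in incident v) inward_deriv p q e v = 0 <-> rsum (flux p q \1_[set v]) = 0.
Proof.
rewrite (rsum_fset (incident_finite v)); last exact: flux_indic1_nincident.
have fv := incident_finite v.
rewrite !fsbig_finite//=.
rewrite [X in _ <-> X = 0](_ : _ = - \sum_(i <- fset_set (incident v)) inward_deriv p q i v).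
  by split => [->|/eqP]; rewrite ?oppr0// oppr_eq0 => /eqP.
rewrite -sumrN big_seq [RHS]big_seq; apply: eq_bigr => e.
by rewrite (in_fset_set (incident_finite v)) inE => ve; rewrite flux_indic1_incident.
Qed.

(** The part of the flux carried by the edges outside [S]; for the indicator of a finite boundary it
    is a finite sum. *)
Definition flux_off S p q (a : V -> R) e := if e \in sub_edge S then 0 else flux p q a e.

Lemma asum_flux1 p q v : asum (flux p q \1_[set v]).
Proof. exact: asum_fset (incident_finite v) (@flux_indic1_nincident p q v). Qed.

(** By the vertex condition, the derivatives into the edges of [S] and those into the other edges at
    [v] have opposite sums, and the flux is minus the inward derivative. *)
Lemma off_vertex p q S v : rsum (flux p q \1_[set v]) = 0 ->
  \sum_(e \in incident v `&` sub_edge S) inward_deriv p q e v = rsum (flux_off S p q \1_[set v]).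
Proof.
move=> k0.
pose on e := if e \in sub_edge S then flux p q \1_[set v] e else 0.
have son : asum on.
  by apply: asum_le (asum_flux1 p q v) => e; rewrite /on; case: ifP => // _; rewrite normr0.
have soff : asum (flux_off S p q \1_[set v]).
  by apply: asum_le (asum_flux1 p q v) => e; rewrite /flux_off; case: ifP => // _; rewrite normr0.
have : rsum on + rsum (flux_off S p q \1_[set v]) = 0.
  rewrite -rsumD// -[RHS]k0; congr rsum; apply/funext => e.
  by rewrite /on /flux_off; case: ifP => _; rewrite ?addr0 ?add0r.
have fin : finite_set (incident v `&` sub_edge S) by exact/finite_setIl/incident_finite.
rewrite (rsum_fset (D := incident v `&` sub_edge S))//; last first.
  move=> e h; rewrite /on; case: ifPn => //; rewrite inE => Se.
  by apply: flux_indic1_nincident => ve; exact: h.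
rewrite !fsbig_finite//= => /eqP; rewrite addrC addr_eq0 => /eqP ->.
rewrite -sumrN big_seq [RHS]big_seq; apply: eq_bigr => e.
rewrite (in_fset_set fin) inE => -[ve Se].
by rewrite /on mem_set// flux_indic1_incident// opprK.
Qed.

Lemma normal_sum_off p q S : finite_set (sub_boundary S) ->
  (forall v, rsum (flux p q \1_[set v]) = 0) ->
  asum (flux_off S p q \1_(sub_boundary S)) /\
  normal_sum p q S = rsum (flux_off S p q \1_(sub_boundary S)).
Proof.
move=> fS k0.
have E1 : flux_off S p q \1_(sub_boundary S) =
    fun e => \sum_(v <- fset_set (sub_boundary S)) flux_off S p q \1_[set v] e.
  apply/funext => e; rewrite /flux_off; case: ifP => _; first by rewrite big1.
  rewrite /flux !indic_fset// !mulr_sumr -sumrB.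
  by apply: eq_bigr.
have soff v : asum (flux_off S p q \1_[set v]).
  by apply: asum_le (asum_flux1 p q v) => e; rewrite /flux_off; case: ifP => // _; rewrite normr0.
have [s1 s2] := rsum_sum (fset_set (sub_boundary S)) soff.
rewrite E1; split => //; rewrite s2 /normal_sum fsbig_finite//=.
by apply: eq_bigr => v _; exact: off_vertex.
Qed.

(** An edge outside [S] with an endpoint in [S] touches the boundary of [S], and finitely many edges
    do. *)
Lemma tame_sub_vertex S : finite_set (sub_boundary S) ->
  asum (fun e => if e \in sub_edge S then len e else 0) -> tame (sub_vertex S).
Proof.
move=> fS sS; have ft := touch_finite fS.
have out e : touch (sub_vertex S) e -> ~ sub_edge S e -> touch (sub_boundary S) e.
  move=> [Ws|Wt] nS; [left|right].
    by apply: (edge_sub_boundary Ws _ nS); left.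
  by apply: (edge_sub_boundary Wt _ nS); right.
split.
  apply: sub_finite_set ft => e ce; apply: out; first exact: cut_touch.
  by move=> /sub_endpoints[Ws Wt]; apply: ce.
apply: asum_le (asumD sS (_ : asum (fun e => if e \in touch (sub_boundary S) then len e else 0))).
  move=> e; have l0 := len_gt0 e.
  case: ifPn => [|_]; last by rewrite normr0.
  rewrite inE => te; case: ifPn => [_|].
    rewrite !ger0_norm ?(ltW l0)//; last by rewrite addr_ge0//; [exact: ltW|case: ifP => _ //; exact: ltW].
    by rewrite lerDl; case: ifP => _ //; exact: ltW.
  by rewrite notin_setE => nS; rewrite add0r mem_set//; exact: out.
by apply: asum_fset ft _ => e; rewrite -notin_setE => /negPf ->.
Qed.

(* Summation by parts: the vertex conditions turn the flux through the boundary edges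
   outside [S] into the normal derivatives. *)
Lemma flux_sub_vertex p q m S : (forall e, `|p e - q e| <= m e + len e) -> asum m ->
  (forall v, rsum (flux p q \1_[set v]) = 0) ->
  finite_set (sub_boundary S) ->
  asum (fun e => if e \in sub_edge S then len e else 0) ->
  rsum (flux p q \1_(sub_vertex S)) = normal_sum p q S +
    rsum (fun e => if e \in sub_edge S then p e - q e else 0).
Proof.
move=> pqm sm k0 fS sS.
have [s1 ->] := normal_sum_off fS k0.
rewrite -rsumD//; last first.
  apply: asum_le (asumD sm sS) => e; case: ifP => _; last by rewrite normr0.
  by apply: le_trans (ler_norm _); exact: pqm.
congr rsum; apply/funext => e; rewrite /flux_off.
case: ifPn => [|].
  rewrite inE => /sub_endpoints[Ws Wt]; rewrite add0r /flux !indicE !mem_set//.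
  by rewrite !mulr1.
rewrite notin_setE => nS; rewrite addr0 /flux.
have H v : incident v e -> \1_(sub_vertex S) v = \1_(sub_boundary S) v :> R.
  move=> ve; rewrite !indicE.
  suff -> : (v \in sub_vertex S) = (v \in sub_boundary S) by [].
  apply/idP/idP; rewrite !inE.
    by move=> Sv; exact: edge_sub_boundary Sv ve nS.
  by case.
by rewrite !H//; [left|right].
Qed.

Lemma sub_rsum_cvg0 p q m gamma (Ss : nat -> subgraph G) :
  (forall e, `|p e - q e| <= m e + len e) -> asum m ->
  finite_volume_end G gamma -> graph_representation gamma Ss ->
  rsum (fun e => if e \in sub_edge (Ss k) then p e - q e else 0) @[k --> \oo] --> 0.
Proof.
move=> pqm sm fg rep.
have [k0 Hk0] := graph_representation_vol fg rep.
pose c e := if e \in sub_edge (Ss k0) then p e - q e else 0.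
have sc : asum c.
  apply: asum_le (asumD sm (Hk0 k0 (leqnn k0))) => e; rewrite /c.
  case: ifP => _; last by rewrite normr0.
  by apply: le_trans (ler_norm _); exact: pqm.
have emp e : exists N, forall k, (N <= k)%N -> ~ sub_edge (Ss k) e.
  apply: (graph_representation_empty e rep).
  by have [[U es gE] _] := fg; exists U.
have := rsum_restr_cvg0 sc emp; apply: cvg_trans; apply: near_eq_cvg.
near=> k; congr rsum; apply/funext => e; rewrite /c.
have k0k : (k0 <= k)%N by near: k; exact: nbhs_infty_ge.
have sub : sub_edge (Ss k) `<=` sub_edge (Ss k0).
  have [_ dS _ _] := rep.
  elim: (k) k0k => [|j IH]; first by rewrite leqn0 => /eqP ->.
  rewrite leq_eqVlt => /predU1P[->//|]; rewrite ltnS => /IH.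
  by apply: subset_trans; exact: sub_edge_mono.
case: ifPn => //; rewrite inE => /sub h; by rewrite mem_set.
Unshelve. all: by end_near. Qed.

Lemma normal_sum_cvg0 p q m gamma (Ss : nat -> subgraph G) :
  (forall e, `|p e - q e| <= m e + len e) -> asum m ->
  (forall W, tame W -> rsum (flux p q \1_W) = 0) ->
  finite_volume_end G gamma -> graph_representation gamma Ss ->
  normal_sum p q (Ss k) @[k --> \oo] --> 0.
Proof.
move=> pqm sm T0 fg rep.
have := sub_rsum_cvg0 pqm sm fg rep => /cvgN; rewrite oppr0.
apply: cvg_trans; apply: near_eq_cvg.
have [k0 Hk0] := graph_representation_vol fg rep.
near=> k.
have k0k : (k0 <= k)%N by near: k; exact: nbhs_infty_ge.
have [_ _ /(_ k) fS _] := rep.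
have := flux_sub_vertex pqm sm (fun v => T0 _ (tame_finite (finite_set1 v))) fS (Hk0 k k0k).
rewrite T0; last exact: tame_sub_vertex fS (Hk0 k k0k).
by move=> /esym/eqP; rewrite addr_eq0 => /eqP ->.
Unshelve. all: by end_near. Qed.

Let lam (e : E) := Num.min (len e) 1.

Lemma rsum_flux_eq0 p q (M N : E -> R) (a : V -> R) :
  finite_set (finite_volume_end G) ->
  (forall e, 0 <= M e) -> (forall e, 0 <= N e) -> asum M -> asum N ->
  (forall e, lam e * q e ^+ 2 <= M e) ->
  (forall e, (p e - q e) ^+ 2 <= lam e * M e) ->
  (forall e, lam e * a (src e) ^+ 2 <= N e) ->
  (forall e, lam e * a (tgt e) ^+ 2 <= N e) ->
  (forall e, (a (tgt e) - a (src e)) ^+ 2 <= lam e * N e) ->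
  (forall v, rsum (flux p q \1_[set v]) = 0) ->
  (forall gamma Ss, finite_volume_end G gamma -> graph_representation gamma Ss ->
    normal_sum p q (Ss k) @[k --> \oo] --> 0) ->
  rsum (flux p q a) = 0.
Proof.
move=> fC M0 N0 sM sN hq hpq has_ hat had k0 lim0.
have lam0 e : 0 < lam e by rewrite /lam lt_min len_gt0 ltr01.
have laml e : lam e <= len e by rewrite /lam ge_min lexx.
have pqm e : `|p e - q e| <= M e + len e.
  apply: le_trans (_ : M e + lam e <= _); last by rewrite lerD2l.
  by apply: normr_le_of_sqrM; rewrite ?(ltW (lam0 e))// mulrC.
have T0 W : tame W -> rsum (flux p q \1_W) = 0.
  apply: (rsum_flux_tame pqm sM k0 fC (EN := @ends_in R G)).
  - by move=> A gamma [].
  - exact: ends_in_ne.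
  - by move=> A B; exact: ends_in_mono.
  - exact: ends_in_disj.
  (* Along the chain the flux is a normal sum plus a sum of [p e - q e] over the remaining edges,
     and both tend to 0. *)
  move=> A Ws tA cWs; have [gamma [fg _ rep]] := chain_end tA cWs.
  have h1 := lim0 _ _ fg rep; have h2 := sub_rsum_cvg0 pqm sM fg rep.
  have : (fun n => normal_sum p q (induced (Ws n)) +
      rsum (fun e => if e \in sub_edge (induced (Ws n)) then p e - q e else 0)) @ \oo --> (0 : R).
    have := cvgD h1 h2; rewrite addr0; apply.
  apply: cvg_trans; apply: near_eq_cvg.
  have [n0 Hn0] := graph_representation_vol fg rep.
  near=> n; have n0n : (n0 <= n)%N by near: n; exact: nbhs_infty_ge.
  have [_ _ /(_ n) fS _] := rep.
  by rewrite -(flux_sub_vertex pqm sM k0 fS (Hn0 n n0n)).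
(* The layer cake treats positive parts, so [a] is written as [pos a - pos (- a)]. Both fluxes are
   summable because the positive part is 1-Lipschitz and vanishes at 0. *)
pose pos (b : V -> R) v := Num.max (b v) 0.
have posP (x : R) : Num.max x 0 ^+ 2 <= x ^+ 2.
  by case: (leP x 0) => // _; rewrite expr0n sqr_ge0.
have posB (x y : R) : (Num.max x 0 - Num.max y 0) ^+ 2 <= (x - y) ^+ 2.
  case: (leP x 0) => hx; case: (leP y 0) => hy //.
  - by rewrite subrr expr0n sqr_ge0.
  - have : 0 <= - x * y by rewrite mulr_ge0 ?oppr_ge0// ltW.
    by have := sqr_ge0 x; lra.
  - have : 0 <= x * - y by rewrite mulr_ge0 ?oppr_ge0// ltW.
    by have := sqr_ge0 y; lra.
have sflux (b : V -> R) : (forall e, b (tgt e) ^+ 2 <= a (tgt e) ^+ 2) ->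
   (forall e, (b (tgt e) - b (src e)) ^+ 2 <= (a (tgt e) - a (src e)) ^+ 2) ->
   asum (flux p q b).
  move=> h1 h2; apply: asum_le (asumD (asumD sM sN) (asumD sM sN)) => e.
  apply: le_trans (ler_norm _).
  have -> : flux p q b e = (p e - q e) * b (tgt e) + q e * (b (tgt e) - b (src e)).
    by rewrite /flux; ring.
  apply: le_trans (ler_normD _ _) _; apply: lerD; apply: normr_le_of_sqrM => //; rewrite exprMn.
    apply: (@le_trans _ _ (lam e * M e * a (tgt e) ^+ 2)).
      by apply: ler_pM; rewrite ?sqr_ge0.
    by rewrite mulrAC mulrC ler_wpM2l.
  apply: (@le_trans _ _ (q e ^+ 2 * (lam e * N e))).
    by apply: ler_pM; rewrite ?sqr_ge0// (le_trans (h2 e)).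
  by rewrite mulrA ler_wpM2r// mulrC.
have -> : flux p q a = fun e => flux p q (pos a) e - flux p q (pos (fun v => - a v)) e.
  apply/funext => e.
  have aE v : a v = pos a v - pos (fun v => - a v) v.
    by rewrite /pos; case: (leP (a v) 0) => h; case: (leP (- a v) 0) => h'; lra.
  by rewrite /flux {1}(aE (tgt e)) {1}(aE (src e)); ring.
rewrite rsumB; last 2 first.
- by apply: sflux => e; rewrite /pos.
- apply: sflux => e; rewrite /pos; first by rewrite (le_trans (posP _))// sqrrN.
  by rewrite (le_trans (posB _ _))// -sqrrN opprB opprK addrC.
rewrite /pos (rsum_flux_pos M0 N0 sM sN hq hpq has_ hat had T0).
rewrite (rsum_flux_pos M0 N0 sM sN hq hpq (a := fun v => - a v)) ?subrr//.
- by move=> e; rewrite sqrrN; exact: has_.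
- by move=> e; rewrite sqrrN; exact: hat.
- by move=> e; rewrite -sqrrN opprB opprK addrC; exact: had.
Unshelve. all: by end_near. Qed.

End Core.

(** * Primitives and integrals up to null sets *)

Section AlmostEverywhere.
Context {R : realType}.
Local Notation mu := (@lebesgue_measure R).
Implicit Types (l x : R) (f g : R -> R).

Lemma ae_imply (P Q : R -> Prop) : (forall x, P x -> Q x) ->
  {ae mu, forall x, P x} -> {ae mu, forall x, Q x}.
Proof. by move=> PQ H; apply: (@filterS _ _ (ae_filter_ringOfSetsType mu)) H. Qed.

Lemma ae_imply2 (P P' Q : R -> Prop) : (forall x, P x -> P' x -> Q x) ->
  {ae mu, forall x, P x} -> {ae mu, forall x, P' x} -> {ae mu, forall x, Q x}.
Proof. by move=> PQ; apply: filterS2; first exact: (ae_filter_ringOfSetsType mu). Qed.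

Lemma Rintegral_ae l f g : measurable_fun `[0, l] f -> measurable_fun `[0, l] g ->
  f = g %[ae mu in `[0, l]%classic] ->
  \int[mu]_(x in `[0, l]) f x = \int[mu]_(x in `[0, l]) g x.
Proof.
move=> mf mg fg; congr fine; apply: ae_eq_integral => //.
- exact/measurable_EFinP.
- exact/measurable_EFinP.
- by apply: ae_imply fg => x H /H /= ->.
Qed.

Lemma ae_sub l l' f g : l' <= l -> f = g %[ae mu in `[0, l]%classic] ->
  f = g %[ae mu in `[0, l']%classic].
Proof.
move=> ll; apply: ae_eq_subset; apply: subset_itvl; by rewrite bnd_simp.
Qed.

Lemma prim_ae l f g g' : prim l f g -> rsqint l g' ->
  g = g' %[ae mu in `[0, l]%classic] -> prim l f g'.
Proof.
move=> [gi fE] gi' gg'; split => // x xl; rewrite fE//; congr (_ + _).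
case/andP: xl => _ xl; apply: Rintegral_ae.
- exact: (rsqint_sub xl gi).1.
- exact: (rsqint_sub xl gi').1.
- exact: ae_sub gg'.
Qed.

Lemma norm2_ae l f g : rsqint l f -> rsqint l g ->
  f = g %[ae mu in `[0, l]%classic] -> norm2 l f = norm2 l g.
Proof.
move=> fi gi fg; apply: Rintegral_ae.
- exact: measurable_funX fi.1.
- exact: measurable_funX gi.1.
- by apply: ae_imply fg => x H /H ->.
Qed.

Lemma RintegralM_ae l f f' g g' : rsqint l f -> rsqint l f' -> rsqint l g -> rsqint l g' ->
  f = f' %[ae mu in `[0, l]%classic] -> g = g' %[ae mu in `[0, l]%classic] ->
  \int[mu]_(x in `[0, l]) (f x * g x) = \int[mu]_(x in `[0, l]) (f' x * g' x).
Proof.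
move=> fi fi' gi gi' ff gg; apply: Rintegral_ae.
- by apply: measurable_funM; [exact: fi.1|exact: gi.1].
- by apply: measurable_funM; [exact: fi'.1|exact: gi'.1].
- by apply: ae_imply2 ff gg => x H1 H2 xl; rewrite H1// H2.
Qed.

Lemma prim_sub l f f' g g' : 0 <= l -> prim l f f' -> prim l g g' ->
  prim l (fun x => f x - g x) (fun x => f' x - g' x).
Proof.
move=> l0 [fi fE] [gi gE]; split.
  by have := rsqintD fi (rsqintN gi).
move=> x xl; rewrite (fE x)// (gE x)//; case/andP: xl => _ xl.
rewrite RintegralB//; first by ring.
- exact: rsqint_integrable (rsqint_sub xl fi).
- exact: rsqint_integrable (rsqint_sub xl gi).
Qed.

Lemma prim_unique l f g g' : 0 < l -> prim l f g -> prim l f g' ->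
  g = g' %[ae mu in `[0, l]%classic].
Proof.
move=> l0 pg pg'; have := prim0_ae l0 (prim_sub (ltW l0) pg pg').
move=> /(_ _)/wrap[]; first by move=> x _; rewrite !subrr.
by apply: ae_imply => x H /H /eqP; rewrite subr_eq0 => /eqP.
Qed.

Lemma prim_eq l f g h : (forall x, 0 <= x <= l -> f x = g x) -> 0 <= l -> prim l f h -> prim l g h.
Proof. by move=> fg l0 [hi fE]; split => // x xl; rewrite -fg// -fg ?lexx//; exact: fE. Qed.

Lemma within_ae_eq l f g : 0 < l -> {within `[0, l], continuous f} ->
  {within `[0, l], continuous g} -> f = g %[ae mu in `[0, l]%classic] ->
  forall x, 0 <= x <= l -> f x = g x.
Proof.
move=> l0 cf cg fg x0 x0l; apply/eqP; apply: contrapT => /negP fgx.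
have d0 : 0 < `|f x0 - g x0| by rewrite normr_gt0 subr_eq0.
have x0l' : `[0, l]%classic x0 by rewrite /= in_itv.
have cf0 : f y @[y --> within `[0, l] (nbhs x0)] --> f x0.
  by move/subspace_continuousP : cf => /(_ _ x0l').
have cg0 : g y @[y --> within `[0, l] (nbhs x0)] --> g x0.
  by move/subspace_continuousP : cg => /(_ _ x0l').
have cfg : (f y - g y) @[y --> within `[0, l] (nbhs x0)] --> f x0 - g x0.
  exact: cvgB cf0 cg0.
have [e /= e0 H] := (cvgrPdist_lt (fun y => f y - g y) (f x0 - g x0)).1 cfg _ d0.
(* The neighbourhood of [x0] is clipped to [[0, l]]. It keeps positive length even if [x0] is an
   endpoint, which contradicts equality almost everywhere. *)
pose c := Num.max 0 (x0 - e); pose d := Num.min l (x0 + e).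
have cd : c < d.
  by case/andP: x0l => x00 x0l; rewrite /c /d gt_max !lt_min l0 /=; apply/andP; split; lra.
have sub : `]c, d[ `<=` [set x | ~ (`[0, l]%classic x -> f x = g x)].
  move=> y; rewrite /= in_itv/= gt_max lt_min => /andP[/andP[y0 ye] /andP[yl yE]].
  have yl' : y \in `[0, l] by rewrite in_itv/= !ltW.
  move=> /(_ yl') fgy; have := H y; rewrite /= => /(_ _ yl')/wrap[].
    by rewrite ltr_norml; apply/andP; split; lra.
  by rewrite fgy subrr subr0 ltxx.
have [N [mN N0 subN]] := fg.
have : (mu `]c, d[ <= mu N)%E.
  by apply: le_measure; rewrite ?inE//; apply: subset_trans subN.
rewrite N0 lebesgue_measure_itv/= lte_fin cd -EFinB lee_fin.
by rewrite subr_le0 leNgt cd.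
Qed.

End AlmostEverywhere.

(** * Real and imaginary parts *)

Section Parts.
Context {R : realType}.
Local Notation mu := (@lebesgue_measure R).
Local Notation C := (R[i]).

(** The estimates are all real; a complex statement becomes one statement for both values of [b]. *)
Definition part (b : bool) (z : C) : R := if b then complex.Im z else complex.Re z.

Lemma part_eq (z w : C) : (forall b, part b z = part b w) -> z = w.
Proof. by case: z => a b; case: w => c d H; rewrite [a](H false) [b](H true). Qed.

Lemma partD b (z w : C) : part b (z + w) = part b z + part b w.
Proof. by case: z => ? ?; case: w => ? ?; case: b. Qed.

Lemma part0 b : part b 0 = 0. Proof. by case: b. Qed.

Lemma partN b (z : C) : part b (- z) = - part b z.
Proof. by case: z => ? ?; case: b. Qed.

Lemma partB b (z w : C) : part b (z - w) = part b z - part b w.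
Proof. by rewrite partD partN. Qed.

Lemma partMr b (z : C) (x : R) : part b (z * x%:C%C) = part b z * x.
Proof. by case: z => ? ?; case: b => /=; rewrite mulr0 ?subr0 ?add0r. Qed.

Lemma part_divr b (z : C) (x : R) : part b (z / x%:C%C) = part b z / x.
Proof. by rewrite -fmorphV/= partMr. Qed.

Lemma part_sum b (I : Type) (s : seq I) (F : I -> C) :
  part b (\sum_(i <- s) F i) = \sum_(i <- s) part b (F i).
Proof. exact: (big_morph (part b) (partD b) (part0 b)). Qed.

Lemma part_fsbig b (I : choiceType) (D : set I) (F : I -> C) : finite_set D ->
  part b (\sum_(i \in D) F i) = \sum_(i \in D) part b (F i).
Proof. by move=> fD; rewrite !fsbig_finite//= part_sum. Qed.

Lemma normc_part_le b (z : C) : (`|part b z|%:C%C <= `|z|).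
Proof.
rewrite normc_def lecR; apply: le_trans (_ : Num.sqrt (part b z ^+ 2) <= _).
  by rewrite sqrtr_sqr.
rewrite ler_wsqrtr//; case: z => x y; case: b => /=.
  by rewrite lerDr sqr_ge0.
by rewrite lerDl sqr_ge0.
Qed.

Lemma normc_le_parts (z : C) : `|z| <= (`|part false z| + `|part true z|)%:C%C.
Proof.
case: z => x y; rewrite normc_def lecR /=.
rewrite -[leRHS]ger0_norm ?addr_ge0// -sqrtr_sqr ler_wsqrtr// sqrrD !real_normK ?num_real//.
by rewrite lerD2r lerDl mulrn_wge0// mulr_ge0.
Qed.

Lemma cvg_part (T : Type) (F : set_system T) (FF : Filter F) (f : T -> C) (c : C) :
  (f x : C^o) @[x --> F] --> (c : C^o) <-> forall b, part b (f x) @[x --> F] --> part b c.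
Proof.
split => [/cvgrPdist_lt H b|H].
  apply/cvgrPdist_lt => e e0; have e0' : 0 < (e%:C%C : C) by rewrite ltcR.
  have := H _ e0'; apply: filterS => x /= hx.
  by rewrite -partB -ltcR; apply: le_lt_trans hx; exact: normc_part_le.
apply/cvgrPdist_lt => e e0.
(* A positive element of [C] is real. *)
have eE : e = (complex.Re e)%:C%C by rewrite RRe_real// realE ltW.
have e0' : 0 < complex.Re e / 2 by rewrite divr_gt0//; move: e0; rewrite eE ltcR.
have /cvgrPdist_lt /(_ _ e0') h0 := H false.
have /cvgrPdist_lt /(_ _ e0') h1 := H true.
apply: filterS2 h0 h1 => x; rewrite -!partB => h0 h1.
by apply: le_lt_trans (normc_le_parts _) _; rewrite eE ltcR; lra.
Qed.

Lemma continuous_part (T : topologicalType) (F : T -> C) :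
  continuous (F : T -> C^o) <-> forall b, continuous (part b \o F).
Proof.
split => [cF b x|H x].
  by have := (@cvg_part _ _ (nbhs_filter x) F (F x)).1 (cF x); apply.
apply/(@cvg_part _ _ (nbhs_filter x) F (F x)) => b; exact: H.
Qed.

Lemma normsqE (z : C) : normsq z = part false z ^+ 2 + part true z ^+ 2.
Proof. by []. Qed.

Lemma part_cintegral b (x y : R) (f : R -> C) :
  part b (cintegral x y f) = \int[mu]_(t in `[x, y]) part b (f t).
Proof. by case: b. Qed.

Lemma measurable_part l (f : R -> C) : cmeasurable l f <->
  forall b, measurable_fun `[0, l] (part b \o f).
Proof. by split => [[h0 h1] []//|H]; split; [exact: (H false)|exact: (H true)]. Qed.

Lemma sqint_part l (f : R -> C) : sqint l f <-> forall b, rsqint l (part b \o f).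
Proof.
split => [[/measurable_part mf fy] b|H].
  split; first exact: mf.
  apply: le_lt_trans fy; apply: ge0_le_integral => //.
  - by move=> x _; rewrite lee_fin sqr_ge0.
  - by apply/measurable_EFinP; apply: measurable_funX; exact: mf.
  - apply/measurable_EFinP; rewrite (_ : (fun x => _) =
      (fun x => (part false \o f) x ^+ 2 + (part true \o f) x ^+ 2))//.
    by apply: measurable_funD; apply: measurable_funX; exact: mf.
  - move=> x _; rewrite lee_fin normsqE /=; case: b; first by rewrite lerDr sqr_ge0.
    by rewrite lerDl sqr_ge0.
split; first by apply/measurable_part => b; exact: (H b).1.
have := integrableD _ (rsqint_integrable_sq (H false)) (rsqint_integrable_sq (H true)).
move=> /(_ _)/wrap[]; first exact: measurable_itv.
move=> /integrableP[_]; apply: le_lt_trans; rewrite le_eqVlt; apply/orP; left; apply/eqP.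
by apply: eq_integral => x _; rewrite /= ger0_norm// addr_ge0// sqr_ge0.
Qed.

Lemma sobolev_part l (F g : R -> C) :
  sobolev_deriv l F g <-> forall b, prim l (part b \o F) (part b \o g).
Proof.
split => [[gi FE] b|H].
  split; first exact: ((sqint_part l g).1 gi b).
  by move=> x xl; rewrite /= FE// partD part_cintegral.
split; first by apply/sqint_part => b; exact: (H b).1.
move=> x xl; apply: part_eq => b; rewrite partD part_cintegral.
exact: (H b).2.
Qed.

End Parts.

(** * The Neumann extension *)

Section L2Facts.
Context {R : realType} (G : metricGraph R).
Local Notation V := (vertex G).
Local Notation E := (edge G).
Local Notation mu := (@lebesgue_measure R).
Local Notation C := (R[i]).
Implicit Types (f g h : L2 G) (F : mgraph G -> C) (e : E) (v : V) (b : bool).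

Definition fpart b f e : R -> R := fun x => part b (f e x).

Lemma len_ge0 e : 0 <= len e. Proof. exact/ltW/len_gt0. Qed.

Lemma l2fun_edge_lty (f : l2fun G) e : (\int[mu]_(x in `[0%R, len e]) (normsq (f e x))%:E < +oo)%E.
Proof.
apply: le_lt_trans (l2_finite f); rewrite (esumID [set e]) ?setTI; last first.
  by move=> i _; apply: integral_ge0 => x _; rewrite lee_fin normsqE addr_ge0// sqr_ge0.
rewrite esum_set1; last by apply: integral_ge0 => x _; rewrite lee_fin normsqE addr_ge0// sqr_ge0.
by rewrite leeDl// esum_ge0// => i _; apply: integral_ge0 => x _;
  rewrite lee_fin normsqE addr_ge0// sqr_ge0.
Qed.

Lemma rsqint_fpart b f e : rsqint (len e) (fpart b f e).
Proof.
apply: (sqint_part (len e) (f e)).1; split; first exact: l2_measurable.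
exact: l2fun_edge_lty.
Qed.

Lemma norm2E l (f : R -> R) : rsqint l f ->
  ((norm2 l f)%:E = \int[mu]_(x in `[0%R, l]) (f x ^+ 2)%:E)%E.
Proof.
by move=> fi; rewrite /norm2 /Rintegral fineK//; exact: (integrable_fin_num _ (rsqint_integrable_sq fi)).
Qed.

Lemma asum_norm2 b f : asum (fun e => norm2 (len e) (fpart b f e)).
Proof.
apply: le_lt_trans (l2_finite (repr f)); apply: le_esum => e _.
have fi c : rsqint (len e) (fpart c f e) by exact: rsqint_fpart.
rewrite ger0_norm ?norm2_ge0// norm2E//; apply: ge0_le_integral => //.
- by move=> x _; rewrite lee_fin sqr_ge0.
- by apply/measurable_EFinP; apply: measurable_funX; exact: (fi b).1.
- apply/measurable_EFinP; rewrite (_ : (fun x => _) =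
    (fun x => (fpart false f e) x ^+ 2 + (fpart true f e) x ^+ 2))//.
  by apply: measurable_funD; apply: measurable_funX; exact: (fi _).1.
- move=> x _; rewrite lee_fin normsqE /fpart; case: b; first by rewrite lerDr sqr_ge0.
  by rewrite lerDl sqr_ge0.
Qed.

Lemma normr_RintegralM_le l (f g : R -> R) : rsqint l f -> rsqint l g ->
  `|\int[mu]_(x in `[0, l]) (f x * g x)| <= norm2 l f + norm2 l g.
Proof.
move=> fi gi; have fgi := rsqint_integrableM fi gi.
apply: le_trans (le_normr_Rintegral _ fgi) _ => //.
have i1 := rsqint_integrable_sq fi; have i2 := rsqint_integrable_sq gi.
rewrite /norm2 -RintegralD//; apply: le_Rintegral => //.
- exact: integrable_norm.
- by have := integrableD _ i1 i2; apply.
move=> x _; rewrite normrM -(real_normK (num_real (f x))) -(real_normK (num_real (g x))).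
by have := sqr_ge0 (`|f x| - `|g x|); have := sqr_ge0 (`|f x|); have := sqr_ge0 (`|g x|); nra.
Qed.

Definition pairing b b' f g e : R :=
  \int[mu]_(x in `[0, len e]) (fpart b f e x * fpart b' g e x).

Lemma asum_pairing b b' f g : asum (pairing b b' f g).
Proof.
apply: asum_le (asumD (asum_norm2 b f) (asum_norm2 b' g)) => e.
apply: le_trans (ler_norm _).
by apply: normr_RintegralM_le; exact: rsqint_fpart.
Qed.

Lemma dotpE f g : dotp f g =
  Complex (rsum (pairing false false f g) + rsum (pairing true true f g))
          (rsum (pairing true false f g) - rsum (pairing false true f g)).
Proof.
have ip b b' e : mu.-integrable `[0, len e] (EFin \o (fun x => fpart b f e x * fpart b' g e x)).
  by apply: rsqint_integrableM; exact: rsqint_fpart.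
rewrite -rsumD; [|exact: asum_pairing|exact: asum_pairing].
rewrite -rsumB; [|exact: asum_pairing|exact: asum_pairing].
rewrite /dotp /= -/(rsum _) -/(rsum _); congr Complex.
  congr rsum; apply/funext => e; rewrite /pairing -RintegralD//.
  apply: eq_Rintegral => x _; rewrite /fpart.
  by case: (f e x) => x1 x2; case: (g e x) => y1 y2 /=; ring.
congr rsum; apply/funext => e; rewrite /pairing -RintegralB//.
apply: eq_Rintegral => x _; rewrite /fpart.
by case: (f e x) => x1 x2; case: (g e x) => y1 y2 /=; ring.
Qed.

Lemma H1_derivP f : H1 G f -> H1_deriv f (Defs.deriv f).
Proof. exact: xgetPex. Qed.

Lemma continuous_rep_within F b e : continuous (F : mgraph G -> C^o) ->
  {within `[0, len e], continuous (fun x => part b (F (edge_pt e x)))}.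
Proof.
move=> /continuous_part /(_ b) cF.
apply: (@within_continuous_comp _ _ _ `[0, len e] (@edge_pt R G e) (part b \o F)).
  by move=> z _; exact: cF.
exact: edge_pt_continuous.
Qed.

Lemma continuous_rep_ae f F b e : continuous_rep f F ->
  fpart b f e = (fun x => part b (F (edge_pt e x))) %[ae mu in `[0, len e]%classic].
Proof. by move=> [_ /(_ e)]; apply: ae_imply => x H /H; rewrite /fpart => ->. Qed.

(** Identifies the representatives quantified separately in [H1_deriv], [kirchhoff_laplacian] and
    [is_normal_deriv]. *)
Lemma continuous_rep_unique f F F' : continuous_rep f F -> continuous_rep f F' -> F = F'.
Proof.
move=> rF rF'; apply/funext => z; have [e [x [xl ->]]] := edge_pt_surj z.
apply: part_eq => b.
apply: (@within_ae_eq _ (len e) (fun x => part b (F (edge_pt e x)))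
  (fun x => part b (F' (edge_pt e x))) (len_gt0 e)) => //.
- exact: continuous_rep_within rF.1.
- exact: continuous_rep_within rF'.1.
by apply: ae_imply2 (continuous_rep_ae b e rF) (continuous_rep_ae b e rF') => y h1 h2 yl; rewrite -h1// h2.
Qed.

Lemma L2_of_rsqint (u : E -> R -> R) : (forall e, rsqint (len e) (u e)) ->
  asum (fun e => norm2 (len e) (u e)) ->
  exists g : L2 G, forall e, g e = (fun x => (u e x)%:C%C) %[ae mu in `[0, len e]%classic].
Proof.
move=> ui su.
pose c e x : C := (u e x)%:C%C.
have mc e : cmeasurable (len e) (c e).
  by apply/measurable_part => -[]; [exact: measurable_cst|exact: (ui e).1].
have fc : (\esum_(e in [set: E])
    \int[mu]_(x in `[0%R, len e]) (normsq (c e x))%:E < +oo)%E.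
  apply: le_lt_trans su; apply: le_esum => e _; rewrite ger0_norm ?norm2_ge0// norm2E//.
  rewrite le_eqVlt; apply/orP; left; apply/eqP; apply: eq_integral => x _.
  by rewrite /normsq /= expr0n addr0.
exists (\pi_(L2 G) (L2Fun mc fc)) => e.
have : l2_ae_eq (repr (\pi_(L2 G) (L2Fun mc fc))) (L2Fun mc fc).
  by apply/(@eqmodP _ (@l2_ae_eq_equiv R G)); rewrite reprK.
by move=> /asboolP /(_ e).
Qed.

(** The source of test functions. The conclusions hold almost everywhere only, because elements of
    [L2 G] are read through chosen representatives. *)
Lemma H1_of_edges (u u' : E -> R -> R) (a : V -> R) :
  (forall e, prim (len e) (u e) (u' e)) ->
  (forall e, u e 0 = a (src e)) -> (forall e, u e (len e) = a (tgt e)) ->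
  asum (fun e => norm2 (len e) (u e)) -> asum (fun e => norm2 (len e) (u' e)) ->
  exists g : L2 G, H1 G g /\ forall e,
    [/\ fpart false g e = u e %[ae mu in `[0, len e]%classic],
        fpart true g e = cst 0 %[ae mu in `[0, len e]%classic],
        fpart false (Defs.deriv g) e = u' e %[ae mu in `[0, len e]%classic]
      & fpart true (Defs.deriv g) e = cst 0 %[ae mu in `[0, len e]%classic]].
Proof.
move=> pu u0 ul su su'.
have ui e : rsqint (len e) (u e) by exact: prim_rsqint (len_ge0 e) (pu e).
have u'i e : rsqint (len e) (u' e) by have [] := pu e.
have [g Hg] := L2_of_rsqint ui su; have [g1 Hg1] := L2_of_rsqint u'i su'.
have [F HF] := @mgraph_lift R G C (fun e x => (u e x)%:C%C) (fun v => (a v)%:C%C)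
  (fun e => congr1 _ (u0 e)) (fun e => congr1 _ (ul e)).
pose up b e x : R := if b then 0 else u e x.
pose up' b e x : R := if b then 0 else u' e x.
have Fup b e x : 0 <= x <= len e -> part b (F (edge_pt e x)) = up b e x.
  by move=> xl; rewrite HF// /up; case: b.
have pup b e : prim (len e) (up b e) (up' b e).
  case: b; last exact: pu.
  split; first exact: (rsqint_cst _ 0).
  by move=> x _; rewrite /up /up' Rintegral_cst// mul0r addr0.
have cF : continuous (F : mgraph G -> C^o).
  apply/continuous_part => b; apply: mgraph_continuous => e.
  apply: (@subspace_eq_continuous _ _ _ (up b e)); last exact: prim_continuous (len_ge0 e) (pup b e).
  by move=> x; rewrite inE/= in_itv/= => xl; symmetry; exact: Fup.
have rF : continuous_rep g F.
  split => // e; apply: ae_imply (Hg e) => x H xl; rewrite H//= HF//; exact: xl.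
have prF b e : prim (len e) (fun x => part b (F (edge_pt e x))) (up' b e).
  by apply: prim_eq (pup b e); [move=> x xl; rewrite Fup|exact: len_ge0].
have d1 : H1_deriv g g1.
  exists F => // e; apply/sobolev_part => b.
  apply: prim_ae (prF b e) _ _; first exact: rsqint_fpart.
  by apply: ae_imply (Hg1 e) => x H xl; rewrite /= H// /up'; case: b.
have gH1 : H1 G g by exists g1.
have [F' rF' dF'] := H1_derivP gH1.
have F'E := continuous_rep_unique rF' rF; rewrite F'E in dF'.
have gd b e : fpart b (Defs.deriv g) e = up' b e %[ae mu in `[0, len e]%classic].
  by apply: prim_unique (len_gt0 e) _ (prF b e); exact: ((sobolev_part _ _ _).1 (dF' e) b).
exists g; split => // e; split.
- by apply: ae_imply (Hg e) => x H xl; rewrite /fpart H.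
- by apply: ae_imply (Hg e) => x H xl; rewrite /fpart H.
- exact: (gd false).
- exact: (gd true).
Qed.

(** Against a real test function the complex form identity splits into one identity for each part of
    [f] and [h]. *)
Lemma neumann_test f h (u u' : E -> R -> R) (a : V -> R) b :
  neumann_extension G (f, h) ->
  (forall e, prim (len e) (u e) (u' e)) ->
  (forall e, u e 0 = a (src e)) -> (forall e, u e (len e) = a (tgt e)) ->
  asum (fun e => norm2 (len e) (u e)) -> asum (fun e => norm2 (len e) (u' e)) ->
  [/\ asum (fun e => \int[mu]_(x in `[0, len e]) (fpart b (Defs.deriv f) e x * u' e x)),
      asum (fun e => \int[mu]_(x in `[0, len e]) (fpart b h e x * u e x)) &
  rsum (fun e => \int[mu]_(x in `[0, len e]) (fpart b (Defs.deriv f) e x * u' e x)) =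
  rsum (fun e => \int[mu]_(x in `[0, len e]) (fpart b h e x * u e x))].
Proof.
move=> [_ N] pu u0 ul su su'.
have [g [gH1 Hg]] := H1_of_edges pu u0 ul su su'.
have ui e : rsqint (len e) (u e) by exact: prim_rsqint (len_ge0 e) (pu e).
have u'i e : rsqint (len e) (u' e) by have [] := pu e.
have E1 k : pairing k false (Defs.deriv f) (Defs.deriv g) =
    fun e => \int[mu]_(x in `[0, len e]) (fpart k (Defs.deriv f) e x * u' e x).
  apply/funext => e; have [_ _ h3 _] := Hg e.
  by apply: RintegralM_ae h3 => //; do ?exact: rsqint_fpart; exact: ae_eq_refl.
have E2 k : pairing k false h g = fun e => \int[mu]_(x in `[0, len e]) (fpart k h e x * u e x).
  apply/funext => e; have [h1 _ _ _] := Hg e.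
  by apply: RintegralM_ae h1 => //; do ?exact: rsqint_fpart; exact: ae_eq_refl.
have Z (f1 f2 : L2 G) k : (forall e, fpart true f2 e = cst 0 %[ae mu in `[0, len e]%classic]) ->
    rsum (pairing k true f1 f2) = 0.
  move=> H; rewrite -[RHS](@rsum0 R E); congr rsum; apply/funext => e.
  transitivity (\int[mu]_(x in `[0, len e]) (fpart k f1 e x * cst 0 x)).
    by apply: RintegralM_ae (H e) => //; do ?exact: rsqint_fpart; [exact: (rsqint_cst _ 0)|exact: ae_eq_refl].
  transitivity (\int[mu]_(x in `[0, len e]) (0 : R)); last by rewrite Rintegral_cst// mul0r.
  by apply: eq_Rintegral => x _; rewrite mulr0.
have := N g gH1; rewrite /neumann_form !dotpE /=.
have Tg e : fpart true g e = cst 0 %[ae mu in `[0, len e]%classic] by have [] := Hg e.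
have Td e : fpart true (Defs.deriv g) e = cst 0 %[ae mu in `[0, len e]%classic].
  by have [] := Hg e.
rewrite (Z h g true Tg) (Z h g false Tg) (Z (Defs.deriv f) _ true Td) (Z (Defs.deriv f) _ false Td).
rewrite addr0 addr0 subr0 subr0.
case=> e0 e1; rewrite -E1 -E2; split; [exact: asum_pairing|exact: asum_pairing|by case: b].
Qed.

(* du Bois-Reymond: test against the primitive of [f' + H - c], where [H] is a primitive
   of [h] and [c] makes the mean over [e] vanish. *)
Lemma neumann_edge f h b e : neumann_extension G (f, h) -> exists c,
  fpart b (Defs.deriv f) e = (fun x => c - \int[mu]_(t in `[0, x]) fpart b h e t)
    %[ae mu in `[0, len e]%classic].
Proof.
move=> N; have l0 := len_gt0 e.
have fi := rsqint_fpart b (Defs.deriv f) e; have hi := rsqint_fpart b h e.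
pose H x := \int[mu]_(t in `[0, x]) fpart b h e t.
have H0 : H 0 = 0 by rewrite /H set_itv1 Rintegral_set1.
have pH : prim (len e) H (fpart b h e) by split => // x _; rewrite H0 add0r.
have Hi := prim_rsqint (len_ge0 e) pH.
pose k x := fpart b (Defs.deriv f) e x + H x.
have ki : rsqint (len e) k by exact: rsqintD.
pose c := (\int[mu]_(x in `[0, len e]) k x) / len e.
pose w x := k x - c.
have wi : rsqint (len e) w by exact: rsqintD ki (rsqint_cst _ (- c)).
have w0 : \int[mu]_(x in `[0, len e]) w x = 0.
  rewrite /w RintegralB//; last 2 first.
  - exact: rsqint_integrable.
  - exact: rsqint_integrable (rsqint_cst _ c).
  by rewrite (Rintegral_cst_itv _ (len_ge0 e)) subr0 /c divfK ?subrr// gt_eqF.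
pose u1 x := \int[mu]_(t in `[0, x]) w t.
have u10 : u1 0 = 0 by rewrite /u1 set_itv1 Rintegral_set1.
have pu1 : prim (len e) u1 w by split => // x _; rewrite u10 add0r.
(* Extension by 0 is continuous because [u1] vanishes at both ends of [e]: subtracting the mean [c]
   gives [w] zero integral. *)
pose u e' x := if e' == e then u1 x else 0.
pose u' e' x := if e' == e then w x else 0.
have zero (z : E -> R -> R) : (forall e', e' != e -> z e' = cst 0) ->
    asum (fun e' => norm2 (len e') (z e')).
  move=> z0; apply: (@asum_fset _ _ [set e]) => // e' /eqP ne.
  rewrite z0// /norm2; transitivity (\int[mu]_(x in `[0, len e']) (0 : R)).
    by apply: eq_Rintegral => x _; rewrite expr0n.
  by rewrite Rintegral_cst// mul0r.
have pu e' : prim (len e') (u e') (u' e').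
  rewrite /u /u'; have [->//|ne] := eqVneq e' e.
  split; first exact: (rsqint_cst _ 0).
  by move=> x _; rewrite Rintegral_cst// mul0r addr0.
have uE (e' : E) (x : R) : e' != e -> u e' x = 0 by move=> ne; rewrite /u (negPf ne).
have u'E (e' : E) (x : R) : e' != e -> u' e' x = 0 by move=> ne; rewrite /u' (negPf ne).
have [||||_ _] := @neumann_test f h u u' (fun=> 0) b N pu.
- by move=> e'; rewrite /u; case: eqP.
- by move=> e'; rewrite /u; case: eqP => // ->.
- by apply: zero => e' ne; apply/funext => x; exact: uE.
- by apply: zero => e' ne; apply/funext => x; exact: u'E.
rewrite !(@rsum_fset _ _ [set e])//; last 2 first.
- move=> e' /eqP ne; transitivity (\int[mu]_(x in `[0, len e']) (0 : R)).
    by apply: eq_Rintegral => x _; rewrite uE// mulr0.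
  by rewrite Rintegral_cst// mul0r.
- move=> e' /eqP ne; transitivity (\int[mu]_(x in `[0, len e']) (0 : R)).
    by apply: eq_Rintegral => x _; rewrite u'E// mulr0.
  by rewrite Rintegral_cst// mul0r.
rewrite !fsbig_set1 /u /u' eqxx => E1.
have E2 := prim_ibp (len_ge0 e) pH pu1.
have ul : u1 (len e) = 0 by exact: w0.
rewrite u10 ul !mulr0 subrr in E2.
exists c.
(* Expand one factor of [w ^+ 2]: the terms with [f'] and [H] cancel by the form identity [E1] and
   integration by parts [E2], and the term with [c] has zero integral. *)
have n0 : norm2 (len e) w = 0.
  rewrite /norm2; transitivity (\int[mu]_(x in `[0, len e])
      (fpart b (Defs.deriv f) e x * w x + H x * w x - c * w x)).
    by apply: eq_Rintegral => x _; rewrite /w /k; ring.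
  have i1 := rsqint_integrableM fi wi; have i2 := rsqint_integrableM Hi wi.
  have i3 : mu.-integrable `[0, len e] (EFin \o (fun x => c * w x)).
    by apply: rsqint_integrable; exact: rsqintZ.
  rewrite RintegralB//; last by have := integrableD _ i1 i2; apply.
  rewrite RintegralD// RintegralZl//; last exact: rsqint_integrable.
  by rewrite w0 mulr0 subr0 E1 addrC.
apply: ae_imply (norm2_eq0_ae wi n0) => x hx xl; have := hx xl.
by rewrite /w /k -/(H x) /= => hw; lra.
Qed.

End L2Facts.

(** * Green's formula and the two inclusions *)

Section Main.
Context {R : realType} (G : metricGraph R).
Local Notation V := (vertex G).
Local Notation E := (edge G).
Local Notation mu := (@lebesgue_measure R).
Local Notation C := (R[i]).
Implicit Types (f g h : L2 G) (F : mgraph G -> C) (e : E) (v : V) (b : bool)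
  (P : bool -> E -> R -> R) (S : subgraph G).

Lemma RintegralN_itv l (u : R -> R) : mu.-integrable `[0, l] (EFin \o u) ->
  \int[mu]_(x in `[0, l]) (- u x) = - \int[mu]_(x in `[0, l]) u x.
Proof.
move=> iu; rewrite -mulN1r -RintegralZl//.
by apply: eq_Rintegral => x _; rewrite mulN1r.
Qed.

Lemma prim_trace_asum (u u' : E -> R -> R) : (forall e, prim (len e) (u e) (u' e)) ->
  asum (fun e => norm2 (len e) (u e)) -> asum (fun e => norm2 (len e) (u' e)) ->
  exists N : E -> R, [/\ (forall e, 0 <= N e) /\ asum N,
    forall e, Num.min (len e) 1 * u e 0 ^+ 2 <= N e,
    forall e, Num.min (len e) 1 * u e (len e) ^+ 2 <= N e
  & forall e, (u e (len e) - u e 0) ^+ 2 <= Num.min (len e) 1 * N e].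
Proof.
move=> pu su su'.
pose m e := norm2 (len e) (u e) + norm2 (len e) (u' e).
have m0 e : 0 <= m e by rewrite addr_ge0// norm2_ge0.
have m28 e : 2 * m e <= 8 * m e by rewrite ler_wpM2r// ler_nat.
(* The larger of the constants 2 and 8 serves all three trace estimates. *)
exists (fun e => 8 * m e); split.
- by split; [move=> e; rewrite mulr_ge0|apply: asumZ; exact: asumD].
- by move=> e; apply: le_trans (m28 e); exact: prim_trace0 (len_gt0 e) (pu e).
- by move=> e; apply: le_trans (m28 e); exact: prim_tracel (len_gt0 e) (pu e).
- move=> e; rewrite mulrA (mulrC _ 8); exact: prim_trace_diff (len_gt0 e) (pu e).
Qed.

(* [P false e] and [P true e] are the continuous real and imaginary parts of [f'] on [e]. *)
Definition edge_solution f h F P := [/\ continuous_rep f F,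
  forall b e, prim (len e) (fun x => part b (F (edge_pt e x))) (P b e)
& forall b e, prim (len e) (P b e) (fun x => - fpart b h e x)].

Definition vertex_flux P b (a : V -> R) :=
  flux (fun e => P b e (len e)) (fun e => P b e 0) a.

(** Each [P b e] is continuous, being a primitive, so the limit in [deriv_into] exists and is an
    endpoint value of [P] up to sign. *)
Lemma part_deriv_into f h F P e v b : edge_solution f h F P -> incident v e ->
  part b (deriv_into F e v) = inward_deriv (fun e => P b e (len e)) (fun e => P b e 0) e v.
Proof.
move=> [_ pF pP] ve.
pose c : C := Complex (inward_deriv (fun e => P false e (len e)) (fun e => P false e 0) e v)
  (inward_deriv (fun e => P true e (len e)) (fun e => P true e 0) e v).
suff -> : deriv_into F e v = c by case: b.
have cP k : {within `[0, len e], continuous (P k e)} by exact: prim_continuous (len_ge0 e) (pP k e).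
rewrite /deriv_into; apply: (@cvg_lim C^o (@norm_hausdorff _ _)).
apply/cvg_part => k.
under eq_fun do rewrite part_divr partB.
have -> : part k c = inward_deriv (fun e => P k e (len e)) (fun e => P k e 0) e v by case: (k).
rewrite /inward_deriv; case: ifP => _; first exact: prim_deriv0 (len_gt0 e) (pF k e) (cP k).
by rewrite subr0; exact: prim_derivl (len_gt0 e) (pF k e) (cP k).
Qed.

Lemma part_sum_deriv_into f h F P v b (D : set E) : edge_solution f h F P ->
  finite_set D -> D `<=` incident v ->
  part b (\sum_(e \in D) deriv_into F e v) =
  \sum_(e \in D) inward_deriv (fun e => P b e (len e)) (fun e => P b e 0) e v.
Proof.
move=> K fD Dv; rewrite part_fsbig//; apply: eq_fsbigr => e; rewrite inE => /Dv ve.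
exact: part_deriv_into K ve.
Qed.

Lemma kirchhoffP f h F P v : edge_solution f h F P ->
  kirchhoff F v <-> forall b, rsum (vertex_flux P b \1_[set v]) = 0.
Proof.
move=> K; rewrite /kirchhoff; have fv := incident_finite v.
split=> [k0 b|k0].
  apply/kirchhoff_flux.
  by rewrite -(part_sum_deriv_into _ K fv (@subset_refl _ _)) k0 part0.
apply: part_eq => b; rewrite (part_sum_deriv_into _ K fv (@subset_refl _ _)) part0.
by apply/kirchhoff_flux; exact: k0.
Qed.

Lemma part_normal_sum f h F P S b : edge_solution f h F P -> finite_set (sub_boundary S) ->
  part b (\sum_(v \in sub_boundary S) subgraph_normal_deriv F S v) =
  normal_sum (fun e => P b e (len e)) (fun e => P b e 0) S.
Proof.
move=> K fS; rewrite part_fsbig//; apply: eq_fsbigr => v _.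
apply: part_sum_deriv_into K _ _ => //.
exact/finite_setIl/incident_finite.
Qed.

Lemma kirchhoff_laplacianP f h : kirchhoff_laplacian G (f, h) <->
  exists F P, edge_solution f h F P /\ forall v b, rsum (vertex_flux P b \1_[set v]) = 0.
Proof.
split=> [[F [rF HF kF]]|[F [P [K k0]]]].
  have /choice[F1 HF1] : forall e, exists F1 : R -> C,
      sobolev_deriv (len e) (F \o edge_pt e) F1 /\ sobolev_deriv (len e) F1 (fun x => - h e x).
    by move=> e; have [F1 ? ?] := HF e; exists F1.
  have K : edge_solution f h F (fun b e => part b \o F1 e).
    split => // b e; first exact: (sobolev_part _ _ _).1 (HF1 e).1 b.
    have := (sobolev_part _ _ _).1 (HF1 e).2 b; congr prim.
    by apply/funext => x; rewrite /= partN.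
  by exists F, (fun b e => part b \o F1 e); split => // v; exact/(kirchhoffP v K).
have [rF pF pP] := K.
exists F; split => //; last by move=> v; apply/(kirchhoffP v K); exact: k0.
move=> e; exists (fun x => Complex (P false e x) (P true e x)).
  by apply/sobolev_part => b; have := pF b e; congr prim; apply/funext => x; case: b.
apply/sobolev_part => b; have := pP b e; congr prim; apply/funext => x; first by case: b.
by rewrite /= partN.
Qed.

Lemma H1_prim f F : H1 G f -> continuous_rep f F ->
  forall b e, prim (len e) (fun x => part b (F (edge_pt e x))) (fpart b (Defs.deriv f) e).
Proof.
move=> Hf rF b e; have [F' rF' dF'] := H1_derivP Hf.
by rewrite (continuous_rep_unique rF rF'); exact: (sobolev_part _ _ _).1 (dF' e) b.
Qed.

Lemma edge_solution_deriv f h F P b e : H1 G f -> edge_solution f h F P ->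
  P b e = fpart b (Defs.deriv f) e %[ae mu in `[0, len e]%classic].
Proof.
by move=> Hf [rF pF _]; exact: prim_unique (len_gt0 e) (pF b e) (H1_prim Hf rF b e).
Qed.

Lemma edge_solution_rsqint f h F P b e : edge_solution f h F P -> rsqint (len e) (P b e).
Proof. by move=> [_ pF _]; have [] := pF b e. Qed.

Lemma edge_solution_asum f h F P b : H1 G f -> edge_solution f h F P ->
  asum (fun e => norm2 (len e) (P b e)) /\
  asum (fun e => norm2 (len e) (fun x => - fpart b h e x)).
Proof.
move=> Hf K; split; [have := asum_norm2 b (Defs.deriv f)|have := asum_norm2 b h];
  congr asum; apply/funext => e.
  apply: norm2_ae; [exact: rsqint_fpart|exact: edge_solution_rsqint K|].
  exact: ae_eq_sym (edge_solution_deriv b e Hf K).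
by apply: eq_Rintegral => x _; rewrite sqrrN.
Qed.

Lemma edge_solution_ibp f h F P g F' b b' e : H1 G f -> edge_solution f h F P ->
  H1 G g -> continuous_rep g F' ->
  pairing b b' (Defs.deriv f) (Defs.deriv g) e - pairing b b' h g e =
  P b e (len e) * part b' (F' (edge_pt e (len e))) - P b e 0 * part b' (F' (edge_pt e 0)).
Proof.
move=> Hf K Hg rF'; have [_ _ pP] := K.
have pG := H1_prim Hg rF' b' e.
rewrite -(prim_ibp (len_ge0 e) (pP b e) pG); congr (_ + _).
  apply: RintegralM_ae (ae_eq_sym (edge_solution_deriv b e Hf K)) (ae_eq_refl _ _ _) => //;
    do ?exact: rsqint_fpart.
  exact: edge_solution_rsqint K.
rewrite /pairing -RintegralN_itv; last by apply: rsqint_integrableM; exact: rsqint_fpart.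
transitivity (\int[mu]_(x in `[0, len e]) (- fpart b h e x * fpart b' g e x)).
  by apply: eq_Rintegral => x _; rewrite mulNr.
have hi := rsqintN (rsqint_fpart b h e).
apply: (RintegralM_ae hi hi _ _ (ae_eq_refl _ _ _) (continuous_rep_ae b' e rF')).
- exact: rsqint_fpart.
- exact: prim_rsqint (len_ge0 e) pG.
Qed.

Lemma neumann_edge_solution f h : neumann_extension G (f, h) ->
  exists F P, edge_solution f h F P.
Proof.
move=> N; have Hf : H1 G f by case: N.
have [F rF dF] := H1_derivP Hf.
pose c b e := projT1 (cid (neumann_edge b e N)).
have cE b e := projT2 (cid (neumann_edge b e N)).
(* The continuous version of [f'] found in [neumann_edge]; [F] remains its primitive, since the two
   versions differ on a null set. *)
pose P b e x := c b e - \int[mu]_(t in `[0, x]) fpart b h e t.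
have pP b e : prim (len e) (P b e) (fun x => - fpart b h e x).
  split; first exact: rsqintN (rsqint_fpart b h e).
  move=> x /andP[_ xl]; rewrite RintegralN_itv; last first.
    exact: rsqint_integrable (rsqint_sub xl (rsqint_fpart b h e)).
  by rewrite /P set_itv1 Rintegral_set1 subr0.
exists F, P; split => // b e.
apply: prim_ae ((sobolev_part _ _ _).1 (dF e) b) _ (cE b e).
exact: prim_rsqint (len_ge0 e) (pP b e).
Qed.

(* Test against the piecewise linear interpolation of the indicator of [W]. *)
Lemma neumann_flux_tame f h F P b (W : set V) : neumann_extension G (f, h) ->
  edge_solution f h F P -> tame W -> rsum (vertex_flux P b \1_W) = 0.
Proof.
move=> N K [cW tW]; have Hf : H1 G f by case: N.
have [_ _ pP] := K.
pose a : V -> R := \1_W.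
have a01 v : 0 <= a v <= 1 by rewrite /a indicE; case: (v \in W) => /=; rewrite ?ler01 lexx.
pose d e := (a (tgt e) - a (src e)) / len e.
pose u e x := a (src e) + d e * x.
pose u' e := cst (d e) : R -> R.
have pu e : prim (len e) (u e) (u' e).
  split; first exact: rsqint_cst.
  move=> x /andP[x0 _]; rewrite /u mulr0 addr0; congr (_ + _).
  by rewrite /u' (Rintegral_cst_itv _ x0) subr0.
have u0 e : u e 0 = a (src e) by rewrite /u mulr0 addr0.
have ul e : u e (len e) = a (tgt e).
  by rewrite /u /d divfK ?gt_eqF ?len_gt0// addrC subrK.
(* The interpolation has values between 0 and 1 and vanishes on edges not touching [W], so finite
   volume bounds its norm. *)
have su : asum (fun e => norm2 (len e) (u e)).
  apply: asum_le tW => e; rewrite ger0_norm ?norm2_ge0//.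
  have l0 := len_gt0 e; case: ifPn => [_|]; last first.
    rewrite notin_setE => te; rewrite normr0.
    have z v : ~ W v -> a v = 0 by move=> Wv; rewrite /a indicE memNset.
    have uz x : u e x = 0.
      by rewrite /u /d !z ?subrr ?mul0r ?addr0// => ?; apply: te; [right|left].
    rewrite /norm2; under eq_Rintegral do rewrite uz expr0n /=.
    by rewrite Rintegral_cst_itv ?mul0r// ltW.
  rewrite (ger0_norm (ltW l0)).
  rewrite [leRHS](_ : _ = \int[mu]_(x in `[0, len e]) (1 : R)); last first.
    by rewrite Rintegral_cst_itv ?mul1r ?subr0// ltW.
  apply: le_Rintegral => //.
  - exact: (rsqint_integrable_sq (prim_rsqint (ltW l0) (pu e))).
  - exact: (rsqint_integrable (rsqint_cst _ 1)).
  move=> x; rewrite /= in_itv/= => /andP[x0 xl].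
  have uE : u e x = a (src e) * (1 - x / len e) + a (tgt e) * (x / len e).
    by rewrite /u /d; field; rewrite gt_eqF.
  have t0 : 0 <= x / len e by rewrite divr_ge0// ltW.
  have t1 : x / len e <= 1 by rewrite ler_pdivrMr// mul1r.
  have /andP[s0 s1] := a01 (src e); have /andP[r0 r1] := a01 (tgt e).
  have ux0 : 0 <= u e x by rewrite uE; nra.
  have ux1 : u e x <= 1 by rewrite uE; nra.
  by rewrite expr_le1.
(* The slope may be large on short edges, but it is non-zero on the finitely many cut edges only. *)
have su' : asum (fun e => norm2 (len e) (u' e)).
  apply: asum_fset cW _ => e ce.
  have d0 : d e = 0.
    rewrite /d /a !indicE; have -> : (tgt e \in W) = (src e \in W).
      have WE : W (src e) <-> W (tgt e) by exact: contrapT.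
      by apply/idP/idP; rewrite !inE => /WE.
    by rewrite subrr mul0r.
  rewrite /norm2 /u' d0; under eq_Rintegral do rewrite expr0n /=.
  by rewrite Rintegral_cst_itv ?mul0r// len_ge0.
have [s1 s2 E1] := neumann_test b N pu u0 ul su su'.
rewrite -[RHS](subrr (rsum (fun e => \int[mu]_(x in `[0, len e]) (fpart b h e x * u e x)))).
rewrite -{1}E1 -rsumB//; congr rsum; apply/funext => e.
rewrite /vertex_flux /flux -/a -u0 -ul -(prim_ibp (len_ge0 e) (pP b e) (pu e)); congr (_ + _).
  apply: RintegralM_ae (edge_solution_deriv b e Hf K) (ae_eq_refl _ _ _).
  - exact: edge_solution_rsqint K.
  - exact: rsqint_fpart.
  - exact: rsqint_cst.
  - exact: rsqint_cst.
rewrite -RintegralN_itv; last first.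
  by apply: rsqint_integrableM (rsqint_fpart b h e) _; exact: prim_rsqint (len_ge0 e) (pu e).
by apply: eq_Rintegral => x _; rewrite mulNr.
Qed.

Lemma neumann_kirchhoff f h : neumann_extension G (f, h) -> kirchhoff_laplacian G (f, h).
Proof.
move=> N; have [F [P K]] := neumann_edge_solution N.
apply/kirchhoff_laplacianP; exists F, P; split => // v b.
exact: neumann_flux_tame N K (tame_finite (finite_set1 v)).
Qed.

Lemma neumann_normal_deriv f h gamma : neumann_extension G (f, h) ->
  finite_volume_end G gamma -> is_normal_deriv f gamma 0.
Proof.
move=> N fg; have Hf : H1 G f by case: N.
have [F [P K]] := neumann_edge_solution N; have [rF _ pP] := K.
exists F => // Ss rep; apply/cvg_part => b; rewrite part0.
have [sP sh] := edge_solution_asum b Hf K.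
have [M [[M0 sM] _ _ hM]] := prim_trace_asum (pP b) sP sh.
have [_ _ fS _] := rep.
under eq_fun do rewrite (part_normal_sum _ K)//.
apply: normal_sum_cvg0 sM _ fg rep; last by move=> W; exact: neumann_flux_tame N K.
move=> e; apply: le_trans (_ : M e + Num.min (len e) 1 <= _).
  apply: normr_le_of_sqrM => //; first by rewrite le_min len_ge0 ler01.
  by rewrite mulrC.
by rewrite lerD2l ge_min lexx.
Qed.

Lemma kirchhoff_neumann f h : finite_set (finite_volume_end G) ->
  kirchhoff_laplacian G (f, h) -> H1 G f ->
  (forall gamma, finite_volume_end G gamma -> is_normal_deriv f gamma 0) ->
  neumann_extension G (f, h).
Proof.
move=> fC /kirchhoff_laplacianP[F [P [K k0]]] Hf nf; split; [exact: Hf|move=> g Hg].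
have [rF _ pP] := K.
have lim0 b gamma Ss : finite_volume_end G gamma -> graph_representation gamma Ss ->
    normal_sum (fun e => P b e (len e)) (fun e => P b e 0) (Ss k) @[k --> \oo] --> 0.
  move=> fg rep; have [F' rF' /(_ Ss rep)] := nf gamma fg.
  rewrite (continuous_rep_unique rF' rF) => /cvg_part /(_ b); rewrite part0.
  by have [_ _ fS _] := rep; under eq_fun do rewrite (part_normal_sum _ K)//.
have [Fg rG _] := H1_derivP Hg.
have [vp vpE] := @vertex_pt_exists R G.
(* The inner product is built from four real pairings, so the flux must vanish for every choice of a
   part of [f] and a part of [g]. *)
have flux0 b b' : rsum (vertex_flux P b (fun v => part b' (Fg (vp v)))) = 0.
  have [sP sh] := edge_solution_asum b Hf K.
  have [M [[M0 sM] hM0 _ hM]] := prim_trace_asum (pP b) sP sh.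
  have sg : asum (fun e => norm2 (len e) (fun x => part b' (Fg (edge_pt e x)))).
    have := asum_norm2 b' g; congr asum; apply/funext => e.
    apply: norm2_ae (continuous_rep_ae b' e rG); first exact: rsqint_fpart.
    exact: prim_rsqint (len_ge0 e) (H1_prim Hg rG b' e).
  have [N [[N0 sN] hN0 hN1 hN]] := prim_trace_asum (H1_prim Hg rG b') sg (asum_norm2 b' (Defs.deriv g)).
  apply: (rsum_flux_eq0 fC M0 N0 sM sN hM0 hM).
  - by move=> e; have [<- _] := vpE e; exact: hN0.
  - by move=> e; have [_ <-] := vpE e; exact: hN1.
  - by move=> e; have [<- <-] := vpE e; exact: hN.
  - by move=> v; exact: k0.
  - exact: lim0.
have E1 b b' : rsum (pairing b b' (Defs.deriv f) (Defs.deriv g)) = rsum (pairing b b' h g).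
  apply/eqP; rewrite -subr_eq0 -rsumB; [|exact: asum_pairing|exact: asum_pairing].
  rewrite -(flux0 b b'); apply/eqP; congr rsum; apply/funext => e.
  by rewrite (edge_solution_ibp b b' e Hf K Hg rG) /vertex_flux /flux; have [-> ->] := vpE e.
by rewrite /neumann_form !dotpE !E1.
Qed.

End Main.

Theorem corollary6p7 (R : realType) (G : metricGraph R)
  (finite_C0 : finite_set (finite_volume_end G)) :
  dom (neumann_extension G) =
    [set f | [/\ dom (kirchhoff_laplacian G) f, H1 G f
       & forall gamma, finite_volume_end G gamma -> is_normal_deriv f gamma 0]]
  /\ neumann_extension G =
       restriction (kirchhoff_laplacian G) (dom (neumann_extension G)).
Proof.
split; apply/seteqP; split.
- move=> f [h N]; split; first by exists h; exact: neumann_kirchhoff.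
    by case: N.
  by move=> gamma; exact: neumann_normal_deriv N.
- by move=> f [[h K] Hf nf]; exists h; exact: kirchhoff_neumann.
- by move=> [f h] N; split; [exact: neumann_kirchhoff|exists h].
(* A priori [h'] may differ from [h]; it only shows that [f] is in H^1 with zero normal derivatives,
   and the converse inclusion then applies to [h] itself. *)
- move=> [f h] [K [h' N]]; apply: kirchhoff_neumann => //; first by case: N.
  by move=> gamma; exact: neumann_normal_deriv N.
Qed.
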